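(* Let $G$ be a connected Lie group of dimension $n$ with Lie algebra $\mathfrak{g}$, let $\{\mathcal{X},Y_1,\dots,Y_{n-1}\}$ define a simple almost-Riemannian structure on $G$, let $\Delta=\mathrm{Span}\{Y_1,\dots,Y_{n-1}\}\subset\mathfrak{g}$, and let $D$ be the derivation of $\mathfrak{g}$ associated to $\mathcal{X}$. If the Lie algebra $\mathfrak{g}$ is solvable and $\Delta$ is a subalgebra of $\mathfrak{g}$, then the singular locus $\mathcal{Z}$ is a codimension one subgroup of $G$ whose Lie algebra is $\mathfrak{z}=D^{-1}\Delta$.
   Context: The Lie algebra $\mathfrak{g}$ is the set of left-invariant vector fields on $G$, identified with $T_eG$. A vector field $\mathcal{X}$ on $G$ is linear if its flow is a one-parameter group of automorphisms of $G$; then $[\mathcal{X},Y]\in\mathfrak{g}$ for all $Y\in\mathfrak{g}$, and the associated derivation $D$ of $\mathfrak{g}$ is $DY=-[\mathcal{X},Y]$. A simple almost-Riemannian structure (ARS) on $G$ is defined by $n=\dim G$ vector fields $\{\mathcal{X},Y_1,\dots,Y_{n-1}\}$ (declared orthonormal) such that $\mathcal{X}$ is linear, $Y_1,\dots,Y_{n-1}$ are left-invariant, the rank of $\mathcal{X},Y_1,\dots,Y_{n-1}$ is $n$ on a nonempty subset of $G$, and the rank condition holds: at every point $g\in G$ the Lie algebra of vector fields generated by $\mathcal{X},Y_1,\dots,Y_{n-1}$ spans $T_gG$. The singular locus is $\mathcal{Z}=\{g\in G:\ \mathrm{rank}(\mathcal{X}(g),Y_1(g),\dots,Y_{n-1}(g))<n\}$.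 Notation: $D^{-1}\Delta=\{Y\in\mathfrak{g}: DY\in\Delta\}$. *)

(* Defs.v *)
From HB Require Import structures.
From mathcomp Require Import all_boot all_order all_algebra.
From mathcomp Require Import all_classical all_reals all_analysis.
Set Implicit Arguments.
Unset Strict Implicit.
Unset Printing Implicit Defensive.
Import Order.TTheory GRing.Theory Num.Theory.
Import numFieldNormedType.Exports.
Local Open Scope classical_set_scope.
Local Open Scope ring_scope.

(* Smooth means C^oo.  The spaces V and W below are always finite-dimensional,
   so the iterated directional derivatives, all existing and continuous on one
   neighbourhood of x, give smoothness in the usual sense. *)
Definition iter_derive (R : realType) (V W : normedModType R) (f : V -> W)
    (vs : seq V) : V -> W :=
  foldr (fun v g => 'D_v g) f vs.

Definition smooth_at (R : realType) (V W : normedModType R) (f : V -> W)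
    (x : V) : Prop :=
  \forall y \near x, forall vs : seq V,
    {for y, continuous (iter_derive f vs)} /\
    forall v, derivable (iter_derive f vs) y v.

(* [chart_map] and [chart_inv] are total functions; only their restrictions to
   [chart_dom] and to [chart_map @` chart_dom] matter, where they are mutually
   inverse. *)
Record chart (R : realType) (n : nat) (M : topologicalType) := Chart {
  chart_dom : set M;
  chart_map : M -> 'rV[R]_n;
  chart_inv : 'rV[R]_n -> M;
  open_chart_dom : open chart_dom;
  open_chart_codom : open (chart_map @` chart_dom);
  chart_mapK : {in chart_dom, cancel chart_map chart_inv};
  chart_map_continuous : {in chart_dom, continuous chart_map};
  chart_inv_continuous : {in chart_map @` chart_dom, continuous chart_inv} }.

Definition compatible (R : realType) (n : nat) (M : topologicalType)
    (a b : chart R n M) : Prop :=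
  forall p, chart_dom a p -> chart_dom b p ->
    smooth_at (chart_map b \o chart_inv a) (chart_map a p) /\
    smooth_at (chart_map a \o chart_inv b) (chart_map b p).

HB.mixin Record isManifold (R : realType) (n : nat) M of Topological M := {
  atlas : set (chart R n M);
  atlas_cover : forall p : M, exists2 a, atlas a & chart_dom a p;
  atlas_compatible : forall a b, atlas a -> atlas b -> compatible a b;
  manifold_hausdorff : hausdorff_space M;
  manifold_second_countable : @second_countable M }.

#[short(type="manifoldType")]
HB.structure Definition Manifold (R : realType) (n : nat) :=
  {M of isManifold R n M & Topological M}.

Arguments atlas {R n} s.

HB.mixin Record Manifold_isLieGroup (R : realType) (n : nat) G
    of Manifold R n G & Group G := {
  lie_mul_continuous : continuous (fun p : G * G => (p.1 * p.2)%g : G);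
  lie_inv_continuous : continuous (fun g : G => g^-1%g : G);
  lie_mul_smooth : forall (a b c : chart R n G) (g h : G),
    atlas G a -> atlas G b -> atlas G c ->
    chart_dom a g -> chart_dom b h -> chart_dom c (g * h)%g ->
    smooth_at (fun xy : 'rV[R]_n * 'rV[R]_n =>
        chart_map c (chart_inv a xy.1 * chart_inv b xy.2)%g)
      (chart_map a g, chart_map b h);
  lie_inv_smooth : forall (a b : chart R n G) (g : G),
    atlas G a -> atlas G b -> chart_dom a g -> chart_dom b (g^-1)%g ->
    smooth_at (fun x : 'rV[R]_n => chart_map b ((chart_inv a x)^-1)%g) (chart_map a g) }.

#[short(type="lieGroupType")]
HB.structure Definition LieGroup (R : realType) (n : nat) :=
  {G of Manifold_isLieGroup R n G & Manifold R n G & Group G}.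

(* A function is smooth near p when it is smooth near p in charts; its values
   away from p are irrelevant, so it stands for a germ at p. *)
Definition smooth_germ (R : realType) (n : nat) (M : manifoldType R n)
    (p : M) (f : M -> R) : Prop :=
  forall a, atlas M a -> chart_dom a p ->
    smooth_at (f \o chart_inv a : _ -> R^o) (chart_map a p).

Definition smooth_map (R : realType) (n : nat) (M : manifoldType R n)
    (F : M -> M) : Prop :=
  continuous F /\
  forall (a b : chart R n M) (p : M), atlas M a -> atlas M b ->
    chart_dom a p -> chart_dom b (F p) ->
    smooth_at (chart_map b \o F \o chart_inv a) (chart_map a p).

(* Tangent vectors are derivations of germs.  They are represented as
   functionals on all functions, sent to 0 when not smooth near p, so that
   equality of tangent vectors is Leibniz equality. *)
Definition tangent_space (R : realType) (n : nat) (M : manifoldType R n) (p : M) :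
    set ((M -> R) -> R) :=
  [set v | [/\ forall f, ~ smooth_germ p f -> v f = 0,
    forall f g, smooth_germ p f -> smooth_germ p g ->
      (\forall q \near p, f q = g q) -> v f = v g,
    forall (c : R) f g, smooth_germ p f -> smooth_germ p g ->
      v (c *: f + g) = c * v f + v g &
    forall f g, smooth_germ p f -> smooth_germ p g ->
      v (f * g) = f p * v g + g p * v f]].

(* [X p f] is the derivative at p of f along X. *)
Notation vfield R M := (M -> (M -> R) -> R).

Definition vector_field (R : realType) (n : nat) (M : manifoldType R n) :
    set (vfield R M) :=
  [set X | (forall p, tangent_space p (X p)) /\
    forall p f, smooth_germ p f -> smooth_germ p (fun q => X q f)].

Definition bracket (R : realType) (n : nat) (M : manifoldType R n)
    (X Y : vfield R M) : vfield R M :=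
  fun p f => if `[< smooth_germ p f >]
    then X p (fun q => Y q f) - Y p (fun q => X q f) else 0.

Definition lie_subalgebra (R : realType) (n : nat) (M : manifoldType R n)
    (A : set (vfield R M)) : Prop :=
  [/\ A `<=` @vector_field R n M, submod_closed [in A] &
    forall X Y, A X -> A Y -> A (bracket X Y)].

Definition lie_generated (R : realType) (n : nat) (M : manifoldType R n)
    (S : set (vfield R M)) : set (vfield R M) :=
  smallest (@lie_subalgebra R n M) S.

Definition linear_span (R : realType) (V : lmodType R) (S : set V) : set V :=
  smallest (fun W : set V => submod_closed [in W]) S.

Fixpoint derived_algebra (R : realType) (n : nat) (M : manifoldType R n)
    (A : set (vfield R M)) (k : nat) : set (vfield R M) :=
  if k is k'.+1 then
    linear_span [set bracket X Y | X in derived_algebra A k'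
                                 & Y in derived_algebra A k']
  else A.

Definition lie_solvable (R : realType) (n : nat) (M : manifoldType R n)
    (A : set (vfield R M)) : Prop :=
  exists k, derived_algebra A k = [set 0].

Definition lin_independent (R : realType) (V : lmodType R) (k : nat)
    (J : {set 'I_k}) (v : 'I_k -> V) : Prop :=
  forall c : 'I_k -> R, \sum_(i in J) c i *: v i = 0 ->
    forall i, i \in J -> c i = 0.

Definition family_rank (R : realType) (V : lmodType R) (k : nat)
    (v : 'I_k -> V) : nat :=
  \max_(J : {set 'I_k} | `[< lin_independent J v >]) #|J|.

Definition left_invariant (R : realType) (n : nat) (G : lieGroupType R n) :
    set (vfield R G) :=
  [set Y | vector_field Y /\
    forall (g h : G) (f : G -> R), smooth_germ (g * h)%g f ->
      Y (g * h)%g f = Y h (fun x => f (g * x)%g)].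

Definition lie_automorphism (R : realType) (n : nat) (G : lieGroupType R n)
    (F : G -> G) : Prop :=
  [/\ {morph F : x y / (x * y)%g}, smooth_map F &
    exists F', [/\ cancel F F', cancel F' F & smooth_map F']].

Definition integral_curve (R : realType) (n : nat) (M : manifoldType R n)
    (X : vfield R M) (c : R -> M) : Prop :=
  continuous c /\
  forall t f, smooth_germ (c t) f ->
    is_derive (t : R^o) (1 : R^o) (f \o c : R^o -> R^o) (X (c t) f).

Definition flow_of (R : realType) (n : nat) (M : manifoldType R n)
    (X : vfield R M) (phi : R -> M -> M) : Prop :=
  forall p, phi 0 p = p /\ integral_curve X (phi ^~ p).

Definition linear_field (R : realType) (n : nat) (G : lieGroupType R n) :
    set (vfield R G) :=
  [set X | vector_field X /\ exists phi : R -> G -> G,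
    [/\ flow_of X phi, forall s t, phi (s + t) = phi s \o phi t &
      forall t, lie_automorphism (phi t)]].

Definition frame (R : realType) (n : nat) (G : lieGroupType R n.+1)
    (X : vfield R G) (Y : 'I_n -> vfield R G) : 'I_n.+1 -> vfield R G :=
  fun i => if unlift ord0 i is Some j then Y j else X.

Definition singular_locus (R : realType) (n : nat) (G : lieGroupType R n.+1)
    (X : vfield R G) (Y : 'I_n -> vfield R G) : set G :=
  [set g | (family_rank (fun i => frame X Y i g) < n.+1)%N].

Definition simple_ARS (R : realType) (n : nat) (G : lieGroupType R n.+1)
    (X : vfield R G) (Y : 'I_n -> vfield R G) : Prop :=
  [/\ linear_field X, forall i, left_invariant (Y i),
    exists g, family_rank (fun i => frame X Y i g) = n.+1 &
    forall g, [set W g | W in lie_generated (range (frame X Y))] =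
      tangent_space g].

Definition assoc_derivation (R : realType) (n : nat) (G : lieGroupType R n)
    (X Y : vfield R G) : vfield R G :=
  - bracket X Y.

(* Local slice condition: near each of its points, S is the vanishing locus of
   the coordinates of index >= d in some chart of the smooth structure. *)
Definition embedded_submanifold (R : realType) (n : nat) (M : manifoldType R n)
    (d : nat) (S : set M) : Prop :=
  (d <= n)%N /\
  forall p, S p -> exists a : chart R n M,
    [/\ forall b, atlas M b -> compatible a b, chart_dom a p &
      forall q, chart_dom a q ->
        (S q <-> forall i : 'I_n, (d <= i)%N -> chart_map a q 0 i = 0)].

(* Velocities at p of smooth curves contained in S. *)
Definition tangent_to (R : realType) (n : nat) (M : manifoldType R n)
    (S : set M) (p : M) : set ((M -> R) -> R) :=
  [set v | tangent_space p v /\ exists c : R -> M,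
    [/\ c 0 = p, \forall t \near (0 : R), S (c t), {for 0, continuous c},
      forall a, atlas M a -> chart_dom a p ->
        smooth_at (chart_map a \o c : R^o -> _) (0 : R^o) &
      forall f, smooth_germ p f ->
        is_derive (0 : R^o) (1 : R^o) (f \o c : R^o -> R^o) (v f)]].

(* The Lie algebra of a Lie subgroup H, inside that of G. *)
Definition lie_algebra_of (R : realType) (n : nat) (G : lieGroupType R n)
    (H : set G) : set (vfield R G) :=
  [set Y | left_invariant Y /\ tangent_to H 1%g (Y 1%g)].

(* Main.v *)
Require Import Defs.
From HB Require Import structures.
From mathcomp Require Import all_boot all_order all_algebra perm.
From mathcomp Require Import all_classical all_reals all_analysis.
From mathcomp Require Import ring lra.
Import Order.TTheory GRing.Theory Num.Theory.
Import numFieldNormedType.Exports.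
Local Open Scope classical_set_scope.
Local Open Scope ring_scope.
Set Implicit Arguments.
Unset Strict Implicit.
Unset Printing Implicit Defensive.

(** Let [Y_0] be a left-invariant field completing the fields of the family [Y]
to a basis of the Lie algebra g of the group ([ars_basis]).  Write
X = sum_i a_i Y_i with smooth functions a_i on the group ([field_coef]); the
singular locus is the zero set of f = a_0.  Let om be the linear form on g that
vanishes on Delta, the span of [Y], and takes the value 1 at [Y_0].

Differentiating X along a left-invariant field A gives
A f = om (D A) - om [A, X_p] at the point p, where X_p is read as the
left-invariant field with the same value at p ([coef_derivative]).  Since Delta
is a subalgebra of codimension one of a solvable algebra, g has a character la
such that la o D = 0 and om [a, x] = la a * om x whenever la x = 0
([codim1_character]).  The function p |-> la (X_p) then has zero derivative
along every left-invariant field, and it vanishes at 1, where X does; so it is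
zero, and f satisfies a closed equation ([singular_locus_function]):

  A f = om (D A) - la A * f    for all left-invariant A.

If f g = 0, the function h |-> f (g h) - f h vanishes at 1 and solves the
homogeneous linear equation A u = - la A * u; a Gronwall argument and the
connectedness of the group make it zero ([propagation]).  Hence f (g h) = f h,
and the zero set of f is a subgroup.  On this zero set A f = om (D A), and
om o D is not zero, as otherwise Delta would be stable under D and the Lie
algebra generated by X and [Y] would span no more than Delta at 1, where X
vanishes.  So f is a submersion along its zero set, which is therefore a
hypersurface ([submersion_chart]); its tangent space at 1 is formed by the
values of the fields A such that om (D A) = 0, that is, such that D A lies in
Delta ([tangent_to_level]).

The underlying calculus treats tangent vectors as derivations of germs.
Hadamard's lemma computes them in coordinates ([tangent_admissible]), the
symmetry of second derivatives makes the bracket of a linear and a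
left-invariant field left-invariant ([bracket_linear_left_invariant]), and
slice charts come from an inverse function theorem in which a single coordinate
changes ([repl_coord_inv_smooth]). *)

(** * Functions of class C^k through directional derivatives *)
Section Ck.
Context {R : realType}.

(** A recursion on k in place of lists of directions: every closure property
follows by induction on k from the rule for one directional derivative. *)
Fixpoint Ck (V W : normedModType R) (k : nat) (U : set V) (f : V -> W) : Prop :=
  (forall x, U x -> {for x, continuous f}) /\
  (if k is k'.+1 then
     (forall x v, U x -> derivable f x v) /\ forall v, Ck k' U ('D_v f)
   else True).

Definition smooth_on (V W : normedModType R) (U : set V) (f : V -> W) :=
  forall k, Ck k U f.

Section General.
Context {V W : normedModType R}.
Implicit Types (U : set V) (f g : V -> W).

Lemma Ck_continuous k U f x : Ck k U f -> U x -> {for x, continuous f}.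
Proof. by case: k => [|k] [fc _] Ux; exact: fc. Qed.

Lemma Ck_derivable k U f x v : Ck k.+1 U f -> U x -> derivable f x v.
Proof. by case=> _ [fd _]; exact: fd. Qed.

Lemma Ck_derive k U f v : Ck k.+1 U f -> Ck k U ('D_v f).
Proof. by case=> _ [_]; exact. Qed.

Lemma CkS k U f : Ck k.+1 U f -> Ck k U f.
Proof.
elim: k f => [|k IH] f; first by case=> fc _; split.
move=> [fc [fd fD]]; split => //; split => // v.
by apply: IH; exact: fD.
Qed.

Lemma Ck_sub k U U' f : U' `<=` U -> Ck k U f -> Ck k U' f.
Proof.
move=> sU; elim: k f => [|k IH] f; first by case=> fc _; split => // x /sU /fc.
move=> [fc [fd fD]]; split=> [x /sU /fc//|]; split=> [x v /sU /fd //|v].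
by apply: IH; exact: fD.
Qed.

Lemma Ck_eq k U f g : open U -> Ck k U f ->
  (forall x, U x -> f x = g x) -> Ck k U g.
Proof.
move=> oU; elim: k f g => [|k IH] f g fk fg; move: fk.
  case=> fc _; split => // x Ux.
  have nfg : \near x, f x = g x.
    by have := open_nbhs_nbhs (conj oU Ux); apply: filterS => y /fg.
  rewrite /prop_for /continuous_at -(fg x Ux).
  exact: cvg_trans (near_eq_cvg nfg) (fc x Ux).
move=> [fc [fd fD]]; have nfg x (Ux : U x) : \near x, f x = g x.
  by have := open_nbhs_nbhs (conj oU Ux); apply: filterS => y /fg.
split.
  move=> x Ux; rewrite /prop_for /continuous_at -(fg x Ux).
  exact: cvg_trans (near_eq_cvg (nfg _ Ux)) (fc x Ux).
split=> [x v Ux|v]; first exact: near_eq_derivable (nfg _ Ux) (fd _ _ Ux).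
by apply: (IH _ _ (fD v)) => x Ux; apply: near_eq_derive; exact: nfg.
Qed.

Lemma Ck_cst k U (c : W) : Ck k U (cst c).
Proof.
elim: k c => [|k IH] c; first by split => // x _; exact: cvg_cst.
split=> [x _|]; first exact: cvg_cst.
split=> [x v _|v]; first exact: derivable_cst.
by have -> : 'D_v (cst c) = cst (0 : W); [apply/funext => x; rewrite derive_cst|].
Qed.

Lemma CkD k U f g : open U -> Ck k U f -> Ck k U g -> Ck k U (f \+ g).
Proof.
move=> oU; elim: k f g => [|k IH] f g.
  by move=> [fc _] [gc _]; split => // x Ux; apply: cvgD; [exact: fc|exact: gc].
move=> [fc [fd fD]] [gc [gd gD]]; split.
  by move=> x Ux; apply: cvgD; [exact: fc|exact: gc].
split=> [x v Ux|v]; first by apply: derivableD; [exact: fd|exact: gd].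
apply: (Ck_eq oU (IH _ _ (fD v) (gD v))) => x Ux /=.
by rewrite deriveD//; [exact: fd|exact: gd].
Qed.

Lemma CkZ k U (c : R) f : open U -> Ck k U f -> Ck k U (c \*: f).
Proof.
move=> oU; elim: k f => [|k IH] f.
  by move=> [fc _]; split => // x Ux; apply: cvgZl_tmp; exact: fc.
move=> [fc [fd fD]]; split; first by move=> x Ux; apply: cvgZl_tmp; exact: fc.
split=> [x v Ux|v]; first by apply: derivableZ; exact: fd.
apply: (Ck_eq oU (IH _ (fD v))) => x Ux /=.
by rewrite deriveZ//; exact: fd.
Qed.

Lemma Ck_sum (I : Type) (r : seq I) (P : pred I) (F : I -> V -> W) k U :
  open U -> (forall i, P i -> Ck k U (F i)) ->
  Ck k U (fun x => \sum_(i <- r | P i) F i x).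
Proof.
move=> oU FU; elim: r => [|i r IH].
  by apply: (Ck_eq oU (@Ck_cst k U 0)) => x _; rewrite big_nil.
case Pi: (P i).
  by apply: (Ck_eq oU (CkD oU (FU i Pi) IH)) => x _; rewrite /= big_cons Pi.
by apply: (Ck_eq oU IH) => x _; rewrite big_cons Pi.
Qed.

(** Smooth functions form the largest class of continuous derivable functions
stable under directional derivatives; this principle is how the recursive
definition is reached from the list-indexed one. *)
Lemma smooth_on_ind (P : (V -> W) -> Prop) U :
  (forall f, P f -> [/\ forall x, U x -> {for x, continuous f},
    forall x v, U x -> derivable f x v & forall v, P ('D_v f)]) ->
  forall f, P f -> smooth_on U f.
Proof.
move=> H f Pf k; elim: k f Pf => [|k IH] f /H[fc fd fD]; first by split.
by split=> //; split=> // v; apply: IH.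
Qed.

Lemma smooth_on_derive U f v : smooth_on U f -> smooth_on U ('D_v f).
Proof. by move=> fU k; exact: Ck_derive (fU k.+1). Qed.

Lemma iter_derive_rcons f vs v :
  iter_derive f (rcons vs v) = iter_derive ('D_v f) vs.
Proof. by rewrite /iter_derive -cats1 foldr_cat. Qed.

Lemma smooth_onP U f : smooth_on U f <->
  forall y, U y -> forall vs : seq V,
    {for y, continuous (iter_derive f vs)} /\
    forall v, derivable (iter_derive f vs) y v.
Proof.
split=> [fU y Uy vs|].
  elim/last_ind: vs f fU => [|vs v IH] f fU.
    split=> [|v]; first exact: Ck_continuous (fU 0%N) Uy.
    exact: Ck_derivable (fU 1%N) Uy.
  by rewrite iter_derive_rcons; apply: IH; exact: smooth_on_derive.
apply: (@smooth_on_ind (fun f => forall y, U y -> forall vs : seq V,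
  {for y, continuous (iter_derive f vs)} /\
  forall v, derivable (iter_derive f vs) y v)) => {}f H; split.
- by move=> x Ux; have [] := H x Ux [::].
- by move=> x v Ux; have [_] := H x Ux [::]; apply.
- by move=> v y Uy vs; rewrite -iter_derive_rcons; exact: H.
Qed.

Lemma smooth_atP f x : smooth_at f x <->
  exists U, [/\ open U, U x & smooth_on U f].
Proof.
split; last first.
  move=> [U [oU Ux /smooth_onP fU]]; have := open_nbhs_nbhs (conj oU Ux).
  exact: filterS.
rewrite /smooth_at -nbhs_nearE nbhsE => -[U [oU Ux] sU]; exists U; split=> //.
exact/smooth_onP.
Qed.

Lemma smooth_at_nbhs f x (U0 : set V) : smooth_at f x -> nbhs x U0 ->
  exists U, [/\ open U, U x, U `<=` U0 & smooth_on U f].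
Proof.
move=> /smooth_atP[U [oU Ux fU]]; rewrite nbhsE => -[U1 [oU1 U1x] sU1].
exists (U `&` U1); split=> //; first exact: openI.
  by move=> y [_ /sU1].
by move=> k; apply: Ck_sub (fU k) => y [].
Qed.

Lemma smooth_at_ext f g x : (\forall y \near x, f y = g y) ->
  smooth_at f x -> smooth_at g x.
Proof.
move=> fg /smooth_at_nbhs -/(_ _ fg)[U [oU Ux sU fU]].
by apply/smooth_atP; exists U; split=> // k; apply: (Ck_eq oU (fU k)) => y /sU.
Qed.

Lemma smooth_at_near f x : smooth_at f x -> \forall y \near x, smooth_at f y.
Proof.
move=> /smooth_atP[U [oU Ux fU]]; have := open_nbhs_nbhs (conj oU Ux).
by apply: filterS => y Uy; apply/smooth_atP; exists U.
Qed.

Lemma smooth_at_continuous f x : smooth_at f x -> {for x, continuous f}.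
Proof. by move=> /smooth_atP[U [oU Ux /(_ 0%N)[fU _]]]; exact: fU. Qed.

Lemma smooth_at_derivable f x v : smooth_at f x -> derivable f x v.
Proof. by move=> /smooth_atP[U [oU Ux /(_ 1%N)[_ [fU _]]]]; exact: fU. Qed.

Lemma smooth_at_derive f x v : smooth_at f x -> smooth_at ('D_v f) x.
Proof.
move=> /smooth_atP[U [oU Ux fU]]; apply/smooth_atP; exists U; split=> //.
exact: smooth_on_derive.
Qed.

End General.

Section Scalar.
Context {V : normedModType R}.
Implicit Types (U : set V) (f g : V -> R^o).

Lemma CkM k U f g : open U -> Ck k U f -> Ck k U g ->
  Ck k U (fun x => f x * g x : R^o).
Proof.
move=> oU; elim: k f g => [|k IH] f g.
  by move=> [fc _] [gc _]; split => // x Ux; apply: cvgM; [exact: fc|exact: gc].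
move=> fk gk; have [fc [fd fD]] := fk; have [gc [gd gD]] := gk; split.
  by move=> x Ux; apply: cvgM; [exact: fc|exact: gc].
split=> [x v Ux|v]; first by apply: derivableM; [exact: fd|exact: gd].
apply: (Ck_eq oU (CkD oU (IH _ _ (CkS fk) (gD v)) (IH _ _ (CkS gk) (fD v)))).
by move=> x Ux /=; rewrite deriveM//; [exact: fd|exact: gd].
Qed.

Lemma CkV k U f : open U -> (forall x, U x -> f x != 0) -> Ck k U f ->
  Ck k U (fun x => (f x)^-1 : R^o).
Proof.
move=> oU f0; elim: k => [|k IH].
  by move=> [fc _]; split => // x Ux; apply: cvgV; [exact: f0|exact: fc].
move=> fk; have [fc [fd fD]] := fk; have Vk := IH (CkS fk); split.
  by move=> x Ux; apply: cvgV; [exact: f0|exact: fc].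
split=> [x v Ux|v]; first by apply: derivableV; [exact: f0|exact: fd].
apply: (Ck_eq oU (CkZ (-1) oU (CkM oU (CkM oU Vk Vk) (fD v)))).
move=> x Ux /=; rewrite deriveV//; [|exact: f0|exact: fd].
by rewrite scaleN1r -exprVn expr2 scaleNr.
Qed.

End Scalar.

End Ck.

(** * Affine reparametrisations and differentiability of C^1 functions *)
Section Affine.
Context {R : realType} {V' V W : normedModType R}.

(** A directional derivative only sees the restriction of the function to a
line, so precomposition by an affine map merely changes the direction, even when
the function is not differentiable. *)
Lemma derivable_affine (f : V -> W) (A : V' -> V) y w w' :
  (forall h : R, A (h *: w + y) = h *: w' + A y) ->
  derivable f (A y) w' -> derivable (f \o A) y w.
Proof.
by move=> AE; rewrite /derivable /=; under [X in _ -> cvg (X @ _)]eq_fun do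
  rewrite AE.
Qed.

Lemma derive_affine (f : V -> W) (A : V' -> V) y w w' :
  (forall h : R, A (h *: w + y) = h *: w' + A y) ->
  'D_w (f \o A) y = 'D_w' f (A y).
Proof.
move=> AE; rewrite /derive.
suff -> : (fun h : R => h^-1 *: (((f \o A) \o shift y) (h *: w) - (f \o A) y)) =
  (fun h => h^-1 *: ((f \o shift (A y)) (h *: w') - f (A y))) by [].
by apply/funext => h /=; rewrite AE.
Qed.

Lemma Ck_affine k (U : set V) (f : V -> W) (A : V' -> V) (L : V' -> V) :
  continuous A -> (forall y (h : R) w, A (h *: w + y) = h *: L w + A y) ->
  Ck k U f -> Ck k (A @^-1` U) (f \o A).
Proof.
move=> cA AE; elim: k f => [|k IH] f.
  by move=> [fc _]; split=> // x Ux; apply: (@continuous_comp _ _ _ A f x); [exact: cA|exact: fc].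
move=> [fc [fd fD]]; split.
  by move=> x Ux; apply: (@continuous_comp _ _ _ A f x); [exact: cA|exact: fc].
split=> [y w Uy|w]; first by apply: derivable_affine; [move=> h; exact: AE|exact: fd].
have -> : 'D_w (f \o A) = 'D_(L w) f \o A.
  by apply/funext => y; apply: derive_affine => h; exact: AE.
exact: IH (fD _).
Qed.

End Affine.

Section Line.
Context {R : realType} {V : normedModType R}.

Lemma line_derivable (W : normedModType R) (f : V -> W) x v (t : R) :
  derivable f (t *: v + x) v -> derivable (fun s : R => f (s *: v + x)) t 1.
Proof.
apply: (@derivable_affine _ _ _ _ f (fun s : R => s *: v + x)) => h.
by rewrite [_%:A]mulr1 scalerDl addrA.
Qed.

Lemma line_derive (W : normedModType R) (f : V -> W) x v (t : R) :
  'D_1 (fun s : R => f (s *: v + x)) t = 'D_v f (t *: v + x).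
Proof.
apply: (@derive_affine _ _ _ _ f (fun s : R => s *: v + x)) => h.
by rewrite [_%:A]mulr1 scalerDl addrA.
Qed.

Lemma line_continuous (x v : V) : continuous (fun s : R => s *: v + x).
Proof.
move=> s; apply: cvgD; last exact: cvg_cst.
by apply: cvgZr_tmp; exact: cvg_id.
Qed.

(** Homogeneity in the direction reduces to the function s |-> f (s v + x) of one
variable, for which derivability is differentiability. *)
Lemma derivable_scale (W : normedModType R) (f : V -> W) x v (c : R) :
  derivable f x v -> derivable f x (c *: v) /\ 'D_(c *: v) f x = c *: 'D_v f x.
Proof.
move=> fd; pose g (s : R) := f (s *: v + x).
have gd : derivable g 0 1 by apply: line_derivable; rewrite scale0r add0r.
have g1 : 'D_1 g 0 = 'D_v f x by rewrite line_derive scale0r add0r.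
have dg : differentiable g 0 by exact/derivable1_diffP.
have E : 'D_(c *: v) f x = 'D_c g 0.
  have -> : 'D_(c *: v) f x = 'D_(c *: v) f (0 *: v + x) by rewrite scale0r add0r.
  apply/esym/(@derive_affine _ _ _ _ f (fun s : R => s *: v + x)) => h.
  by rewrite addr0 scale0r add0r scalerA.
split.
  have : derivable g 0 c by exact: diff_derivable.
  rewrite /derivable /g /=.
  have -> : (fun h : R => h^-1 *: (f ((h *: c + 0) *: v + x) - f (0 *: v + x))) =
    (fun h => h^-1 *: (f (h *: (c *: v) + x) - f x)); last by [].
  by apply/funext => h; rewrite addr0 scale0r add0r scalerA.
rewrite E deriveE// -[c in LHS]mulr1 -[c * 1]/(c *: 1) linearZ/=.
by rewrite -deriveE// g1.
Qed.

Lemma segment_MVT (f : V -> R^o) x v :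
  (forall t : R, 0 <= t <= 1 -> derivable f (t *: v + x) v) ->
  exists2 t : R, 0 < t < 1 & f (v + x) - f x = 'D_v f (t *: v + x).
Proof.
move=> fd; pose g (s : R) : R := f (s *: v + x).
have gd (t : R) : t \in `]0, 1[%R -> is_derive t 1 g ('D_v f (t *: v + x)).
  rewrite in_itv/= => /andP[t0 t1].
  apply: DeriveDef; last exact: line_derive.
  by apply: line_derivable; apply: fd; rewrite !ltW.
have gc : {within `[0, 1], continuous g}.
  apply: derivable_within_continuous => t; rewrite in_itv/= => t01.
  by apply: line_derivable; exact: fd.
have [t] := MVT ltr01 gd gc.
rewrite in_itv/= => t01; rewrite subr0 mulr1 /g scale1r scale0r add0r => gE.
by exists t.
Qed.

End Line.

Section Differentiability.
Context {R : realType}.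

Lemma rV_norm_le m (x : 'rV[R]_m) (M : R) : 0 <= M ->
  (forall i, `|x 0 i| <= M) -> `|x| <= M.
Proof.
move=> M0 H; rewrite /Num.Def.normr/= mx_normrE.
by apply: bigmax_le => // -[i j] _ /=; rewrite ord1.
Qed.

Lemma rV_coord_le m (x : 'rV[R]_m) i : `|x 0 i| <= `|x|.
Proof.
rewrite [leRHS]/Num.Def.normr/= mx_normrE.
exact: (le_bigmax _ (fun ij => `|x ij.1 ij.2|) (0, i)).
Qed.

Lemma rV_coord_continuous m i (x : 'rV[R]_m) :
  {for x, continuous (fun x : 'rV[R]_m => x 0 i : R^o)}.
Proof.
apply/(@cvgrPdist_le _ _ _ _ (nbhs_filter x)) => e e0; near=> y.
have -> : x 0 i - y 0 i = (x - y) 0 i by rewrite !mxE.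
apply: (le_trans (rV_coord_le _ _)); near: y.
apply/nbhs_ballP; exists e => // y.
by rewrite -ball_normE/= => /ltW.
Unshelve. all: by end_near. Qed.

Lemma Ck_coord m k U i : Ck k U (fun x : 'rV[R]_m => x 0 i : R^o).
Proof.
case: k => [|k]; first by split=> // x _; exact: rV_coord_continuous.
have dE (x v : 'rV[R]_m) :
    derivable (fun x : 'rV[R]_m => x 0 i : R^o) x v /\
    'D_v (fun x : 'rV[R]_m => x 0 i : R^o) x = v 0 i.
  have vd : derivable (@id 'rV[R]_m) x v by exact: derivable_id.
  split; first exact: (derivable_mxP _ _ _).1 vd 0 i.
  by have := derive_mx vd; rewrite derive_id => /matrixP/(_ 0 i); rewrite mxE.
split=> [x _|]; first exact: rV_coord_continuous.
split=> [x v _|v]; first exact: (dE x v).1.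
have -> : 'D_v (fun x : 'rV[R]_m => x 0 i : R^o) = cst (v 0 i).
  by apply/funext => x; exact: (dE x v).2.
exact: Ck_cst.
Qed.

Lemma differentiable_eps (V W : normedModType R) (f : V -> W)
    (df : {linear V -> W}) x : continuous df ->
  (forall e : R, 0 < e ->
    \forall v \near 0, `|f (v + x) - f x - df v| <= e * `|v|) ->
  differentiable f x /\ forall v, 'D_v f x = df v.
Proof.
move=> cdf H.
have dE : f \o shift x = cst (f x) + df +o_ 0 id.
  apply/eqaddoP => e e0; apply: filterS (H e e0) => v.
  by rewrite !fctE /= opprD addrA.
have dfE := diff_unique cdf dE.
have fdiff : differentiable f x by apply/diff_locallyP; rewrite dfE.
by split=> // v; rewrite deriveE// dfE.
Qed.

(** The candidate for the differential of f at x. *)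
Definition dsum m (f : 'rV[R]_m -> R^o) (x v : 'rV[R]_m) : R^o :=
  \sum_i v 0 i * 'D_(delta_mx 0 i) f x.

(** The successive truncations of v are the vertices of a path from 0 to v whose
k-th step is parallel to the k-th axis. *)
Definition trunc m (v : 'rV[R]_m) (k : nat) : 'rV[R]_m :=
  \row_i (if (i < k)%N then v 0 i else 0).

(** The increment is split along the path of truncations.  On each step the mean
value theorem produces a partial derivative at a point at distance at most r
from x, hence within e of its value at x. *)
Lemma C1_increment m (f : 'rV[R]_m -> R^o) (x v : 'rV[R]_m) (r e : R) :
  0 <= e -> (forall y : 'rV[R]_m, `|y - x| <= r -> forall i,
    derivable f y (delta_mx 0 i) /\
    `|'D_(delta_mx 0 i) f y - 'D_(delta_mx 0 i) f x| <= e) ->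
  `|v| <= r -> `|f (v + x) - f x - dsum f x v| <= m%:R * e * `|v|.
Proof.
move=> e0 H vr.
have step (k : 'I_m) : `|f (trunc v k.+1 + x) - f (trunc v k + x) -
    v 0 k * 'D_(delta_mx 0 k) f x| <= e * `|v|.
  have tE : trunc v k.+1 = v 0 k *: delta_mx 0 k + trunc v k.
    apply/rowP => i; rewrite !mxE /= ltnS leq_eqVlt.
    have [ik|ik] /= := eqVneq i k; first by rewrite ik ltnn !eqxx mulr1 addr0.
    by rewrite mulr0 add0r val_eqE (negbTE ik).
  pose A (s : R) := s *: (v 0 k *: delta_mx 0 k) + (trunc v k + x).
  have AD (t : R) : 0 <= t <= 1 -> `|A t - x| <= r.
    move=> /andP[t0 t1]; rewrite /A addrA addrK.
    apply: le_trans vr; apply: rV_norm_le => // i.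
    rewrite !mxE/=; have [ik|ik] := eqVneq i k.
      rewrite ik ltnn mulr1 addr0 normrM ger0_norm//.
      by rewrite (le_trans (ler_piMl _ t1))// rV_coord_le.
    by rewrite !mulr0 add0r; case: ifP => _; rewrite ?normr0// rV_coord_le.
  have kd (t : R) (t01 : 0 <= t <= 1) :=
    derivable_scale (v 0 k) (H (A t) (AD t t01) k).1.
  have [t t01] := @segment_MVT _ _ f (trunc v k + x) (v 0 k *: delta_mx 0 k)
    (fun t t01 => (kd t t01).1).
  have {}t01 : 0 <= t <= 1 by case/andP: t01 => /ltW -> /ltW ->.
  rewrite (kd t t01).2 => fE; rewrite tE -[_ + _ + x]addrA fE.
  rewrite -[_ *: _]/(_ * _) -mulrBr normrM mulrC.
  by rewrite ler_pM//; [exact: (H _ (AD t t01) k).2|exact: rV_coord_le].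
have E : f (v + x) - f x = \sum_(k < m) (f (trunc v k.+1 + x) - f (trunc v k + x)).
  rewrite -(big_mkord xpredT (fun k => f (trunc v k.+1 + x) - f (trunc v k + x))).
  rewrite telescope_sumr//; congr (f (_ + _) - f _).
    by apply/rowP => i; rewrite mxE ltn_ord.
  by rewrite [X in X + _](_ : _ = 0) ?add0r//; apply/rowP => i; rewrite !mxE.
rewrite E /dsum -sumrB (le_trans (ler_norm_sum _ _ _))//.
apply: le_trans (ler_sum _ (fun k _ => step k)) _.
by rewrite sumr_const card_ord -mulrA mulr_natl.
Qed.

Lemma dsum_linear m (f : 'rV[R]_m -> R^o) x : linear (dsum f x).
Proof.
move=> c u v; rewrite /dsum scaler_sumr -big_split; apply: eq_bigr => i _ /=.
by rewrite !mxE mulrDl -mulrA.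
Qed.

(** [C1_increment] applies on a ball where the partial derivatives vary by at
most e / (m + 1), which absorbs the number of coordinates. *)
Lemma C1_differentiable m (f : 'rV[R]_m -> R^o) (U : set 'rV[R]_m) x :
  open U -> Ck 1 U f -> U x ->
  differentiable f x /\ forall v, 'D_v f x = dsum f x v.
Proof.
move=> oU [fc [fd fD]] Ux.
pose df : {linear 'rV[R]_m -> R^o} := HB.pack (dsum f x)
  (GRing.isLinear.Build _ _ _ _ _ (dsum_linear f x)).
have cdf : continuous df.
  move=> v; suff [H _] : Ck 0 setT (dsum f x) by exact: H.
  apply: Ck_sum => [|i _]; first exact: openT.
  exact: (CkM openT (Ck_coord 0 setT i) (@Ck_cst R _ R^o 0 setT ('D_(delta_mx 0 i) f x))).
apply: (differentiable_eps cdf) => e e0.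
pose e' := e / (m%:R + 1).
have m0 : 0 < m%:R + 1 :> R by rewrite ltr_wpDl.
have e'0 : 0 < e' by rewrite divr_gt0.
have /nbhs_ballP[r0 /= r00 r0P] : \forall y \near x, U y /\ forall i,
    `|'D_(delta_mx 0 i) f y - 'D_(delta_mx 0 i) f x| <= e'.
  near=> y; split; first by near: y; exact: (open_nbhs_nbhs (conj oU Ux)).
  near: y; apply: filter_forall => i.
  have [/(_ x Ux)/cvgrPdist_le/(_ _ e'0) + _] := fD (delta_mx 0 i).
  by apply: filterS => y; rewrite distrC.
near=> v.
have vr : `|v| <= r0 / 2.
  near: v; apply/nbhs_ballP; exists (r0 / 2); first by rewrite /= divr_gt0.
  by move=> v; rewrite -ball_normE/= sub0r normrN => /ltW.
have := @C1_increment m f x v (r0 / 2) e' (ltW e'0) _ vr.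
move=> /(_ _)/le_trans -> //.
  move=> y yr i; have [] := r0P y.
    rewrite -ball_normE/= distrC (le_lt_trans yr)// ltr_pdivrMr//.
    by rewrite ltr_pMr// ltr1n.
  by move=> Uy /(_ i) H; split=> //; exact: fd.
rewrite ler_wpM2r// /e' mulrCA ler_piMr ?(ltW e0)//.
by rewrite ler_pdivrMr// mul1r lerDl.
Unshelve. all: by end_near. Qed.

End Differentiability.

(** * Composition of smooth maps *)
Section Composition.
Context {R : realType}.

(** Restricting c to the line through x in the direction v makes both factors
differentiable; c itself may be derivable in the direction v only. *)
Lemma derive_comp (V W Z : normedModType R) (c : V -> W) (f : W -> Z) x v :
  derivable c x v -> differentiable f (c x) ->
  derivable (f \o c) x v /\ 'D_v (f \o c) x = 'D_('D_v c x) f (c x).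
Proof.
move=> cd fd; pose g (s : R) := c (s *: v + x).
have g0 : g 0 = c x by rewrite /g scale0r add0r.
have gd : derivable g 0 1 by apply: line_derivable; rewrite scale0r add0r.
have gD : differentiable g 0 by exact/derivable1_diffP.
have g1 : 'D_1 g 0 = 'D_v c x by rewrite line_derive scale0r add0r.
have fgD : differentiable (f \o g) 0 by apply: differentiable_comp; rewrite ?g0.
split; first by apply/derivable1P/derivable1_diffP.
have -> : 'D_v (f \o c) x = 'D_1 (f \o g) 0.
  by rewrite [RHS](line_derive (f \o c) x v 0) scale0r add0r.
rewrite deriveE// diff_comp ?g0//= -deriveE ?g0// -g1.
by rewrite (deriveE _ gD).
Qed.

Lemma Ck_rV (V : normedModType R) m k (U : set V) (g : V -> 'rV[R]_m) :
  open U -> Ck k U g <-> forall i, Ck k U (fun x => g x 0 i : R^o).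
Proof.
move=> oU; split.
  move=> + i; elim: k g => [|k IH] g.
    move=> [gc _]; split=> // x Ux.
    by apply: (@continuous_comp _ _ _ g (fun y : 'rV[R]_m => y 0 i : R^o) x);
      [exact: gc|exact: rV_coord_continuous].
  move=> [gc [gd gD]]; split.
    move=> x Ux.
    by apply: (@continuous_comp _ _ _ g (fun y : 'rV[R]_m => y 0 i : R^o) x);
      [exact: gc|exact: rV_coord_continuous].
  split=> [x v Ux|v]; first exact: (derivable_mxP _ _ _).1 (gd x v Ux) 0 i.
  apply: (Ck_eq oU (IH _ (gD v))) => x Ux.
  by rewrite (derive_mx (gd x v Ux)) mxE.
have gcont (h : V -> 'rV[R]_m) :
    (forall i, Ck 0 U (fun x => h x 0 i : R^o)) ->
    forall x, U x -> {for x, continuous h}.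
  move=> gi x Ux; apply/(@cvgrPdist_le _ _ _ _ (nbhs_filter x)) => e e0.
  have H i : \forall y \near x, `|h x 0 i - h y 0 i| <= e.
    have [/(_ x Ux)/(@cvgrPdist_le _ _ _ _ (nbhs_filter x))/(_ e e0) + _] := gi i.
    exact.
  have := filter_forall (nbhs_filter x) H; apply: filterS => y yH.
  by apply: rV_norm_le (ltW e0) _ => i; rewrite !mxE.
elim: k g => [|k IH] g gi; first by split=> //; exact: gcont.
split; first by apply: gcont => i; have [? _] := gi i; split.
have gd x v : U x -> derivable g x v.
  move=> Ux; apply/derivable_mxP => i j; rewrite ord1.
  exact: (Ck_derivable (gi j) Ux).
split=> // v; apply: IH => i.
apply: (Ck_eq oU (Ck_derive v (gi i))) => x Ux.
by rewrite (derive_mx (gd x v Ux)) mxE.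
Qed.

(** Induction on k: by the chain rule, which rests on the differentiability of
C^1 functions, a derivative of the composite is a sum of products of functions
to which the induction hypothesis applies. *)
Lemma Ck_comp (V : normedModType R) m k (U : set V) (O : set 'rV[R]_m)
    (g : V -> 'rV[R]_m) (f : 'rV[R]_m -> R^o) :
  open U -> open O -> (forall x, U x -> O (g x)) ->
  Ck k U g -> Ck k O f -> Ck k U (f \o g).
Proof.
move=> oU oO UO; elim: k f g UO => [|k IH] f g UO gk fk.
  move: gk fk => [gc _] [fc _]; split=> // x Ux.
  by apply: (@continuous_comp _ _ _ g f x); [exact: gc|apply: fc; exact: UO].
have gi := (Ck_rV _ _ oU).1 gk.
have [gc [gd gD]] := gk; have [fc [fd fD]] := fk.
have f1 : Ck 1 O f by split=> //; split=> // v; split=> // x Ux; exact: Ck_continuous (fD v) Ux.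
have fdiff x Ux := (C1_differentiable oO f1 (UO x Ux)).
split.
  move=> x Ux.
  by apply: (@continuous_comp _ _ _ g f x); [exact: gc|apply: fc; exact: UO].
split=> [x v Ux|v].
  exact: (derive_comp (gd x v Ux) (fdiff x Ux).1).1.
have step i : Ck k U (fun x => ('D_v g x) 0 i * ('D_(delta_mx 0 i) f \o g) x : R^o).
  apply: CkM => //; first exact: (Ck_rV _ _ oU).1 (gD v) i.
  exact: IH UO (CkS gk) (fD _).
apply: (Ck_eq oU (Ck_sum (index_enum _) oU (fun i (_ : xpredT i) => step i))).
move=> x Ux; rewrite (derive_comp (gd x v Ux) (fdiff x Ux).1).2.
by rewrite (fdiff x Ux).2.
Qed.

Lemma smooth_at_comp (V : normedModType R) m (g : V -> 'rV[R]_m)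
    (f : 'rV[R]_m -> R^o) x :
  smooth_at g x -> smooth_at f (g x) -> smooth_at (f \o g) x.
Proof.
move=> gx /smooth_atP[B [oB Bgx fB]].
have nB : nbhs x (g @^-1` B).
  by apply: (smooth_at_continuous gx); exact: (open_nbhs_nbhs (conj oB Bgx)).
have [U [oU Ux sU gU]] := smooth_at_nbhs gx nB.
by apply/smooth_atP; exists U; split=> // k; exact: (Ck_comp oU oB sU).
Qed.

Lemma smooth_at_rV (V : normedModType R) m (g : V -> 'rV[R]_m) x :
  smooth_at g x <-> forall i, smooth_at (fun x => g x 0 i : R^o) x.
Proof.
split=> [/smooth_atP[U [oU Ux gU]] i|H].
  by apply/smooth_atP; exists U; split=> // k; exact: (Ck_rV _ _ oU).1 (gU k) i.
have := filter_forall (nbhs_filter x) H.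
rewrite -nbhs_nearE nbhsE => -[U [oU Ux] sU].
apply/smooth_atP; exists U; split=> // k; apply/(Ck_rV _ _ oU) => i.
have /smooth_onP : forall y, U y -> forall vs : seq V,
    {for y, continuous (iter_derive (fun x => g x 0 i : R^o) vs)} /\
    forall v, derivable (iter_derive (fun x => g x 0 i : R^o) vs) y v.
  by move=> y /sU; exact.
exact.
Qed.

Lemma smooth_at_comp_rV (V : normedModType R) m k (g : V -> 'rV[R]_m)
    (f : 'rV[R]_m -> 'rV[R]_k) x :
  smooth_at g x -> smooth_at f (g x) -> smooth_at (f \o g) x.
Proof.
move=> gx /smooth_at_rV fi; apply/smooth_at_rV => i.
exact: (smooth_at_comp gx (fi i)).
Qed.

End Composition.

(** * Hadamard's lemma *)
Section UnitIntegral.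
Context {R : realType}.
Implicit Types (phi psi : R -> R).

(** Two-sided continuity also at the end points: the integrands below are
defined and continuous beyond [0, 1]. *)
Definition cont01 phi := forall t, 0 <= t <= 1 -> {for t, continuous phi}.

Definition int01 phi : R := \int[lebesgue_measure]_(t in `[0, 1]) phi t.

Lemma cont01_within phi : cont01 phi -> {within `[0, 1], continuous phi}.
Proof.
move=> c; apply: continuous_in_subspaceT => t; rewrite inE/= in_itv/=.
exact: c.
Qed.

Lemma cont01_integrable phi : cont01 phi ->
  lebesgue_measure.-integrable `[0, 1] (EFin \o phi).
Proof.
move=> /cont01_within c; apply: continuous_compact_integrable => //.
exact: segment_compact.
Qed.

Lemma cont01B phi psi : cont01 phi -> cont01 psi -> cont01 (fun t => phi t - psi t).
Proof. by move=> c d t t01; apply: cvgB; [exact: c|exact: d]. Qed.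

Lemma cont01Z (c : R) phi : cont01 phi -> cont01 (fun t => c * phi t).
Proof. by move=> d t t01; apply: cvgM; [exact: cvg_cst|exact: d]. Qed.

Lemma int01B phi psi : cont01 phi -> cont01 psi ->
  int01 (fun t => phi t - psi t) = int01 phi - int01 psi.
Proof. by move=> ? ?; apply: RintegralB => //; exact: cont01_integrable. Qed.

Lemma int01D phi psi : cont01 phi -> cont01 psi ->
  int01 (fun t => phi t + psi t) = int01 phi + int01 psi.
Proof. by move=> ? ?; apply: RintegralD => //; exact: cont01_integrable. Qed.

Lemma int01Z (c : R) phi : cont01 phi -> int01 (fun t => c * phi t) = c * int01 phi.
Proof. by move=> ?; apply: RintegralZl => //; exact: cont01_integrable. Qed.

Lemma eq_int01 phi psi : (forall t, 0 <= t <= 1 -> phi t = psi t) ->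
  int01 phi = int01 psi.
Proof.
by move=> H; apply: eq_Rintegral => t; rewrite inE/= in_itv/=; exact: H.
Qed.

Lemma int01_cst (c : R) : int01 (fun=> c) = c.
Proof.
have E : fine (lebesgue_measure (`[0, 1]%classic : set R)) = 1 :> R.
  by rewrite lebesgue_measure_itv/= lte_fin ltr01 oppr0 adde0.
by rewrite /int01 Rintegral_cst// [X in _ * X](_ : _ = 1) ?mulr1//; exact: E.
Qed.

Lemma int01_le phi (e : R) : cont01 phi ->
  (forall t, 0 <= t <= 1 -> `|phi t| <= e) -> `|int01 phi| <= e.
Proof.
move=> cphi H.
have cn : cont01 (fun t => `|phi t|).
  by move=> t /cphi pt; apply: (@continuous_comp _ _ _ phi (@Num.norm _ R) t) => //;
    exact: norm_continuous.
have ce : cont01 (fun=> e) by move=> t _; exact: cvg_cst.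
have le1 : `|int01 phi| <= int01 (fun t => `|phi t|).
  by apply: le_normr_Rintegral => //; exact: cont01_integrable.
have le2 : int01 (fun t => `|phi t|) <= int01 (fun=> e).
  apply: le_Rintegral => //; [exact: (cont01_integrable cn)|exact: (cont01_integrable ce)].
by rewrite (le_trans le1)// (le_trans le2)// int01_cst.
Qed.

Lemma int01_FTC (F : R -> R) :
  (forall t, 0 <= t <= 1 -> derivable F t 1) -> cont01 ('D_1 F) ->
  int01 ('D_1 F) = F 1 - F 0.
Proof.
move=> Fd Fc.
have dc t : 0 <= t <= 1 -> {for t, continuous F}.
  by move=> /Fd Ft; apply: differentiable_continuous; exact/derivable1_diffP.
rewrite /int01 /Rintegral (@continuous_FTC2 _ _ F)//.
- exact: cont01_within.
- split.
  + by move=> t; rewrite in_itv/= => /andP[t0 t1]; apply: Fd; rewrite !ltW.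
  + by apply: cvg_at_right_filter; apply: dc; rewrite lexx ler01.
  + by apply: cvg_at_left_filter; apply: dc; rewrite lexx ler01.
- by move=> t _; rewrite derive1E.
Qed.

End UnitIntegral.

Section RayIntegral.
Context {R : realType} {V : normedModType R}.
Variables (U : set V) (x0 : V).
Hypothesis oU : open U.

(** The homothety of ratio t centred at x0. *)
Definition ray (t : R) (x : V) := t *: (x - x0) + x0.

Hypothesis starU : forall x t, U x -> 0 <= t <= 1 -> U (ray t x).

(** The weight t^k is forced by differentiation under the integral sign: each
derivative of h (ray t x) in x brings out a factor t. *)
Definition rayint (k : nat) (h : V -> R^o) : V -> R^o :=
  fun x => int01 (fun t => t ^+ k * h (ray t x)).

Lemma ray_step t s v x : ray t (s *: v + x) = s *: (t *: v) + ray t x.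
Proof.
by rewrite /ray -addrA scalerDr -addrA !scalerA mulrC.
Qed.

Lemma ray_continuous : continuous (fun tx : R * V => ray tx.1 tx.2).
Proof.
move=> [t x]; apply: cvgD; last exact: cvg_cst.
apply: cvgZ; first exact: cvg_fst.
by apply: cvgB; [exact: cvg_snd|exact: cvg_cst].
Qed.

Lemma ray_cont01 (h : V -> R^o) k x : Ck 0 U h -> U x ->
  cont01 (fun t => t ^+ k * h (ray t x)).
Proof.
move=> [hc _] Ux t t01; apply: cvgM.
  exact: exprn_continuous.
apply: (@continuous_comp _ _ _ (fun t => ray t x) h t); last first.
  by apply: hc; exact: starU.
exact: line_continuous.
Qed.

(** Continuity of (t, y) |-> h (ray t y), uniform in t by compactness of the
parameter interval. *)
Lemma ray_tube (h : V -> R^o) x (e : R) : Ck 0 U h -> U x -> 0 < e ->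
  \forall y \near x, forall t : R, 0 <= t <= 1 -> `|h (ray t y) - h (ray t x)| <= e.
Proof.
move=> [hc _] Ux e0.
have cov := (compact_near_coveringP _).1 (@segment_compact R 0 1).
pose P y t := `|h (ray t y) - h (ray t x)| <= e.
suff Hpt (t : R) : t \in `[0, 1] -> \forall t' \near t & y \near nbhs x, P y t'.
  have := cov V (nbhs x) P (nbhs_filter x) Hpt.
  by apply: filterS => y yH t t01; apply: yH; rewrite /= in_itv.
rewrite in_itv/= => t01.
have Ut := starU Ux t01.
have e20 : 0 < e / 2 by rewrite divr_gt0.
have := (@cvgrPdist_le _ _ _ _ (nbhs_filter (ray t x)) _ _).1 (hc _ Ut) (e / 2) e20.
move=> H; have := @ray_continuous (t, x) _ H.
move=> [[A B]/= [nA nB] AB].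
exists (A, B) => // -[s y] [/= As By].
have H1 := AB (s, y) (conj As By).
have H2 := AB (s, x) (conj As (nbhs_singleton nB)).
rewrite /P /= (le_trans (ler_distD (h (ray t x)) _ _))// (splitr e) lerD//.
by rewrite distrC.
Qed.

Lemma rayint_continuous (h : V -> R^o) k : Ck 0 U h -> Ck 0 U (rayint k h).
Proof.
move=> hc; split=> // x Ux; apply/(@cvgrPdist_le _ _ _ _ (nbhs_filter x)) => e e0.
near=> y.
have Uy : U y by near: y; exact: (open_nbhs_nbhs (conj oU Ux)).
have cx := @ray_cont01 h k x hc Ux; have cy := @ray_cont01 h k y hc Uy.
rewrite distrC /rayint -(int01B cy cx).
apply: int01_le => [|t t01]; first exact: cont01B.
rewrite -mulrBr normrM.
have tk : `|t ^+ k| <= 1.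
  case/andP: t01 => t0 t1.
  by rewrite ger0_norm ?exprn_ge0// exprn_ile1.
apply: (le_trans (ler_piMl _ tk)) => //.
by move: t t01 {tk}; near: y; exact: ray_tube.
Unshelve. all: by end_near. Qed.

(** Differentiation under the integral sign.  By the mean value theorem the
difference quotient of the integrand is t^(k+1) times a derivative of h at a
nearby point of the same ray, and [ray_tube] bounds the error uniformly in t. *)
Lemma rayint_derive (h : V -> R^o) k x v : Ck 1 U h -> U x ->
  derivable (rayint k h) x v /\ 'D_v (rayint k h) x = rayint k.+1 ('D_v h) x.
Proof.
move=> h1 Ux.
have h0 := CkS h1; have hd := Ck_derive v h1.
suff H : (fun s : R => s^-1 *: ((rayint k h \o shift x) (s *: v) - rayint k h x))
    @ 0^' --> (rayint k.+1 ('D_v h) x : R^o).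
  by split; [apply/cvg_ex; eexists; exact: H|exact/cvg_lim].
apply/cvgrPdist_le => e e0.
have nU : nbhs x U by exact: (open_nbhs_nbhs (conj oU Ux)).
have [d /= d0 dP] := (nbhs_ballP _ _).1 (filterI nU (ray_tube hd Ux e0)).
near=> s.
have s0 : s != 0 by near: s; exact: nbhs_dnbhs_neq.
have sv : `|s| * `|v| < d.
  have v1 : 0 < `|v| + 1 by rewrite ltr_wpDl.
  have : `|s| < d / (`|v| + 1) by near: s; apply: dnbhs0_lt; rewrite divr_gt0.
  rewrite ltr_pdivlMr//; apply: le_lt_trans.
  by rewrite ler_wpM2l// lerDl.
have inU (t : R) : 0 <= t <= 1 -> ball x d (t *: (s *: v) + x).
  move=> /andP[t0 t1]; rewrite -ball_normE/= opprD addrCA subrr addr0 normrN.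
  rewrite !normrZ ger0_norm//; apply: le_lt_trans sv.
  by rewrite ler_piMl// mulr_ge0.
have Usv : U (s *: v + x) by have [] := dP _ (inU 1 _); rewrite ?scale1r// lexx ler01.
have cphi := @ray_cont01 h k _ (CkS h1) Usv; have cpsi := @ray_cont01 h k _ (CkS h1) Ux.
have cd := cont01B cphi cpsi; have cs := @cont01Z R s^-1 _ cd.
have cchi := @ray_cont01 _ k.+1 _ hd Ux.
have E : s^-1 *: (rayint k h (s *: v + x) - rayint k h x) =
  int01 (fun t => s^-1 * (t ^+ k * h (ray t (s *: v + x)) - t ^+ k * h (ray t x))).
  by rewrite (@int01Z R s^-1 _ cd) (int01B cphi cpsi).
rewrite /= E distrC /rayint -(int01B cs cchi).
apply: int01_le => [|t t01]; first exact: cont01B.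
have [t0 t1] := andP t01.
have segd (u : R) (u01 : 0 <= u <= 1) :=
  derivable_scale (t * s) (Ck_derivable (v := v) h1
    (starU (dP _ (inU u u01)).1 t01)).
have rayE u : ray t (u *: (s *: v) + x) = u *: ((t * s) *: v) + ray t x.
  by rewrite ray_step [t *: (s *: v)]scalerA.
have [u u01] := @segment_MVT _ _ h (ray t x) ((t * s) *: v)
  (fun u u01 => eq_ind _ (fun z => derivable h z _) (segd u u01).1 _ (rayE u)).
have {}u01 : 0 <= u <= 1 by case/andP: u01 => /ltW -> /ltW ->.
rewrite -rayE (segd u u01).2.
have -> : (t * s) *: v + ray t x = ray t (s *: v + x) by have := rayE 1; rewrite !scale1r.
move=> hE; rewrite -mulrBr hE.
set A := 'D_v h (ray t (u *: _ + x)); set B := 'D_v h (ray t x).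
rewrite -[(t * s) *: A]/((t * s) * A).
have -> : s^-1 * (t ^+ k * (t * s * A)) - t ^+ k.+1 * B = t ^+ k.+1 * (A - B).
  by rewrite exprS; field.
rewrite normrM ger0_norm ?exprn_ge0//.
have H : `|A - B| <= e by exact: (dP _ (inU u u01)).2.
by rewrite (le_trans _ H)// ler_piMl// exprn_ile1.
Unshelve. all: by end_near. Qed.

Lemma rayint_Ck (h : V -> R^o) m k : Ck m U h -> Ck m U (rayint k h).
Proof.
elim: m h k => [|m IH] h k hm; first exact: rayint_continuous.
have h1 : Ck 1 U h.
  have [hc [hd hD]] := hm; split=> //; split=> // v.
  by split=> // x Ux; exact: Ck_continuous (hD v) Ux.
split.
  by have [] := @rayint_continuous h k; first by case: h1.
split=> [x v Ux|v]; first exact: (rayint_derive k v h1 Ux).1.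
apply: (Ck_eq oU (IH _ k.+1 (Ck_derive v hm))) => x Ux.
by rewrite (rayint_derive k v h1 Ux).2.
Qed.

End RayIntegral.

Section Hadamard.
Context {R : realType}.

Lemma cont01_sum (I : Type) (r : seq I) (F : I -> R -> R) :
  (forall i, cont01 (F i)) -> cont01 (fun t => \sum_(i <- r) F i t).
Proof.
move=> Fc; elim: r => [|i r IH].
  by under eq_fun do rewrite big_nil; move=> t _; exact: cvg_cst.
under eq_fun do rewrite big_cons.
by move=> t t01; apply: cvgD; [exact: Fc|exact: IH].
Qed.

Lemma int01_sum (I : Type) (r : seq I) (F : I -> R -> R) :
  (forall i, cont01 (F i)) ->
  int01 (fun t => \sum_(i <- r) F i t) = \sum_(i <- r) int01 (F i).
Proof.
move=> Fc; elim: r => [|i r IH].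
  rewrite big_nil -[RHS](mul0r (int01 (cst 0))) -int01Z; last by move=> t _; exact: cvg_cst.
  by apply: eq_int01 => t _; rewrite big_nil mul0r.
rewrite big_cons -IH -int01D//; last exact: cont01_sum.
by apply: eq_int01 => t _; rewrite big_cons.
Qed.

(** The function g i is the mean of the i-th partial derivative over the segment
from x0 to x, and the formula is the fundamental theorem of calculus on that
segment. *)
Lemma hadamard m (f : 'rV[R]_m -> R^o) x0 : smooth_at f x0 ->
  exists g : 'I_m -> 'rV[R]_m -> R^o, [/\ forall i, smooth_at (g i) x0,
    forall i, g i x0 = 'D_(delta_mx 0 i) f x0 &
    \forall x \near x0, f x = f x0 + \sum_i (x - x0) 0 i * g i x].
Proof.
move=> /smooth_atP[U0 [oU0 U0x fU0]].
have [r /= r0 rU0] := (nbhs_ballP _ _).1 (open_nbhs_nbhs (conj oU0 U0x)).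
pose U := ball x0 r.
have oU : open U by exact: ball_open.
have Ux : U x0 by exact: ballxx.
have fU : smooth_on U f by move=> k; apply: Ck_sub (fU0 k).
have starU (x : 'rV[R]_m) (t : R) : U x -> 0 <= t <= 1 -> U (ray x0 t x).
  rewrite /U -ball_normE/= => xr /andP[t0 t1].
  rewrite /ray opprD addrCA subrr addr0 normrN normrZ ger0_norm//.
  by apply: le_lt_trans xr; rewrite distrC ler_piMl.
pose d i : 'rV[R]_m -> R^o := 'D_(delta_mx 0 i) f.
have dU i : smooth_on U (d i) by exact: smooth_on_derive.
exists (fun i => rayint x0 0 (d i)); split.
- move=> i; apply/smooth_atP; exists U; split=> // k.
  by apply: (rayint_Ck oU starU); exact: dU.
- move=> i; rewrite /rayint -[RHS]int01_cst; apply: eq_int01 => t _.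
  by rewrite expr0 mul1r /ray subrr scaler0 add0r.
- have := open_nbhs_nbhs (conj oU Ux); apply: filterS => x xU.
  have dE (t : R) : 0 <= t <= 1 -> 'D_(x - x0) f (ray x0 t x) =
      \sum_i (x - x0) 0 i * (t ^+ 0 * d i (ray x0 t x)).
    move=> t01; rewrite (C1_differentiable oU (fU 1%N) (starU x t xU t01)).2.
    by rewrite /dsum; apply: eq_bigr => i _; rewrite expr0 mul1r.
  have FD (t : R) : 'D_1 (fun s : R => f (ray x0 s x)) t = 'D_(x - x0) f (ray x0 t x).
    exact: line_derive.
  have cF i := @cont01Z R ((x - x0) 0 i) _ (@ray_cont01 _ _ U x0 starU (d i) 0 x (dU i 0%N) xU).
  have Dc : cont01 ('D_1 (fun s : R => f (ray x0 s x))).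
    rewrite (_ : 'D_1 (fun s : R => f (ray x0 s x)) = fun t : R => t ^+ 0 * 'D_(x - x0) f (ray x0 t x)).
      exact: (@ray_cont01 _ _ U x0 starU ('D_(x - x0) f) 0 x (Ck_derive _ (fU 1%N)) xU).
    by apply/funext => t; rewrite FD expr0 mul1r.
  have Fd (t : R) : 0 <= t <= 1 -> derivable (fun s : R => f (ray x0 s x)) t 1.
    move=> t01; apply: line_derivable.
    exact: Ck_derivable (fU 1%N) (starU _ _ xU t01).
  have := int01_FTC Fd Dc.
  rewrite (_ : ray x0 1 x = x); last by rewrite /ray scale1r subrK.
  rewrite (_ : ray x0 0 x = x0); last by rewrite /ray scale0r add0r.
  move=> /esym/eqP; rewrite subr_eq => /eqP ->; rewrite addrC; congr (_ + _).
  rewrite -(eq_bigr _ (fun i _ => @int01Z _ ((x - x0) 0 i) _ (@ray_cont01 _ _ U x0 starU (d i) 0 x (dU i 0%N) xU))).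
  rewrite -(int01_sum _ cF); apply: eq_int01 => t t01.
  by rewrite FD dE.
Qed.

End Hadamard.

(** * Smoothness at a point and symmetry of second derivatives *)
Section SmoothAt.
Context {R : realType} {V : normedModType R}.

Lemma smooth_on_smooth_at (W : normedModType R) (U : set V) (f : V -> W) x :
  open U -> U x -> smooth_on U f -> smooth_at f x.
Proof. by move=> oU Ux fU; apply/smooth_atP; exists U. Qed.

Lemma smooth_at2 (W W' : normedModType R) (f : V -> W) (g : V -> W') x :
  smooth_at f x -> smooth_at g x ->
  exists U, [/\ open U, U x, smooth_on U f & smooth_on U g].
Proof.
move=> /smooth_atP[U [oU Ux fU]] /smooth_at_nbhs.
move=> /(_ U (open_nbhs_nbhs (conj oU Ux)))[U' [oU' U'x sU gU]].
by exists U'; split=> // k; apply: Ck_sub (fU k).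
Qed.

Lemma smooth_at_cst (W : normedModType R) (c : W) x : smooth_at (fun _ : V => c) x.
Proof.
apply: (@smooth_on_smooth_at _ setT) => //; first exact: openT.
by move=> k; exact: Ck_cst.
Qed.

Lemma smooth_atD (W : normedModType R) (f g : V -> W) x :
  smooth_at f x -> smooth_at g x -> smooth_at (fun y => f y + g y) x.
Proof.
move=> fx gx; have [U [oU Ux fU gU]] := smooth_at2 fx gx.
by apply: (smooth_on_smooth_at oU Ux) => k; exact: CkD.
Qed.

Lemma smooth_atZ (W : normedModType R) (c : R) (f : V -> W) x :
  smooth_at f x -> smooth_at (fun y => c *: f y) x.
Proof.
move=> /smooth_atP[U [oU Ux fU]].
by apply: (smooth_on_smooth_at oU Ux) => k; exact: CkZ.
Qed.

Lemma smooth_atM (f g : V -> R^o) x :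
  smooth_at f x -> smooth_at g x -> smooth_at (fun y => f y * g y : R^o) x.
Proof.
move=> fx gx; have [U [oU Ux fU gU]] := smooth_at2 fx gx.
by apply: (smooth_on_smooth_at oU Ux) => k; exact: CkM.
Qed.

Lemma smooth_atV (f : V -> R^o) x : f x != 0 ->
  smooth_at f x -> smooth_at (fun y => (f y)^-1 : R^o) x.
Proof.
move=> fx0 fx.
have n0 : \forall y \near x, f y != 0.
  exact: (smooth_at_continuous fx) _ (open_nbhs_nbhs (conj (@open_neq R 0) fx0)).
have [U [oU Ux sU fU]] := smooth_at_nbhs fx n0.
by apply: (smooth_on_smooth_at oU Ux) => k; exact: CkV.
Qed.

Lemma smooth_at_sum (W : normedModType R) (I : Type) (r : seq I) (P : pred I)
    (F : I -> V -> W) x : (forall i, P i -> smooth_at (F i) x) ->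
  smooth_at (fun y => \sum_(i <- r | P i) F i y) x.
Proof.
move=> FS; elim: r => [|i r IH].
  by under eq_fun do rewrite big_nil; exact: smooth_at_cst.
under eq_fun do rewrite big_cons; case Pi: (P i) => //.
by apply: smooth_atD => //; exact: FS.
Qed.

Lemma smooth_at_prod (I : Type) (r : seq I) (P : pred I)
    (F : I -> V -> R^o) x : (forall i, P i -> smooth_at (F i) x) ->
  smooth_at (fun y => \prod_(i <- r | P i) F i y : R^o) x.
Proof.
move=> FS; elim: r => [|i r IH].
  by under eq_fun do rewrite big_nil; exact: smooth_at_cst.
case Pi: (P i).
  rewrite (_ : (fun y => _) = fun y => F i y * \prod_(i <- r | P i) F i y : R^o).
    exact: smooth_atM (FS i Pi) IH.
  by apply/funext => y; rewrite big_cons Pi.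
rewrite (_ : (fun y => _) = fun y => \prod_(i <- r | P i) F i y : R^o); first exact: IH.
by apply/funext => y; rewrite big_cons Pi.
Qed.

Lemma smooth_at_det m (A : V -> 'M[R]_m) x :
  (forall i j, smooth_at (fun y => A y i j : R^o) x) ->
  smooth_at (fun y => \det (A y) : R^o) x.
Proof.
move=> AS; apply: smooth_at_sum => s _; apply: smooth_atM; first exact: smooth_at_cst.
exact: smooth_at_prod.
Qed.

(** By Cramer's formula the entries of the inverse are cofactors divided by the
determinant. *)
Lemma smooth_at_invmx m (A : V -> 'M[R]_m) x i j :
  (forall i j, smooth_at (fun y => A y i j : R^o) x) ->
  \det (A x) != 0 -> smooth_at (fun y => invmx (A y) i j : R^o) x.
Proof.
move=> AS A0; have dS := smooth_at_det AS.
have n0 : \forall y \near x, \det (A y) != 0.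
  exact: (smooth_at_continuous dS) _ (open_nbhs_nbhs (conj (@open_neq R 0) A0)).
apply: (@smooth_at_ext _ _ _
  (fun y => (\det (A y))^-1 * cofactor (A y) j i : R^o)).
  apply: filterS n0 => y Ay0.
  by rewrite /invmx unitmxE unitfE Ay0 !mxE.
apply: smooth_atM; first exact: smooth_atV.
apply: smooth_atM; first exact: smooth_at_cst.
by apply: smooth_at_det => k l; under eq_fun do rewrite !mxE; exact: AS.
Qed.

Lemma smooth_at_affine (V' W : normedModType R) (f : V' -> W) (A L : V -> V') x :
  continuous A -> (forall y (h : R) w, A (h *: w + y) = h *: L w + A y) ->
  smooth_at f (A x) -> smooth_at (f \o A) x.
Proof.
move=> cA AE /smooth_atP[U [oU Ux fU]].
apply: (@smooth_on_smooth_at _ (A @^-1` U)) => //; last first.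
  by move=> k; exact: Ck_affine.
by apply: open_comp => // y _; exact: cA.
Qed.

End SmoothAt.

Section Schwarz.
Context {R : realType} {V : normedModType R}.

(** Two mean value theorems: along u for y |-> f (h w + y) - f y, then along w.
The left-hand side is symmetric in u and w, the right-hand side is not, and this
is the source of [schwarz]. *)
Lemma second_difference (f : V -> R^o) (U : set V) x u w (h : R) :
  0 < h -> open U -> Ck 2 U f ->
  (forall a b : R, 0 <= a <= h -> 0 <= b <= h -> U (a *: u + (b *: w + x))) ->
  exists a b : R, [/\ 0 <= a <= h, 0 <= b <= h &
    f (h *: u + (h *: w + x)) - f (h *: u + x) - (f (h *: w + x) - f x)
    = h * h * 'D_w ('D_u f) (a *: u + (b *: w + x))].
Proof.
move=> h0 oU f2 Uab.
have hU (t : R) : 0 <= t <= 1 -> 0 <= t * h <= h.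
  by move=> /andP[t0 t1]; rewrite mulr_ge0 ?(ltW h0)//= ler_piMl// ltW.
have [fc [fd fD]] := f2.
have zh : (0 : R) <= 0 <= h by rewrite lexx/= ltW.
have hh : 0 <= h <= h by rewrite lexx andbT ltW.
pose g y : R^o := f (h *: w + y) - f y.
have gd (t : R) : 0 <= t <= 1 -> derivable g (t *: (h *: u) + x) (h *: u) /\
   'D_(h *: u) g (t *: (h *: u) + x) =
    h *: ('D_u f (h *: w + (t *: (h *: u) + x)) - 'D_u f (t *: (h *: u) + x)).
  move=> t01; have th := hU t t01; rewrite scalerA.
  have Ua : U ((t * h) *: u + x) by have := Uab _ 0 th zh; rewrite scale0r add0r.
  have Ub : U (h *: w + ((t * h) *: u + x)).
    by rewrite addrCA; exact: Uab th hh.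
  have [d1 e1] := derivable_scale h (fd _ u Ua).
  have [d2 e2] := derivable_scale h (fd _ u Ub).
  have AE (s : R) : h *: w + (s *: (h *: u) + ((t * h) *: u + x)) =
      s *: (h *: u) + (h *: w + ((t * h) *: u + x)) by rewrite addrCA.
  have d3 : derivable (f \o (fun y => h *: w + y)) ((t * h) *: u + x) (h *: u).
    exact: (derivable_affine AE).
  have e3 : 'D_(h *: u) (f \o (fun y => h *: w + y)) ((t * h) *: u + x) =
    'D_(h *: u) f (h *: w + ((t * h) *: u + x)) by exact: (derive_affine f AE).
  split; first exact: derivableB d3 d1.
  by rewrite (deriveB d3 d1) e3 e1 e2 -scalerBr.
have [t t01 E] := segment_MVT (fun t t01 => (gd t t01).1).
have {}t01 : 0 <= t <= 1 by case/andP: t01 => /ltW -> /ltW ->.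
move: E; rewrite (gd t t01).2 /g.
have th := hU t t01.
set p := t *: (h *: u) + x => E.
have pE (s : R) : s *: (h *: w) + p = (t * h) *: u + ((s * h) *: w + x).
  by rewrite /p !scalerA addrCA.
have qd (s : R) : 0 <= s <= 1 -> derivable ('D_u f) (s *: (h *: w) + p) (h *: w) /\
    'D_(h *: w) ('D_u f) (s *: (h *: w) + p) = h *: 'D_w ('D_u f) (s *: (h *: w) + p).
  move=> s01; apply: derivable_scale.
  have [_ [d _]] := fD u; apply: d; rewrite pE.
  by apply: Uab; exact: hU.
have [s s01 F] := segment_MVT (fun s s01 => (qd s s01).1).
have {}s01 : 0 <= s <= 1 by case/andP: s01 => /ltW -> /ltW ->.
move: F; rewrite (qd s s01).2 => F.
exists (t * h), (s * h); split; [exact: hU|exact: hU|].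
have -> : f (h *: u + (h *: w + x)) - f (h *: u + x) - (f (h *: w + x) - f x) =
  f (h *: w + (h *: u + x)) - f (h *: u + x) - (f (h *: w + x) - f x).
  by rewrite [X in f X - _ - _]addrCA.
by rewrite E F pE -mulrA.
Qed.

(** Expanding the second difference in both orders expresses the same number by
values of the two mixed derivatives at points that tend to x with h. *)
Lemma schwarz (f : V -> R^o) x u w : smooth_at f x ->
  'D_u ('D_w f) x = 'D_w ('D_u f) x.
Proof.
move=> /smooth_atP[U [oU Ux fU]].
apply/eqP; rewrite -subr_eq0 -normr_le0; apply/ler_addgt0Pr => e e0.
rewrite add0r.
have e20 : 0 < e / 2 by rewrite divr_gt0.
have cuw : {for x, continuous ('D_u ('D_w f))}.
  exact: Ck_continuous (Ck_derive _ (Ck_derive _ (fU 2%N))) Ux.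
have cwu : {for x, continuous ('D_w ('D_u f))}.
  exact: Ck_continuous (Ck_derive _ (Ck_derive _ (fU 2%N))) Ux.
have n1 := (@cvgrPdist_le _ _ _ _ (nbhs_filter x) _ _).1 cuw _ e20.
have n2 := (@cvgrPdist_le _ _ _ _ (nbhs_filter x) _ _).1 cwu _ e20.
have nU : nbhs x U by exact: (open_nbhs_nbhs (conj oU Ux)).
have [r /= r0 rP] := (nbhs_ballP _ _).1 (filterI nU (filterI n1 n2)).
(* The parallelogram spanned by h u and h w at x stays in the ball of radius r. *)
pose h := r / (`|u| + `|w| + 1).
have uw0 : 0 < `|u| + `|w| + 1 by rewrite ltr_wpDl// addr_ge0.
have h0 : 0 < h by rewrite divr_gt0.
have inB (a b : R) : 0 <= a <= h -> 0 <= b <= h -> ball x r (a *: u + (b *: w + x)).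
  move=> /andP[a0 ah] /andP[b0 bh].
  rewrite -ball_normE/= distrC addrA addrK.
  rewrite (le_lt_trans (ler_normD _ _))// !normrZ !ger0_norm//.
  have : a * `|u| + b * `|w| <= h * (`|u| + `|w|).
    by rewrite mulrDr lerD// ler_wpM2r.
  move=> /le_lt_trans; apply.
  have -> : r = h * (`|u| + `|w| + 1) by rewrite divfK// gt_eqF.
  by rewrite ltr_pM2l// ltrDl.
have [a [b [ah bh E1]]] := second_difference h0 oU (fU 2%N)
  (fun a b ah bh => (rP _ (inB a b ah bh)).1).
have inB' (p q : R) : 0 <= p <= h -> 0 <= q <= h -> U (p *: w + (q *: u + x)).
  by move=> ph qh; rewrite addrCA; exact: (rP _ (inB q p qh ph)).1.
have [b' [a' [bh' ah' E2]]] := second_difference h0 oU (fU 2%N) inB'.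
have [_ [_ H1]] := rP _ (inB a b ah bh).
have [_ [H2 _]] := rP _ (inB a' b' ah' bh').
have bE : b' *: w + (a' *: u + x) = a' *: u + (b' *: w + x) by exact: addrCA.
have hE : h *: w + (h *: u + x) = h *: u + (h *: w + x) by exact: addrCA.
rewrite bE hE in E2.
move: E1 E2 H1 H2.
move: ('D_w ('D_u f) (a *: u + (b *: w + x))) ('D_u ('D_w f) (a' *: u + (b' *: w + x))).
move: ('D_u ('D_w f) x) ('D_w ('D_u f) x).
move: (f (h *: u + (h *: w + x))) (f (h *: u + x)) (f (h *: w + x)) (f x) => f1 f2 f3 f4 B A C D E1 E2 H1 H2.
have hh0 : h * h != 0 by rewrite mulf_neq0// gt_eqF.
have CD : C = D by apply: (mulfI hh0); rewrite -E1 -E2; ring.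
rewrite CD distrC in H1.
by rewrite (splitr e) (le_trans (ler_distD D _ _))// lerD.
Qed.

End Schwarz.

(** * Propagation of zeros and inversion of one coordinate *)
Section ZeroSet.
Context {R : realType}.

Lemma dsum_le m (f : 'rV[R]_m -> R^o) x v (K : R) : 0 <= K ->
  (forall i, `|'D_(delta_mx 0 i) f x| <= K) -> `|dsum f x v| <= m%:R * `|v| * K.
Proof.
move=> K0 H; rewrite (le_trans (ler_norm_sum _ _ _))//.
have -> : m%:R * `|v| * K = \sum_(i < m) `|v| * K.
  by rewrite sumr_const card_ord -mulrA mulr_natl.
by apply: ler_sum => i _; rewrite normrM ler_pM// rV_coord_le.
Qed.

(** A local Gronwall lemma.  On the segment from x0 to y, |f| is maximal at some
point; the mean value theorem bounds this maximum by m r' C times itself, and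
the radius r' is chosen so that m r' C <= 1/2. *)
Lemma zero_near m (f : 'rV[R]_m -> R^o) x0 (C : R) : 0 <= C ->
  smooth_at f x0 -> f x0 = 0 ->
  (\forall y \near x0, forall i, `|'D_(delta_mx 0 i) f y| <= C * `|f y|) ->
  \forall y \near x0, f y = 0.
Proof.
move=> C0 /smooth_at_nbhs fS f0 /fS[U [oU Ux sU fU]] {fS}.
have [r /= r0 rU] := (nbhs_ballP _ _).1 (open_nbhs_nbhs (conj oU Ux)).
(* Adding 1 to m C keeps the radius positive when C = 0. *)
pose r' := Num.min r (2 * (m%:R * C + 1))^-1.
have mC : 0 < m%:R * C + 1 by rewrite ltr_wpDl// mulr_ge0.
have r'0 : 0 < r' by rewrite lt_min r0 invr_gt0 mulr_gt0.
have r'C : m%:R * r' * C <= 2^-1.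
  have : r' <= (2 * (m%:R * C + 1))^-1 by rewrite ge_min lexx orbT.
  rewrite -[_^-1]mul1r ler_pdivlMr ?mulr_gt0// => H.
  have : 0 <= r' by exact: ltW.
  by nra.
apply/nbhs_ballP; exists r' => //= y; rewrite -ball_normE/= distrC => yr.
have inU (t : R) : 0 <= t <= 1 -> U (t *: (y - x0) + x0).
  move=> /andP[t0 t1]; apply: rU; rewrite -ball_normE/= distrC addrK normrZ ger0_norm//.
  have : r' <= r by rewrite ge_min lexx.
  by apply: lt_le_trans; apply: le_lt_trans yr; rewrite ler_piMl.
pose g (t : R) : R := `|f (t *: (y - x0) + x0)|.
have gc : {within `[0, 1], continuous g}.
  apply: continuous_in_subspaceT => t; rewrite inE/= in_itv/= => /inU Ut.
  apply: (@continuous_comp _ _ _ (fun t : R => f (t *: (y - x0) + x0)) (@Num.norm _ R) t).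
    apply: (@continuous_comp _ _ _ (fun t : R => t *: (y - x0) + x0) f t).
      exact: line_continuous.
    exact: Ck_continuous (fU 0%N) Ut.
  exact: norm_continuous.
have [c] := EVT_max (@ler01 R) gc.
rewrite in_itv/= => c01 gmax.
have [c0 c1] := andP c01.
have tc (t : R) : 0 <= t <= 1 -> 0 <= t * c <= 1.
  by move=> /andP[t0 t1]; rewrite mulr_ge0//= mulr_ile1.
have [t t01 E] := @segment_MVT _ _ f x0 (c *: (y - x0)) (fun t t01 =>
  eq_ind_r (fun z => derivable f (z + x0) (c *: (y - x0)))
   (derivable_scale c (Ck_derivable (v := y - x0) (fU 1%N) (inU _ (tc t t01)))).1
   (scalerA t c (y - x0))).
have {}t01 : 0 <= t <= 1 by case/andP: t01 => /ltW -> /ltW ->.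
move: E; rewrite f0 subr0 (C1_differentiable oU (fU 1%N) _).2; last first.
  by rewrite scalerA; exact: inU _ (tc _ t01).
move=> E.
have gle : g c <= 2^-1 * g c.
  rewrite {1}/g E; apply: (le_trans (dsum_le _ _ (sU _ _))).
  - by rewrite mulr_ge0.
  - by rewrite scalerA; exact: inU _ (tc _ t01).
  rewrite scalerA.
  have H1 : `|f ((t * c) *: (y - x0) + x0)| <= g c.
    by apply: gmax; rewrite in_itv/=; exact: tc.
  have H2 : `|c *: (y - x0)| <= r'.
    by rewrite normrZ ger0_norm// (le_trans _ (ltW yr))// ler_piMl.
  apply: (@le_trans _ _ (m%:R * r' * (C * g c))).
    by rewrite ler_pM ?mulr_ge0// ?ler_wpM2l// mulr_ge0.
  by rewrite mulrA ler_wpM2r// normr_ge0.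
have : g 1 <= g c by apply: gmax; rewrite in_itv/= ler01 lexx.
have : 0 <= g 1 by exact: normr_ge0.
rewrite /g scale1r subrK -/(g c) => H1 H2.
by apply/eqP; rewrite -normr_le0; lra.
Qed.

End ZeroSet.

Section PartialInverse.
Context {R : realType} {m : nat}.
Variables (u : 'rV[R]_m -> R^o) (j : 'I_m) (x0 : 'rV[R]_m) (r : R).
Let e : 'rV[R]_m := delta_mx 0 j.
Let B := ball x0 r.
Hypothesis r0 : 0 < r.
Hypothesis uB : smooth_on B u.
Hypothesis uj : forall x, B x -> 0 < 'D_e u x.

(** Where u has a positive j-th derivative this is a change of coordinates that
makes u the j-th coordinate.  As the other coordinates are kept, inverting it
means solving one monotone equation in one real unknown, so that the
intermediate value theorem stands in for a fixed point argument. *)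
Definition repl_coord (x : 'rV[R]_m) : 'rV[R]_m := x + (u x - x 0 j) *: e.

Definition repl_coord_inv (y : 'rV[R]_m) : 'rV[R]_m :=
  xget x0 [set x | B x /\ repl_coord x = y].

Let oB : open B. Proof. exact: ball_open. Qed.

Lemma repl_coordE x i : repl_coord x 0 i = if i == j then u x else x 0 i.
Proof.
rewrite !mxE eqxx/=; case: (eqVneq i j) => [->|_]; first by rewrite mulr1 addrC subrK.
by rewrite mulr0 addr0.
Qed.

Lemma repl_coord_smooth : smooth_on B repl_coord.
Proof.
move=> k; apply/(Ck_rV _ _ oB) => i; under eq_fun do rewrite repl_coordE.
by case: (i == j); [exact: uB|exact: Ck_coord].
Qed.

Lemma coord_ball (x y : 'rV[R]_m) (s : R) : 0 < s ->
  ball x s y <-> forall i, `|x 0 i - y 0 i| < s.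
Proof.
move=> s0; split=> [|H].
  rewrite -ball_normE/= => H i.
  by apply: le_lt_trans H; have := rV_coord_le (x - y) i; rewrite !mxE.
by split=> // i k; rewrite ord1; exact: H.
Qed.

(** The coefficient c is a value of the j-th derivative; stating the increment as
s * c covers both signs of s. *)
Lemma increment_j x (s : R) : B x -> B (s *: e + x) ->
  exists2 c : R, 0 < c & u (s *: e + x) - u x = s * c.
Proof.
move=> Bx Bsx.
have inB (t : R) : 0 <= t <= 1 -> B (t *: (s *: e) + x).
  move=> /andP[t0 t1]; move: Bx Bsx; rewrite /B -!ball_normE/= => Bx Bsx.
  have -> : x0 - (t *: (s *: e) + x) = t *: (x0 - (s *: e + x)) + (1 - t) *: (x0 - x).
    by apply/rowP => i; rewrite !mxE; ring.
  rewrite (le_lt_trans (ler_normD _ _))// !normrZ !ger0_norm ?subr_ge0//.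
  move: Bx Bsx; move: `|x0 - x| `|x0 - (s *: e + x)| => p q pr qr.
  have [pq|/ltW qp] := leP p q; [apply: le_lt_trans qr|apply: le_lt_trans pr].
    have : 0 <= (1 - t) * (q - p) by rewrite mulr_ge0// subr_ge0.
    by lra.
  have : 0 <= t * (p - q) by rewrite mulr_ge0// subr_ge0.
  by lra.
have H (t : R) (t01 : 0 <= t <= 1) :=
  derivable_scale s (Ck_derivable (v := e) (uB 1%N) (inB t t01)).
have [t t01 ->] := segment_MVT (fun t t01 => (H t t01).1).
have {}t01 : 0 <= t <= 1 by case/andP: t01 => /ltW -> /ltW ->.
by rewrite (H t t01).2; exists ('D_e u (t *: (s *: e) + x)) => //; exact: uj (inB _ _).
Qed.

Lemma repl_coord_inj x y : B x -> B y -> repl_coord x = repl_coord y -> x = y.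
Proof.
move=> Bx By E.
have yE : y = (y 0 j - x 0 j) *: e + x.
  apply/rowP => i; rewrite !mxE eqxx/=; case: (eqVneq i j) => [->|ij].
    by rewrite mulr1 subrK.
  have := congr1 (fun z : 'rV[R]_m => z 0 i) E.
  by rewrite !repl_coordE (negbTE ij) mulr0 add0r.
have [|c c0 H] := @increment_j x (y 0 j - x 0 j) Bx; first by rewrite -yE.
move: H; rewrite -yE; have := congr1 (fun z : 'rV[R]_m => z 0 j) E.
rewrite !repl_coordE eqxx => ->; rewrite subrr => /esym/eqP.
rewrite mulf_eq0 (gt_eqF c0) orbF => /eqP yx.
by rewrite [RHS]yE yx scale0r add0r.
Qed.

Lemma repl_coordK x : B x -> repl_coord_inv (repl_coord x) = x.
Proof.
move=> Bx; rewrite /repl_coord_inv; case: xgetP => [y _ [By]|/(_ x)[]//].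
exact: repl_coord_inj.
Qed.

(** At height h below and above x along the j-th axis, u is strictly smaller and
strictly larger than u x.  This persists when the other coordinates are those of
a point y close to the image of x, and the intermediate value theorem then
yields the j-th coordinate of a preimage of y. *)
Lemma repl_coord_open x (N : set 'rV[R]_m) : B x -> nbhs x N ->
  nbhs (repl_coord x) (repl_coord @` (N `&` B)).
Proof.
move=> Bx nN.
have nB : nbhs x B by exact: (open_nbhs_nbhs (conj oB Bx)).
have [d /= d0 dP] := (nbhs_ballP _ _).1 (filterI nN nB).
pose h := d / 2.
have h0 : 0 < h by rewrite divr_gt0.
have hd : h < d by rewrite ltr_pdivrMr// ltr_pMr// ltr1n.
pose z (s : R) (y : 'rV[R]_m) : 'rV[R]_m := y + (s - y 0 j) *: e.
have zE (s : R) (y : 'rV[R]_m) i : z s y 0 i = if i == j then s else y 0 i.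
  rewrite !mxE eqxx/=; case: (eqVneq i j) => [->|_]; first by rewrite mulr1 addrC subrK.
  by rewrite mulr0 addr0.
have zb (s : R) (y : 'rV[R]_m) : `|s - x 0 j| <= h -> (forall i, i != j -> `|y 0 i - x 0 i| < h) ->
    ball x d (z s y).
  move=> sh yh; apply/(coord_ball _ _ d0) => i; rewrite distrC zE.
  case: (eqVneq i j) => [->|ij]; first exact: le_lt_trans hd.
  exact: lt_trans (yh i ij) hd.
have zB (s : R) (y : 'rV[R]_m) H1 H2 : B (z s y) := (dP _ (zb s y H1 H2)).2.
have zx (s : R) : z s (repl_coord x) = (s - x 0 j) *: e + x.
  apply/rowP => i; rewrite zE repl_coordE !mxE eqxx/=.
  by case: (eqVneq i j) => [->|_]; rewrite ?mulr1 ?subrK// mulr0 add0r.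
have zcont (s : R) (y : 'rV[R]_m) : {for y, continuous (z s)}.
  apply/smooth_at_continuous/smooth_at_rV => i; under eq_fun do rewrite zE.
  case: (i == j); first exact: smooth_at_cst.
  apply: (smooth_on_smooth_at openT I) => k; exact: Ck_coord.
have ucont (s : R) : `|s - x 0 j| <= h -> {for repl_coord x, continuous (u \o z s)}.
  move=> sh; apply: (@continuous_comp _ _ _ (z s) u); first exact: zcont.
  apply: (Ck_continuous (uB 0%N)); apply: zB => // i ij.
  by rewrite repl_coordE (negbTE ij) subrr normr0.
have zx_B (s : R) : `|s| <= h -> B (s *: e + x).
  move=> sh; have := zB (s + x 0 j) (repl_coord x); rewrite zx addrK.
  apply => // i ij.
  by rewrite repl_coordE (negbTE ij) subrr normr0.
have lo : u (z (x 0 j - h) (repl_coord x)) < u x.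
  rewrite zx (_ : x 0 j - h - x 0 j = - h); last by ring.
  have [|c c0 cE] := @increment_j x (- h) Bx; first by apply: zx_B; rewrite normrN gtr0_norm.
  by rewrite -subr_lt0 cE mulNr oppr_lt0 mulr_gt0.
have hi : u x < u (z (x 0 j + h) (repl_coord x)).
  rewrite zx (_ : x 0 j + h - x 0 j = h); last by ring.
  have [|c c0 cE] := @increment_j x h Bx; first by apply: zx_B; rewrite gtr0_norm.
  by rewrite -subr_gt0 cE mulr_gt0.
have jcont : {for repl_coord x, continuous (fun y : 'rV[R]_m => y 0 j : R^o)}.
  exact: rV_coord_continuous.
have uxE : u x = (repl_coord x) 0 j by rewrite repl_coordE eqxx.
have pos_near (w : 'rV[R]_m -> R^o) : {for repl_coord x, continuous w} ->
    0 < w (repl_coord x) -> nbhs (repl_coord x) [set y : 'rV[R]_m | 0 < w y].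
  by move=> wc w0; exact: wc _ (open_nbhs_nbhs (conj (@open_gt R 0) w0)).
have hh : `|h| <= h by rewrite gtr0_norm.
have nlo : nbhs (repl_coord x)
    [set y : 'rV[R]_m | 0 < y 0 j - u (z (x 0 j - h) y)].
  apply: (pos_near (fun y : 'rV[R]_m => y 0 j - u (z (x 0 j - h) y))).
    have cu : {for repl_coord x, continuous (u \o z (x 0 j - h))}.
      by apply: ucont; rewrite addrC addKr normrN.
    exact: cvgB jcont cu.
  by rewrite subr_gt0 -uxE.
have nhi : nbhs (repl_coord x)
    [set y : 'rV[R]_m | 0 < u (z (x 0 j + h) y) - y 0 j].
  apply: (pos_near (fun y : 'rV[R]_m => u (z (x 0 j + h) y) - y 0 j)).
    have cu : {for repl_coord x, continuous (u \o z (x 0 j + h))}.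
      by apply: ucont; rewrite addrC addKr.
    exact: cvgB cu jcont.
  by rewrite subr_gt0 -uxE.
near=> y.
have yh i : i != j -> `|y 0 i - x 0 i| < h.
  move=> ij; have := (coord_ball (repl_coord x) y h0).1 _ i.
  by rewrite repl_coordE (negbTE ij) distrC; apply; near: y; exact: nbhsx_ballx.
have ylo : u (z (x 0 j - h) y) < y 0 j by rewrite -subr_gt0; near: y.
have yhi : y 0 j < u (z (x 0 j + h) y) by rewrite -subr_gt0; near: y.
have [s] : exists2 s, s \in `[x 0 j - h, x 0 j + h] & u (z s y) = y 0 j.
  apply: IVT.
  - by lra.
  - apply: continuous_in_subspaceT => s; rewrite inE/= in_itv/= => /andP[s1 s2].
    apply: (@continuous_comp _ _ _ (fun s : R => z s y) u s).
      rewrite (_ : (fun s : R => z s y) = (fun s => s *: e + (y - y 0 j *: e))).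
        exact: line_continuous.
      by apply/funext => t; rewrite /z scalerBl addrCA.
    apply: (Ck_continuous (uB 0%N)); apply: zB => //.
    by rewrite ler_norml; apply/andP; split; lra.
  - by rewrite ge_min le_max (ltW ylo) (ltW yhi) orbT.
rewrite in_itv/= => /andP[s1 s2] us.
have sh : `|s - x 0 j| <= h by rewrite ler_norml; apply/andP; split; lra.
exists (z s y); first exact: dP (zb s y sh yh).
by apply/rowP => i; rewrite repl_coordE zE us; case: (eqVneq i j) => [->|].
Unshelve. all: by end_near. Qed.

Lemma repl_coord_image_open : open (repl_coord @` B).
Proof.
rewrite openE => y [x Bx <-].
have nT : nbhs x setT by exact: (@filterT _ _ (nbhs_filter x)).
apply: (filterS _ (repl_coord_open Bx nT)) => z [w [_ Bw] <-].
by exists w.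
Qed.

Lemma repl_coord_inv_continuous x : B x -> {for repl_coord x, continuous repl_coord_inv}.
Proof.
move=> Bx N; rewrite repl_coordK// => nN.
have := repl_coord_open Bx nN; apply: filterS => z [w [Nw Bw] <-].
by rewrite /= repl_coordK.
Qed.

(** The displacement of the inverse is a step h v', which leaves the j-th
coordinate fixed, followed by a step of unknown length along the j-th axis.  The
mean value theorem on the two steps expresses the unknown length by derivatives
of u at points that tend to x. *)
Lemma repl_coord_inv_derive (x v : 'rV[R]_m) : B x ->
  let v' : 'rV[R]_m := v - v 0 j *: e in
  let w : 'rV[R]_m := v' + ((v 0 j - 'D_v' u x) / 'D_e u x) *: e in
  derivable repl_coord_inv (repl_coord x) v /\
  'D_v repl_coord_inv (repl_coord x) = w.
Proof.
move=> Bx v' w; set y := repl_coord x.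
have v'E i : v' 0 i = if i == j then 0 else v 0 i.
  rewrite !mxE eqxx/=; case: (eqVneq i j) => [->|_]; first by rewrite mulr1 subrr.
  by rewrite mulr0 subr0.
suff H : (fun h : R => h^-1 *: ((repl_coord_inv \o shift y) (h *: v) - repl_coord_inv y))
    @ 0^' --> w.
  by split; [apply/cvg_ex; eexists; exact: H|exact/cvg_lim].
apply/cvgrPdist_le => eps eps0.
(* The two derivatives are taken at different mean value points, hence a limit in
   the pair (p, q). *)
pose Q (p q : 'rV[R]_m) : R := (v 0 j - 'D_v' u q) / 'D_e u p.
have cv' : {for x, continuous ('D_v' u)}.
  exact: Ck_continuous (Ck_derive _ (uB 1%N)) Bx.
have ce : {for x, continuous ('D_e u)}.
  exact: Ck_continuous (Ck_derive _ (uB 1%N)) Bx.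
have c2 : {for (x, x), continuous (fun pq : 'rV[R]_m * 'rV[R]_m => 'D_v' u pq.2)}.
  by apply: (@continuous_comp _ _ _ (@snd 'rV[R]_m 'rV[R]_m) ('D_v' u) (x, x));
    [exact: cvg_snd|exact: cv'].
have c1 : {for (x, x), continuous (fun pq : 'rV[R]_m * 'rV[R]_m => 'D_e u pq.1)}.
  by apply: (@continuous_comp _ _ _ (@fst 'rV[R]_m 'rV[R]_m) ('D_e u) (x, x));
    [exact: cvg_fst|exact: ce].
have Qc : {for (x, x), continuous (fun pq : 'rV[R]_m * 'rV[R]_m => Q pq.1 pq.2)}.
  apply: cvgM; first by apply: cvgB c2; exact: cvg_cst.
  by apply: cvgV c1; rewrite gt_eqF// uj.
have [[N1 N2] /= [nN1 nN2] N12] := (cvgrPdist_le _ _).1 Qc eps eps0.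
have nB : nbhs x B by exact: (open_nbhs_nbhs (conj oB Bx)).
have [d /= d0 dP] := (nbhs_ballP _ _).1 (filterI nB (filterI nN1 nN2)).
have lc : (h *: v + y) @[h --> (0:R)] --> y.
  by have := @line_continuous R _ y v 0; rewrite /continuous_at scale0r add0r.
have nim : \forall h \near (0:R)^', (repl_coord @` B) (h *: v + y).
  apply: cvg_within; apply: lc; apply: open_nbhs_nbhs; split.
    exact: repl_coord_image_open.
  by exists x.
have nball : \forall h \near (0:R)^', ball x d (repl_coord_inv (h *: v + y)).
  have H : nbhs (repl_coord_inv (repl_coord x)) (ball x d).
    by rewrite repl_coordK//; exact: nbhsx_ballx.
  by apply: cvg_within; exact: lc _ (repl_coord_inv_continuous Bx H).
near=> h.
have h0 : h != 0 by near: h; exact: nbhs_dnbhs_neq.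
have [x' Bx' x'E] : (repl_coord @` B) (h *: v + y) by near: h.
have x'd : ball x d x'.
  by rewrite -(repl_coordK Bx') x'E; near: h.
rewrite /= -x'E !repl_coordK//.
have kd := (coord_ball _ _ d0).1 x'd.
have xE i : repl_coord x' 0 i = h * v 0 i + repl_coord x 0 i.
  by rewrite x'E [LHS]mxE [X in X + _]mxE.
have ki i : i != j -> x' 0 i - x 0 i = h * v 0 i.
  by move=> ij; move: (xE i); rewrite !repl_coordE (negbTE ij) => ->; rewrite addrK.
have uk : u x' - u x = h * v 0 j.
  by move: (xE j); rewrite !repl_coordE eqxx => ->; rewrite addrK.
pose sg := x' 0 j - x 0 j.
pose x1 := h *: v' + x.
have x'1 : x' = sg *: e + x1.
  apply/rowP => i; rewrite /x1 /sg; move: (v'E i); rewrite !mxE eqxx/= => ->.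
  case: (eqVneq i j) => [->|ij]; first by rewrite mulr1 mulr0 add0r subrK.
  by rewrite -ki// mulr0 add0r subrK.
have inb1 (t : R) : 0 <= t <= 1 -> ball x d (t *: (h *: v') + x).
  move=> /andP[t0 t1]; apply/(coord_ball _ _ d0) => i.
  have -> : x 0 i - (t *: (h *: v') + x) 0 i = - (t * (h * v' 0 i)).
    by rewrite !mxE; ring.
  rewrite normrN v'E; case: (eqVneq i j) => [_|ij]; first by rewrite !mulr0 normr0.
  rewrite -ki// normrM ger0_norm//.
  by apply: le_lt_trans (kd i); rewrite distrC ler_piMl.
have inb2 (t : R) : 0 <= t <= 1 -> ball x d (t *: (sg *: e) + x1).
  move=> /andP[t0 t1]; apply/(coord_ball _ _ d0) => i.
  have -> : x 0 i - (t *: (sg *: e) + x1) 0 i =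
      - (t * (if i == j then sg else 0) + h * v' 0 i).
    rewrite /x1 !mxE eqxx/=; case: (eqVneq i j) => _ /=; ring.
  rewrite normrN v'E; case: (eqVneq i j) => [_|ij].
    rewrite mulr0 addr0 normrM ger0_norm//.
    by apply: le_lt_trans (kd j); rewrite /sg distrC ler_piMl.
  by rewrite mulr0 add0r -ki// distrC; exact: kd.
have H1 (t : R) (t01 : 0 <= t <= 1) :=
  derivable_scale h (Ck_derivable (v := v') (uB 1%N) (dP _ (inb1 t t01)).1).
have H2 (t : R) (t01 : 0 <= t <= 1) :=
  derivable_scale sg (Ck_derivable (v := e) (uB 1%N) (dP _ (inb2 t t01)).1).
have [t t01 E1] := segment_MVT (fun t t01 => (H1 t t01).1).
have {}t01 : 0 <= t <= 1 by case/andP: t01 => /ltW -> /ltW ->.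
have [s s01 E2] := segment_MVT (fun t t01 => (H2 t t01).1).
have {}s01 : 0 <= s <= 1 by case/andP: s01 => /ltW -> /ltW ->.
move: E1 E2; rewrite (H1 t t01).2 (H2 s s01).2 -x'1 -/x1.
set q := t *: _ + x; set p := s *: _ + x1 => E1 E2.
have Bp := (dP _ (inb2 s s01)).1.
(* The j-th coordinate of the image moves by h v_j; the two steps account for it. *)
have sgE : sg = h * Q p q.
  have dp : 'D_e u p != 0 by rewrite gt_eqF// uj.
  apply: (mulIf dp); rewrite /Q mulrA divfK//.
  rewrite -[LHS]/(sg *: 'D_e u p) -E2 mulrBr.
  rewrite -uk -[h * 'D_v' u q]/(h *: 'D_v' u q) -E1; ring.
have -> : h^-1 *: (x' - x) = v' + Q p q *: e.
  rewrite x'1 /x1 addrA addrK scalerDr addrC !scalerA mulVf// scale1r.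
  by rewrite sgE mulKf.
rewrite /w opprD addrACA subrr add0r -scalerBl.
have Hpq : `|Q x x - Q p q| <= eps.
  apply: (N12 (p, q)); split.
    by have [_ []] := dP _ (inb2 s s01).
  by have [_ []] := dP _ (inb1 t t01).
apply: rV_norm_le (ltW eps0) _ => i; rewrite !mxE eqxx/=.
case: (i == j); last by rewrite mulr0 normr0 ltW.
by rewrite mulr1.
Unshelve. all: by end_near. Qed.

(** Bootstrapping: a derivative of the inverse is a rational expression in
derivatives of u composed with the inverse, so it is of class C^k as soon as the
inverse is. *)
Lemma repl_coord_inv_smooth : smooth_on (repl_coord @` B) repl_coord_inv.
Proof.
have oI := repl_coord_image_open.
have BI y : (repl_coord @` B) y -> B (repl_coord_inv y).
  by move=> [x Bx <-]; rewrite repl_coordK.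
have invK y : (repl_coord @` B) y -> repl_coord (repl_coord_inv y) = y.
  by move=> [x Bx <-]; rewrite repl_coordK.
elim=> [|k IH].
  by split=> // y [x Bx <-]; exact: repl_coord_inv_continuous.
split; first by move=> y [x Bx <-]; exact: repl_coord_inv_continuous.
split; first by move=> y v [x Bx <-]; exact: (repl_coord_inv_derive v Bx).1.
move=> v; pose v' : 'rV[R]_m := v - v 0 j *: e.
have cD (w : 'rV[R]_m) : Ck k (repl_coord @` B) ('D_w u \o repl_coord_inv).
  by apply: (Ck_comp oI oB BI IH); exact: Ck_derive (uB k.+1).
apply/(Ck_rV _ _ oI) => i.
have nz y : (repl_coord @` B) y -> ('D_e u \o repl_coord_inv) y != 0.
  by move=> /BI By; rewrite gt_eqF//=; exact: uj.
have L := CkM oI (CkD oI (@Ck_cst _ _ R^o _ _ (v 0 j)) (CkZ (-1) oI (cD v'))) (CkV oI nz (cD e)).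
have M := CkD oI (@Ck_cst _ _ R^o _ _ (v' 0 i)) (CkM oI L (@Ck_cst _ _ R^o _ _ (e 0 i))).
apply: (Ck_eq oI M) => y Iy.
rewrite -[in RHS](invK y Iy) (repl_coord_inv_derive v (BI y Iy)).2 [RHS]mxE.
by rewrite [X in _ = _ + X]mxE /= scaleN1r.
Qed.

End PartialInverse.

(** * Germs and tangent vectors in coordinates *)
(* Unification must not unfold smoothness into iterated derivatives. *)
Opaque smooth_at.

Section Germs.
Context {R : realType} {n : nat} {M : manifoldType R n}.
Implicit Types (p q : M) (f g : M -> R) (a b : chart R n M).

Lemma chart_invK a p : chart_dom a p -> chart_inv a (chart_map a p) = p.
Proof. by move=> ap; apply: chart_mapK; rewrite inE. Qed.

Lemma near_chart_inv a p (P : set M) : chart_dom a p -> nbhs p P ->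
  \forall y \near chart_map a p, P (chart_inv a y).
Proof.
move=> ap nP.
have c : {for chart_map a p, continuous (chart_inv a)}.
  by apply: chart_inv_continuous; rewrite inE; exists p.
by apply: c; rewrite chart_invK.
Qed.

Lemma near_chart_map a p (P : set 'rV[R]_n) : chart_dom a p -> nbhs (chart_map a p) P ->
  \forall q \near p, P (chart_map a q).
Proof.
move=> ap nP; have c : {for p, continuous (chart_map a)}.
  by apply: chart_map_continuous; rewrite inE.
exact: c.
Qed.

Lemma near_chart_dom a p : chart_dom a p -> \forall q \near p, chart_dom a q.
Proof. by move=> ap; exact: (open_nbhs_nbhs (conj (open_chart_dom a) ap)). Qed.

Lemma near_chart_codom a p : chart_dom a p ->
  \forall y \near chart_map a p, (chart_map a @` chart_dom a) y.
Proof.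
move=> ap; apply: open_nbhs_nbhs; split; first exact: open_chart_codom.
by exists p.
Qed.

Lemma smooth_transfer a b p f :
  chart_dom a p -> chart_dom b p ->
  smooth_at (chart_map a \o chart_inv b) (chart_map b p) ->
  smooth_at (f \o chart_inv a : _ -> R^o) (chart_map a p) ->
  smooth_at (f \o chart_inv b : _ -> R^o) (chart_map b p).
Proof.
move=> ap bp ab fa.
apply: (@smooth_at_ext _ _ _ ((f \o chart_inv a : _ -> R^o) \o (chart_map a \o chart_inv b))).
  have := near_chart_inv bp (near_chart_dom ap); apply: filterS => y ay /=.
  by rewrite chart_invK.
by apply: smooth_at_comp; [exact: ab|rewrite /= chart_invK].
Qed.

(** The charts of the maximal atlas: slice charts are only required to be
compatible with the given atlas, not to belong to it. *)
Definition admissible a := forall b, atlas M b -> compatible a b.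

Lemma atlas_admissible a : atlas M a -> admissible a.
Proof. by move=> Aa b Ab; exact: atlas_compatible. Qed.

Lemma smooth_germ_admissible a p f : admissible a -> chart_dom a p ->
  smooth_at (f \o chart_inv a : _ -> R^o) (chart_map a p) <-> smooth_germ p f.
Proof.
move=> Aa ap; split=> [fa b Ab bp|fp].
  by apply: (smooth_transfer ap bp) fa; have [] := Aa b Ab p ap bp.
have [b Ab bp] := atlas_cover p.
by apply: (smooth_transfer bp ap) (fp b Ab bp); have [] := Aa b Ab p ap bp.
Qed.

Lemma smooth_germ_chart a p f : atlas M a -> chart_dom a p ->
  smooth_at (f \o chart_inv a : _ -> R^o) (chart_map a p) -> smooth_germ p f.
Proof. by move=> /atlas_admissible Aa ap /(smooth_germ_admissible _ Aa ap). Qed.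

Lemma smooth_germ_ext p f g : (\forall q \near p, f q = g q) ->
  smooth_germ p f -> smooth_germ p g.
Proof.
move=> fg fp a Aa ap; apply: (smooth_at_ext _ (fp a Aa ap)).
exact: (near_chart_inv ap fg).
Qed.

Lemma smooth_germ_near p f : smooth_germ p f -> \forall q \near p, smooth_germ q f.
Proof.
move=> fp; have [a Aa ap] := atlas_cover p.
have := near_chart_map ap (smooth_at_near (fp a Aa ap)).
move=> /(filterI (near_chart_dom ap)); apply: filterS => q [aq].
exact: smooth_germ_chart.
Qed.

Lemma smooth_germ_cst p (c : R) : smooth_germ p (fun _ : M => c).
Proof. by move=> a _ _; exact: smooth_at_cst. Qed.

Lemma smooth_germD p f g : smooth_germ p f -> smooth_germ p g -> smooth_germ p (f + g).
Proof. by move=> fp gp a Aa ap; apply: smooth_atD; [exact: fp|exact: gp]. Qed.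

Lemma smooth_germZ p (c : R) f : smooth_germ p f -> smooth_germ p (c *: f).
Proof. by move=> fp a Aa ap; apply: smooth_atZ; exact: fp. Qed.

Lemma smooth_germM p f g : smooth_germ p f -> smooth_germ p g -> smooth_germ p (f * g).
Proof. by move=> fp gp a Aa ap; apply: smooth_atM; [exact: fp|exact: gp]. Qed.

Lemma smooth_germ_sum (I : Type) (r : seq I) (P : pred I) (F : I -> M -> R) p :
  (forall i, P i -> smooth_germ p (F i)) ->
  smooth_germ p (fun q => \sum_(i <- r | P i) F i q).
Proof.
move=> FS a Aa ap; apply: smooth_at_sum => i Pi; exact: FS.
Qed.

Lemma smooth_germ_admissible_coord a p i : admissible a -> chart_dom a p ->
  smooth_germ p (fun q => chart_map a q 0 i).
Proof.
move=> Aa ap; apply/(smooth_germ_admissible _ Aa ap).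
apply: (@smooth_at_ext _ _ _ (fun y : 'rV[R]_n => y 0 i : R^o)).
  have := near_chart_codom ap; apply: filterS => y [q aq <-] /=.
  by rewrite chart_invK.
by apply: (smooth_on_smooth_at openT I) => k; exact: Ck_coord.
Qed.

Lemma smooth_germ_coord a p i : atlas M a -> chart_dom a p ->
  smooth_germ p (fun q => chart_map a q 0 i).
Proof. by move=> /atlas_admissible; exact: smooth_germ_admissible_coord. Qed.

Lemma smooth_germ_continuous p f : smooth_germ p f -> {for p, continuous (f : M -> R^o)}.
Proof.
move=> fp; have [a Aa ap] := atlas_cover p.
have c : {for p, continuous ((f \o chart_inv a : _ -> R^o) \o chart_map a)}.
  apply: continuous_comp; first by apply: chart_map_continuous; rewrite inE.
  exact: smooth_at_continuous (fp a Aa ap).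
move=> N nN.
have nN' : nbhs (((f \o chart_inv a) \o chart_map a) p) N by rewrite /= chart_invK.
have H : nbhs p [set q | N (f (chart_inv a (chart_map a q)))] := c _ nN'.
apply: (filterS _ (filterI (near_chart_dom ap) H)) => q [aq] /=.
by rewrite chart_invK.
Qed.

End Germs.

(* Same for germs, whose definition quantifies over charts. *)
Opaque smooth_germ.

Section Tangent.
Context {R : realType} {n : nat} {M : manifoldType R n}.
Implicit Types (p q : M) (f g : M -> R) (v : (M -> R) -> R).

Lemma tangent_eq p v f g : tangent_space p v -> smooth_germ p f ->
  (\forall q \near p, f q = g q) -> v f = v g.
Proof. by move=> [_ loc _ _] fp fg; exact: (loc _ _ fp (smooth_germ_ext fg fp) fg). Qed.

Lemma tangent0 p v : tangent_space p v -> v (fun=> 0) = 0.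
Proof.
move=> [_ _ lin _]; have z := @smooth_germ_cst _ _ _ p (0 : R).
have := lin 1 _ _ z z; rewrite (_ : 1 *: _ + _ = (fun=> 0)); last first.
  by apply/funext => q; rewrite /= !fctE scaler0 addr0.
by rewrite mul1r => /eqP; rewrite -subr_eq0 opprD addrA subrr add0r oppr_eq0 => /eqP.
Qed.

Lemma tangentD p v f g : tangent_space p v -> smooth_germ p f -> smooth_germ p g ->
  v (f + g) = v f + v g.
Proof.
by move=> [_ _ lin _] fp gp; have := lin 1 _ _ fp gp; rewrite scale1r mul1r.
Qed.

Lemma tangentZ p v (c : R) f : tangent_space p v -> smooth_germ p f ->
  v (c *: f) = c * v f.
Proof.
move=> tv fp; have [_ _ lin _] := tv.
have := lin c _ _ fp (@smooth_germ_cst _ _ _ p 0).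
have -> : c *: f + (fun=> 0) = c *: f by exact: addr0.
by rewrite (tangent0 tv) addr0.
Qed.

Lemma tangentB p v f g : tangent_space p v -> smooth_germ p f -> smooth_germ p g ->
  v (f - g) = v f - v g.
Proof.
move=> tv fp gp; rewrite -scaleN1r (tangentD tv fp (smooth_germZ (-1) gp)).
by rewrite (tangentZ _ tv gp) mulN1r.
Qed.

Lemma tangentM p v f g : tangent_space p v -> smooth_germ p f -> smooth_germ p g ->
  v (f * g) = f p * v g + g p * v f.
Proof. by move=> [_ _ _ leib]; exact: leib. Qed.

Lemma tangent_cst p v (c : R) : tangent_space p v -> v (fun=> c) = 0.
Proof.
move=> tv; have s1 := @smooth_germ_cst _ _ _ p (1 : R).
have v1 : v (fun=> 1) = 0.
  have := tangentM tv s1 s1; rewrite (_ : _ * _ = (fun=> 1)); last first.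
    by apply/funext => q; rewrite !fctE mulr1.
  by rewrite !mul1r => /eqP; rewrite -subr_eq0 opprD addrA subrr add0r oppr_eq0 => /eqP.
have := tangentZ c tv s1; rewrite v1 mulr0 => <-.
by congr v; apply/funext => q; rewrite !fctE /= [RHS]mulr1.
Qed.

Lemma tangent_sum p v (I : Type) (r : seq I) (F : I -> M -> R) : tangent_space p v ->
  (forall i, smooth_germ p (F i)) ->
  v (fun q => \sum_(i <- r) F i q) = \sum_(i <- r) v (F i).
Proof.
move=> tv FS; elim: r => [|i r IH].
  by under eq_fun do rewrite big_nil; rewrite big_nil; exact: tangent0 tv.
rewrite big_cons -IH -(tangentD tv)//; last exact: smooth_germ_sum.
by congr v; apply/funext => q; rewrite big_cons !fctE.
Qed.

Definition partial (a : chart R n M) i f p : R :=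
  'D_(delta_mx 0 i) (f \o chart_inv a : _ -> R^o) (chart_map a p).

(** By Hadamard's lemma f is near p a constant plus a sum of products
x_i * g_i, where x_i vanishes at p and g_i takes the value of the i-th partial
derivative there; the Leibniz rule leaves only these values. *)
Lemma tangent_admissible (a : chart R n M) p v f : admissible a -> chart_dom a p ->
  tangent_space p v -> smooth_germ p f ->
  v f = \sum_i v (fun q => chart_map a q 0 i) * partial a i f p.
Proof.
move=> Aa ap tv fp.
have [g [gs g0 gE]] := hadamard ((smooth_germ_admissible f Aa ap).2 fp).
have xs i := smooth_germ_admissible_coord i Aa ap.
pose x i : M -> R := (fun q => chart_map a q 0 i) + (fun=> - chart_map a p 0 i).
have cs i : smooth_germ p (fun=> - chart_map a p 0 i) by exact: smooth_germ_cst.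
have x's i : smooth_germ p (x i) := smooth_germD (xs i) (cs i).
have gg i : smooth_germ p (g i \o chart_map a).
  apply/(smooth_germ_admissible _ Aa ap).
  apply: (smooth_at_ext _ (gs i)); have := near_chart_codom ap.
  by apply: filterS => y [q aq <-] /=; rewrite chart_invK.
pose F i : M -> R := x i * (g i \o chart_map a).
have Fs i : smooth_germ p (F i) := smooth_germM (x's i) (gg i).
have fE : \forall q \near p, f q = ((fun=> f p) + (fun q => \sum_i F i q)) q.
  apply: (filterS _ (filterI (near_chart_dom ap) (near_chart_map ap gE))).
  move=> q [aq] /=; rewrite !chart_invK// => ->.
  rewrite !fctE; congr (_ + _); apply: eq_bigr => i _.
  by rewrite /F /x !fctE !mxE.
have cf : smooth_germ p (fun=> f p) by exact: smooth_germ_cst.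
have Fsum : smooth_germ p (fun q => \sum_i F i q).
  by apply: smooth_germ_sum => i _; exact: Fs.
rewrite (tangent_eq tv fp fE) (tangentD tv cf Fsum) (tangent_cst _ tv) add0r.
rewrite (tangent_sum _ tv Fs); apply: eq_bigr => i _.
rewrite /F (tangentM tv (x's i) (gg i)) {1}/x !fctE subrr mul0r add0r /= mulrC.
by rewrite /partial g0 /x (tangentD tv (xs i) (cs i)) (tangent_cst _ tv) addr0.
Qed.

Lemma tangent_coord (a : chart R n M) p v f : atlas M a -> chart_dom a p ->
  tangent_space p v -> smooth_germ p f ->
  v f = \sum_i v (fun q => chart_map a q 0 i) * partial a i f p.
Proof. by move=> /atlas_admissible; exact: tangent_admissible. Qed.

End Tangent.

(** * The Lie algebra of vector fields *)
Section VectorFields.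
Context {R : realType} {n : nat} {M : manifoldType R n}.
Implicit Types (p q : M) (f g : M -> R) (X Y Z : vfield R M).

Lemma vfield_tangent X p : vector_field X -> tangent_space p (X p).
Proof. by case=> tX _; exact: tX. Qed.

Lemma vfield_smooth X p f : vector_field X -> smooth_germ p f ->
  smooth_germ p (fun q => X q f).
Proof. by case=> _ sX; exact: sX. Qed.

Lemma vfield_out X p f : vector_field X -> ~ smooth_germ p f -> X p f = 0.
Proof. by move=> /vfield_tangent -/(_ p)[H _ _ _]; exact: H. Qed.

Lemma vfield_ext X Y : vector_field X -> vector_field Y ->
  (forall p f, smooth_germ p f -> X p f = Y p f) -> X = Y.
Proof.
move=> vX vY H; apply/funext => p; apply/funext => f.
have [fp|fp] := pselect (smooth_germ p f); first exact: H.
by rewrite (vfield_out vX fp) (vfield_out vY fp).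
Qed.

Lemma vfield_near X p f g : vector_field X -> smooth_germ p f ->
  (\forall q \near p, f q = g q) -> \forall q \near p, X q f = X q g.
Proof.
move=> vX fp fg; apply: (filterS _ (filterI (smooth_germ_near fp) (nbhs_interior fg))).
by move=> q [fq qg]; exact: (tangent_eq (vfield_tangent q vX) fq qg).
Qed.

Lemma vfieldD_near X p f g : vector_field X -> smooth_germ p f -> smooth_germ p g ->
  \forall q \near p, X q (f + g) = X q f + X q g.
Proof.
move=> vX fp gp.
apply: (filterS _ (filterI (smooth_germ_near fp) (smooth_germ_near gp))) => q [fq gq].
exact: tangentD (vfield_tangent q vX) fq gq.
Qed.

Lemma vfieldZ_near X p c f : vector_field X -> smooth_germ p f ->
  \forall q \near p, X q (c *: f) = c * X q f.
Proof.
move=> vX fp; apply: (filterS _ (smooth_germ_near fp)) => q fq.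
exact: tangentZ (vfield_tangent q vX) fq.
Qed.

Lemma vfieldM_near X p f g : vector_field X -> smooth_germ p f -> smooth_germ p g ->
  \forall q \near p, X q (f * g) = f q * X q g + g q * X q f.
Proof.
move=> vX fp gp.
apply: (filterS _ (filterI (smooth_germ_near fp) (smooth_germ_near gp))) => q [fq gq].
exact: tangentM (vfield_tangent q vX) fq gq.
Qed.

Lemma tangent_comb p (c : R) (v w : (M -> R) -> R) :
  tangent_space p v -> tangent_space p w -> tangent_space p (c *: v + w).
Proof.
move=> tv tw; have [v0 vl vD vM] := tv; have [w0 wl wD wM] := tw; split.
- by move=> f fp; rewrite !fctE v0// w0// scaler0 addr0.
- by move=> f g fp gp fg; rewrite !fctE (vl f g fp gp fg) (wl f g fp gp fg).
- move=> d f g fp gp; rewrite !fctE (vD d f g fp gp) (wD d f g fp gp).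
  by rewrite -![_ *: _]/(_ * _); ring.
- move=> f g fp gp; rewrite !fctE (vM f g fp gp) (wM f g fp gp).
  by rewrite -![_ *: _]/(_ * _); ring.
Qed.

Lemma vector_field_comb (c : R) X Y :
  vector_field X -> vector_field Y -> vector_field (c *: X + Y).
Proof.
move=> vX vY; split=> [p|p f fp].
  by apply: tangent_comb; exact: vfield_tangent.
rewrite (_ : (fun q => _) = c *: (fun q => X q f) + (fun q => Y q f)); last by [].
exact: smooth_germD (smooth_germZ c (vfield_smooth vX fp)) (vfield_smooth vY fp).
Qed.

Lemma vector_field0 : vector_field (0 : vfield R M).
Proof.
split=> [p|p f fp]; last first.
  by have := @smooth_germ_cst R n M p 0; apply.
split.
- by move=> f _.
- by move=> f g _ _ _.
- by move=> c f g _ _; rewrite -![(0 : vfield R M) p _]/(0 : R) mulr0 addr0.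
- by move=> f g _ _; rewrite -![(0 : vfield R M) p _]/(0 : R) !mulr0 addr0.
Qed.

Lemma vector_fieldD X Y : vector_field X -> vector_field Y -> vector_field (X + Y).
Proof. by move=> vX vY; have := vector_field_comb 1 vX vY; rewrite scale1r. Qed.

Lemma bracketE X Y p f : smooth_germ p f ->
  bracket X Y p f = X p (fun q => Y q f) - Y p (fun q => X q f).
Proof. by move=> fp; rewrite /bracket asboolT. Qed.

Lemma bracket_out X Y p f : ~ smooth_germ p f -> bracket X Y p f = 0.
Proof. by move=> fp; rewrite /bracket asboolF. Qed.

Lemma bracket_near X Y p f : smooth_germ p f ->
  \forall q \near p, bracket X Y q f = X q (fun q => Y q f) - Y q (fun q => X q f).
Proof. by move=> fp; apply: (filterS _ (smooth_germ_near fp)) => q; exact: bracketE. Qed.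

(** Of the four axioms only the Leibniz rule is not formal: the products of
first derivatives coming from the two orders of composition cancel. *)
Lemma vector_field_bracket X Y :
  vector_field X -> vector_field Y -> vector_field (bracket X Y).
Proof.
move=> vX vY; split=> [p|p f fp]; last first.
  have H := smooth_germD (vfield_smooth vX (vfield_smooth vY fp))
    (smooth_germZ (-1) (vfield_smooth vY (vfield_smooth vX fp))).
  apply: (smooth_germ_ext _ H).
  apply: (filterS _ (bracket_near X Y fp)) => q ->.
  by rewrite !fctE scaleN1r.
have tX := vfield_tangent p vX; have tY := vfield_tangent p vY.
split.
- by move=> f; exact: bracket_out.
- move=> f g fp gp fg; rewrite (bracketE _ _ fp) (bracketE _ _ gp).
  rewrite (tangent_eq tX (vfield_smooth vY fp) (vfield_near vY fp fg)).
  by rewrite (tangent_eq tY (vfield_smooth vX fp) (vfield_near vX fp fg)).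
- move=> c f g fp gp.
  have cfg := smooth_germD (smooth_germZ c fp) gp.
  rewrite (bracketE _ _ fp) (bracketE _ _ gp) (bracketE _ _ cfg).
  have E Z : vector_field Z -> \forall q \near p,
      Z q (c *: f + g) = (c *: (fun q => Z q f) + (fun q => Z q g)) q.
    move=> vZ; apply: (filterS _ (filterI (vfieldD_near vZ (smooth_germZ c fp) gp)
      (vfieldZ_near c vZ fp))) => q [-> ->].
    by rewrite !fctE.
  have L (v : (M -> R) -> R) Z : tangent_space p v -> vector_field Z ->
      v (fun q => Z q (c *: f + g)) = c * v (fun q => Z q f) + v (fun q => Z q g).
    move=> tv vZ; rewrite (tangent_eq tv (vfield_smooth vZ cfg) (E Z vZ)).
    have sf := vfield_smooth vZ fp; have sg := vfield_smooth vZ gp.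
    by rewrite (tangentD tv (smooth_germZ c sf) sg) (tangentZ c tv sf).
  by rewrite (L _ _ tX vY) (L _ _ tY vX); ring.
- move=> f g fp gp.
  have fg := smooth_germM fp gp.
  rewrite (bracketE _ _ fp) (bracketE _ _ gp) (bracketE _ _ fg).
  have L (v : (M -> R) -> R) Z : tangent_space p v -> vector_field Z ->
      v (fun q => Z q (f * g)) = (f p * v (fun q => Z q g) + Z p g * v f)
        + (g p * v (fun q => Z q f) + Z p f * v g).
    move=> tv vZ; rewrite (tangent_eq tv (vfield_smooth vZ fg) (vfieldM_near vZ fp gp)).
    have sf := vfield_smooth vZ fp; have sg := vfield_smooth vZ gp.
    have := tangentD tv (smooth_germM fp sg) (smooth_germM gp sf).
    by rewrite (tangentM tv fp sg) (tangentM tv gp sf).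
  by rewrite (L _ _ tX vY) (L _ _ tY vX); ring.
Qed.

Lemma bracketC X Y : bracket X Y = - bracket Y X.
Proof.
apply/funext => p; apply/funext => f; rewrite !fctE /bracket.
by case: asboolP => _; rewrite ?opprB ?oppr0.
Qed.

Lemma bracketZDr Z (c : R) X Y : vector_field Z -> vector_field X -> vector_field Y ->
  bracket Z (c *: X + Y) = c *: bracket Z X + bracket Z Y.
Proof.
move=> vZ vX vY.
apply: (vfield_ext (vector_field_bracket vZ (vector_field_comb c vX vY))
  (vector_field_comb c (vector_field_bracket vZ vX) (vector_field_bracket vZ vY))).
move=> p f fp.
rewrite -[RHS]/(c * bracket Z X p f + bracket Z Y p f) !(bracketE _ _ fp).
have tZ := vfield_tangent p vZ; have tX := vfield_tangent p vX.
have tY := vfield_tangent p vY.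
have sX := vfield_smooth vX fp; have sY := vfield_smooth vY fp.
have -> : Z p (fun q => (c *: X + Y) q f) = c * Z p (fun q => X q f) + Z p (fun q => Y q f).
  by have := tangentD tZ (smooth_germZ c sX) sY; rewrite (tangentZ c tZ sX).
rewrite -[(c *: X + Y) p _]/(c * X p _ + Y p _); ring.
Qed.

Lemma bracketNr Z X : vector_field Z -> vector_field X ->
  bracket Z (- X) = - bracket Z X.
Proof.
move=> vZ vX.
have b0 : bracket Z 0 = 0.
  have := bracketZDr (-1) vZ vector_field0 vector_field0.
  by rewrite scaler0 addr0 scaleN1r addNr.
have := bracketZDr (-1) vZ vX vector_field0.
by rewrite !scaleN1r b0 !addr0.
Qed.

Lemma bracketNl Z X : vector_field Z -> vector_field X ->
  bracket (- X) Z = - bracket X Z.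
Proof. by move=> vZ vX; rewrite bracketC (bracketNr vZ vX) -bracketC. Qed.

Lemma bracketZDl Z (c : R) X Y : vector_field Z -> vector_field X -> vector_field Y ->
  bracket (c *: X + Y) Z = c *: bracket X Z + bracket Y Z.
Proof.
move=> vZ vX vY; rewrite bracketC (bracketZDr c vZ vX vY) opprD -scalerN.
by rewrite -!bracketC.
Qed.

Lemma jacobi X Y Z : vector_field X -> vector_field Y -> vector_field Z ->
  bracket X (bracket Y Z) = bracket (bracket X Y) Z + bracket Y (bracket X Z).
Proof.
move=> vX vY vZ.
have vXY := vector_field_bracket vX vY; have vXZ := vector_field_bracket vX vZ.
have vYZ := vector_field_bracket vY vZ.
apply: (vfield_ext (vector_field_bracket vX vYZ)
  (vector_fieldD (vector_field_bracket vXY vZ) (vector_field_bracket vY vXZ))).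
move=> p f fp.
rewrite -[RHS]/(bracket (bracket X Y) Z p f + bracket Y (bracket X Z) p f).
rewrite !(bracketE _ _ fp).
have L (A B C : vfield R M) : vector_field A -> vector_field B -> vector_field C ->
    A p (fun q => bracket B C q f) =
    A p (fun q => B q (fun q => C q f)) - A p (fun q => C q (fun q => B q f)).
  move=> vA vB vC; have tA := vfield_tangent p vA.
  rewrite (tangent_eq tA (vfield_smooth (vector_field_bracket vB vC) fp) (bracket_near B C fp)).
  have sB := vfield_smooth vB (vfield_smooth vC fp).
  have sC := vfield_smooth vC (vfield_smooth vB fp).
  exact: tangentB tA sB sC.
have sX := vfield_smooth vX fp; have sY := vfield_smooth vY fp.
have sZ := vfield_smooth vZ fp.
rewrite (L X Y Z vX vY vZ) (L Z X Y vZ vX vY) (L Y X Z vY vX vZ).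
by rewrite (bracketE _ _ sZ) (bracketE _ _ sY) (bracketE _ _ sX); ring.
Qed.

End VectorFields.

(** * Calculus in two groups of variables *)
Section PairChain.
Context {R : realType} {m k : nat}.
Variables (F : 'rV[R]_m * 'rV[R]_k -> R^o).

Let split_pair (z : 'rV[R]_(m + k)) : 'rV[R]_m * 'rV[R]_k := (lsubmx z, rsubmx z).

Let split_pair_affine y (h : R) w :
  split_pair (h *: w + y) = h *: split_pair w + split_pair y.
Proof.
by rewrite /split_pair; congr pair; apply/rowP => i; rewrite !mxE.
Qed.

Let split_pair_continuous : continuous split_pair.
Proof.
move=> z.
have H1 : {for z, continuous (fun z : 'rV[R]_(m + k) => lsubmx z)}.
  apply: smooth_at_continuous; apply/smooth_at_rV => i; under eq_fun do rewrite mxE.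
  by apply: (smooth_on_smooth_at openT I) => l; exact: Ck_coord.
have H2 : {for z, continuous (fun z : 'rV[R]_(m + k) => rsubmx z)}.
  apply: smooth_at_continuous; apply/smooth_at_rV => i; under eq_fun do rewrite mxE.
  by apply: (smooth_on_smooth_at openT I) => l; exact: Ck_coord.
exact: (cvg_pair H1 H2).
Qed.

(** The product is identified with the row vectors of size m + k, to which the
chain rule for C^1 functions applies. *)
Lemma pair_chain (x : R -> 'rV[R]_m) (y : R -> 'rV[R]_k) (t : R) :
  smooth_at F (x t, y t) -> derivable x t 1 -> derivable y t 1 ->
  'D_1 (fun s => F (x s, y s)) t =
    \sum_i 'D_1 (fun s => x s 0 i) t * 'D_(delta_mx 0 i, 0) F (x t, y t) +
    \sum_i 'D_1 (fun s => y s 0 i) t * 'D_(0, delta_mx 0 i) F (x t, y t).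
Proof.
move=> sF dx dy; pose z s : 'rV[R]_(m + k) := row_mx (x s) (y s).
have zE s : split_pair (z s) = (x s, y s) by rewrite /split_pair row_mxKl row_mxKr.
have dz : derivable z t 1.
  apply/derivable_mxP => i j; rewrite /z; case: (split_ordP j) => l ->.
    under eq_fun do rewrite row_mxEl; exact: (derivable_mxP _ _ _).1 dx i l.
  under eq_fun do rewrite row_mxEr; exact: (derivable_mxP _ _ _).1 dy i l.
have sFz : smooth_at (F \o split_pair) (z t).
  by apply: (smooth_at_affine split_pair_continuous split_pair_affine); rewrite zE.
have [U [oU Uz FU]] := (smooth_atP _ _).1 sFz.
have [Fd FE] := C1_differentiable oU (FU 1%N) Uz.
have -> : (fun s => F (x s, y s)) = (F \o split_pair) \o z.
  by apply/funext => s /=; rewrite zE.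
have [_ ->] := derive_comp dz Fd.
rewrite FE /dsum big_split_ord /=; congr (_ + _); apply: eq_bigr => i _.
  rewrite (derive_mx dz) mxE; congr (_ * _).
    by congr ('D_1 _ t); apply/funext => s; rewrite /z row_mxEl.
  rewrite -[in RHS]zE; apply: (@derive_affine _ _ _ _ F split_pair) => h.
  rewrite split_pair_affine zE; congr (_ *: _ + _); congr pair.
    by apply/rowP => j; rewrite !mxE eqxx/= (inj_eq (@lshift_inj _ _)).
  by apply/rowP => j; rewrite !mxE eqxx/= eq_rlshift.
rewrite (derive_mx dz) mxE; congr (_ * _).
  by congr ('D_1 _ t); apply/funext => s; rewrite /z row_mxEr.
rewrite -[in RHS]zE; apply: (@derive_affine _ _ _ _ F split_pair) => h.
rewrite split_pair_affine zE; congr (_ *: _ + _); congr pair.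
  by apply/rowP => j; rewrite !mxE eqxx/= eq_lrshift.
by apply/rowP => j; rewrite !mxE eqxx/= (inj_eq (@rshift_inj _ _)).
Qed.

Lemma smooth_at_slice1 x y : smooth_at F (x, y) -> smooth_at (fun z => F (z, y)) x.
Proof.
move=> sF; apply: (@smooth_at_affine _ _ _ _ F (fun z => (z, y)) (fun w => (w, 0))) => //.
- move=> z; have H1 : {for z, continuous (@id 'rV[R]_m)} by move=> N.
  have H2 := smooth_at_continuous (smooth_at_cst y z).
  exact: (cvg_pair H1 H2).
- by move=> z h w; rewrite -[RHS]/(h *: w + z, h *: 0 + y) scaler0 add0r.
Qed.

Lemma smooth_at_slice2 x y : smooth_at F (x, y) -> smooth_at (fun z => F (x, z)) y.
Proof.
move=> sF; apply: (@smooth_at_affine _ _ _ _ F (fun z => (x, z)) (fun w => (0, w))) => //.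
- move=> z; have H1 : {for z, continuous (@id 'rV[R]_k)} by move=> N.
  have H2 := smooth_at_continuous (smooth_at_cst x z).
  exact: (cvg_pair H2 H1).
- by move=> z h w; rewrite -[RHS]/(h *: 0 + x, h *: w + z) scaler0 add0r.
Qed.

Lemma derive_slice1 x y w : 'D_w (fun z => F (z, y)) x = 'D_(w, 0) F (x, y).
Proof.
apply: (@derive_affine _ _ _ _ F (fun z => (z, y))) => h.
by rewrite -[RHS]/(h *: w + x, h *: 0 + y) scaler0 add0r.
Qed.

Lemma derive_slice2 x y w : 'D_w (fun z => F (x, z)) y = 'D_(0, w) F (x, y).
Proof.
apply: (@derive_affine _ _ _ _ F (fun z => (x, z))) => h.
by rewrite -[RHS]/(h *: 0 + x, h *: w + y) scaler0 add0r.
Qed.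

End PairChain.

(** * Left-invariant and linear vector fields *)
(* Conversion must not unfold derivatives into limits of quotients. *)
Opaque derive.

Lemma derive_lincomb (R : realType) (V : normedModType R) m (c : 'I_m -> R)
    (F : 'I_m -> V -> R^o) x v : (forall i, derivable (F i) x v) ->
  'D_v (fun y => \sum_i c i * F i y : R^o) x = \sum_i c i * 'D_v (F i) x.
Proof.
move=> Fd; have -> : (fun y => \sum_i c i * F i y : R^o) = \sum_i (c i \*: F i).
  by apply/funext => y; rewrite fct_sumE.
rewrite derive_sum; last by move=> i; exact: derivableZ.
by apply: eq_bigr => i _; rewrite deriveZ.
Qed.

Lemma bilinear_exchange (R : comPzRingType) m k (a : 'I_m -> R) (b : 'I_k -> R)
    (D : 'I_m -> 'I_k -> R) :
  \sum_i a i * (\sum_j b j * D i j) = \sum_j b j * (\sum_i a i * D i j).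
Proof.
under eq_bigr do rewrite mulr_sumr; under [RHS]eq_bigr do rewrite mulr_sumr.
by rewrite exchange_big; apply: eq_bigr => j _; apply: eq_bigr => i _; exact: mulrCA.
Qed.

Section LieGroup.
Context {R : realType} {n : nat} {G : lieGroupType R n}.
Implicit Types (g h p q : G) (f : G -> R) (X Y A B : vfield R G).

Lemma lmul_near g h (P : set G) : nbhs (g * h)%g P -> \forall q \near h, P (g * q)%g.
Proof.
move=> nP; have [[N1 N2] /= [nN1 nN2] N12] := lie_mul_continuous (g, h) _ nP.
by apply: (filterS _ nN2) => q Nq; exact: (N12 (g, q) (conj (nbhs_singleton nN1) Nq)).
Qed.

Lemma rmul_near g h (P : set G) : nbhs (g * h)%g P -> \forall q \near g, P (q * h)%g.
Proof.
move=> nP; have [[N1 N2] /= [nN1 nN2] N12] := lie_mul_continuous (g, h) _ nP.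
by apply: (filterS _ nN1) => q Nq; exact: (N12 (q, h) (conj Nq (nbhs_singleton nN2))).
Qed.

Definition mul_chart (a b : chart R n G) f (xy : 'rV[R]_n * 'rV[R]_n) : R^o :=
  f (chart_inv a xy.1 * chart_inv b xy.2)%g.

Lemma smooth_mul_chart (a b : chart R n G) g h f : atlas G a -> atlas G b ->
  chart_dom a g -> chart_dom b h -> smooth_germ (g * h)%g f ->
  smooth_at (mul_chart a b f) (chart_map a g, chart_map b h).
Proof.
move=> Aa Ab ag bh fgh; have [c Ac cgh] := atlas_cover (g * h)%g.
have sm := lie_mul_smooth a b c g h Aa Ab Ac ag bh cgh.
have sf : smooth_at (f \o chart_inv c : _ -> R^o)
    (chart_map c (chart_inv a (chart_map a g, chart_map b h).1 *
      chart_inv b (chart_map a g, chart_map b h).2)%g).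
  by rewrite /= !chart_invK//; exact: fgh.
apply: (smooth_at_ext _ (smooth_at_comp sm sf)).
have [[N1 N2] /= [nN1 nN2] N12] := lie_mul_continuous (g, h) _ (near_chart_dom cgh).
have H1 := near_chart_inv ag nN1; have H2 := near_chart_inv bh nN2.
exists ((fun y => N1 (chart_inv a y)), (fun y => N2 (chart_inv b y))) => //.
move=> [x y] [/= Nx Ny]; rewrite /mul_chart /= chart_invK//.
exact: (N12 (chart_inv a x, chart_inv b y) (conj Nx Ny)).
Qed.

Lemma smooth_germ_lmul g h f : smooth_germ (g * h)%g f ->
  smooth_germ h (fun x => f (g * x)%g).
Proof.
move=> fgh; have [a Aa ag] := atlas_cover g; have [b Ab bh] := atlas_cover h.
apply: (smooth_germ_chart Ab bh).
have := smooth_at_slice2 (smooth_mul_chart Aa Ab ag bh fgh).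
by rewrite /mul_chart /= chart_invK.
Qed.

Lemma smooth_germ_rmul g h f : smooth_germ (g * h)%g f ->
  smooth_germ g (fun x => f (x * h)%g).
Proof.
move=> fgh; have [a Aa ag] := atlas_cover g; have [b Ab bh] := atlas_cover h.
apply: (smooth_germ_chart Aa ag).
have := smooth_at_slice1 (smooth_mul_chart Aa Ab ag bh fgh).
by rewrite /mul_chart /= chart_invK.
Qed.

Lemma partial_lmul (a b : chart R n G) g h f i : atlas G a -> atlas G b ->
  chart_dom a g -> chart_dom b h ->
  partial b i (fun x => f (g * x)%g) h =
    'D_(0, delta_mx 0 i) (mul_chart a b f) (chart_map a g, chart_map b h).
Proof.
move=> Aa Ab ag bh; rewrite -derive_slice2 /partial.
have -> : (fun x => f (g * x)%g) \o chart_inv b =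
    (fun y => mul_chart a b f (chart_map a g, y)).
  by apply/funext => y; rewrite /mul_chart /= chart_invK.
exact: erefl.
Qed.

Lemma partial_rmul (a b : chart R n G) g h f i : atlas G a -> atlas G b ->
  chart_dom a g -> chart_dom b h ->
  partial a i (fun x => f (x * h)%g) g =
    'D_(delta_mx 0 i, 0) (mul_chart a b f) (chart_map a g, chart_map b h).
Proof.
move=> Aa Ab ag bh; rewrite -derive_slice1 /partial.
have -> : (fun x => f (x * h)%g) \o chart_inv a =
    (fun y => mul_chart a b f (y, chart_map b h)).
  by apply/funext => y; rewrite /mul_chart /= chart_invK.
exact: erefl.
Qed.

(** The flow phi of X consists of automorphisms, so
f (phi_t (g h)) = f (phi_t g * phi_t h); this is its derivative at t = 0. *)
Lemma linear_field_mul X g h f : linear_field X -> smooth_germ (g * h)%g f ->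
  X (g * h)%g f = X h (fun x => f (g * x)%g) + X g (fun x => f (x * h)%g).
Proof.
move=> [vX [phi [flow addphi autphi]]] fgh.
have [a Aa ag] := atlas_cover g; have [b Ab bh] := atlas_cover h.
have phi0 p : phi 0 p = p by have [] := flow p.
have dphi p f' : smooth_germ p f' ->
    is_derive (0 : R^o) (1 : R^o) (fun t => f' (phi t p) : R^o) (X p f').
  have [_ [_ H]] := flow p; move=> fp; have := H 0 f'; rewrite phi0; exact.
pose x t := chart_map a (phi t g); pose y t := chart_map b (phi t h).
have dx i : is_derive (0 : R^o) (1 : R^o) (fun t => x t 0 i : R^o)
    (X g (fun q => chart_map a q 0 i)) := dphi g _ (smooth_germ_coord i Aa ag).
have dy i : is_derive (0 : R^o) (1 : R^o) (fun t => y t 0 i : R^o)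
    (X h (fun q => chart_map b q 0 i)) := dphi h _ (smooth_germ_coord i Ab bh).
have xd : derivable x 0 1.
  by apply/derivable_mxP => i j; rewrite ord1; have [] := dx j.
have yd : derivable y 0 1.
  by apply/derivable_mxP => i j; rewrite ord1; have [] := dy j.
have sF : smooth_at (mul_chart a b f) (x 0, y 0).
  by rewrite /x /y !phi0; exact: smooth_mul_chart.
have := pair_chain sF xd yd.
have -> : 'D_1 (fun s => mul_chart a b f (x s, y s)) 0 = X (g * h)%g f.
  have [_ <-] := dphi (g * h)%g f fgh.
  apply: near_eq_derive.
  have dom (c : chart R n G) (p : G) : chart_dom c p -> \forall s \near (0 : R), chart_dom c (phi s p).
    move=> cp; have [_ [cont _]] := flow p.
    have cp' : nbhs (phi 0 p) (chart_dom c) by rewrite phi0; exact: near_chart_dom.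
    exact: cont 0 _ cp'.
  apply: (filterS _ (filterI (dom a g ag) (dom b h bh))) => s [as_ bs].
  have [morph _ _] := autphi s.
  by rewrite /mul_chart /x /y /= !chart_invK// -morph.
move=> ->; rewrite addrC /x /y !phi0; congr (_ + _).
  rewrite (tangent_coord Ab bh (vfield_tangent h vX) (smooth_germ_lmul fgh)).
  apply: eq_bigr => i _; rewrite (partial_lmul f i Aa Ab ag bh); congr (_ * _).
  by have [_] := dy i.
rewrite (tangent_coord Aa ag (vfield_tangent g vX) (smooth_germ_rmul fgh)).
apply: eq_bigr => i _; rewrite (partial_rmul f i Aa Ab ag bh); congr (_ * _).
by have [_] := dx i.
Qed.

(** Tangent vectors acting on the two variables of (q, k) |-> f (q k) are
combinations of partial derivatives in independent variables, so they commute by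
the symmetry of second derivatives. *)
Lemma mixed_tangent g h f (v w : (G -> R) -> R) :
  tangent_space g v -> tangent_space h w -> smooth_germ (g * h)%g f ->
  [/\ smooth_germ g (fun q => w (fun k => f (q * k)%g)),
    smooth_germ h (fun k => v (fun q => f (q * k)%g)) &
    v (fun q => w (fun k => f (q * k)%g)) = w (fun k => v (fun q => f (q * k)%g))].
Proof.
move=> tv tw fgh.
have [a Aa ag] := atlas_cover g; have [b Ab bh] := atlas_cover h.
pose F := mul_chart a b f.
have sF : smooth_at F (chart_map a g, chart_map b h) := smooth_mul_chart Aa Ab ag bh fgh.
pose wb i := w (fun k => chart_map b k 0 i); pose va i := v (fun q => chart_map a q 0 i).
pose Fw xy : R^o := \sum_i wb i * 'D_(0, delta_mx 0 i) F xy.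
pose Fv xy : R^o := \sum_i va i * 'D_(delta_mx 0 i, 0) F xy.
have wE : \forall q \near g, w (fun k => f (q * k)%g) = Fw (chart_map a q, chart_map b h).
  apply: (filterS _ (filterI (near_chart_dom ag) (rmul_near (smooth_germ_near fgh)))).
  move=> q [aq fq]; rewrite (tangent_coord Ab bh tw (smooth_germ_lmul fq)).
  by apply: eq_bigr => i _; rewrite (partial_lmul f i Aa Ab aq bh).
have vE : \forall k \near h, v (fun q => f (q * k)%g) = Fv (chart_map a g, chart_map b k).
  apply: (filterS _ (filterI (near_chart_dom bh) (lmul_near (smooth_germ_near fgh)))).
  move=> k [bk fk]; rewrite (tangent_coord Aa ag tv (smooth_germ_rmul fk)).
  by apply: eq_bigr => i _; rewrite (partial_rmul f i Aa Ab ag bk).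
have sFw : smooth_at Fw (chart_map a g, chart_map b h).
  by apply: smooth_at_sum => i _; apply: smooth_atZ; exact: smooth_at_derive.
have sFv : smooth_at Fv (chart_map a g, chart_map b h).
  by apply: smooth_at_sum => i _; apply: smooth_atZ; exact: smooth_at_derive.
have sw : smooth_germ g (fun q => w (fun k => f (q * k)%g)).
  apply: (smooth_germ_chart Aa ag); apply: (smooth_at_ext _ (smooth_at_slice1 sFw)).
  apply: (filterS _ (filterI (near_chart_codom ag) (near_chart_inv ag wE))).
  by move=> y [[q aq <-]] /= ->; rewrite chart_invK.
have sv : smooth_germ h (fun k => v (fun q => f (q * k)%g)).
  apply: (smooth_germ_chart Ab bh); apply: (smooth_at_ext _ (smooth_at_slice2 sFv)).
  apply: (filterS _ (filterI (near_chart_codom bh) (near_chart_inv bh vE))).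
  by move=> y [[q aq <-]] /= ->; rewrite chart_invK.
split => //.
rewrite (tangent_coord Aa ag tv sw) (tangent_coord Ab bh tw sv).
have dw i : partial a i (fun q => w (fun k => f (q * k)%g)) g =
    \sum_j wb j * 'D_(0, delta_mx 0 j) ('D_(delta_mx 0 i, 0) F) (chart_map a g, chart_map b h).
  rewrite /partial (near_eq_derive (g := fun y => Fw (y, chart_map b h))); last first.
    apply: (filterS _ (filterI (near_chart_codom ag) (near_chart_inv ag wE))).
    by move=> y [[q aq <-]] /= ->; rewrite chart_invK.
  rewrite derive_slice1 (derive_lincomb _ (fun j =>
    smooth_at_derivable (smooth_at_derive (0, delta_mx 0 j) sF))).
  apply: eq_bigr => j _.
  exact: (congr1 (fun z : R => wb j * z)
    (schwarz (delta_mx 0 i, 0) (0, delta_mx 0 j) sF)).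
have dv j : partial b j (fun k => v (fun q => f (q * k)%g)) h =
    \sum_i va i * 'D_(0, delta_mx 0 j) ('D_(delta_mx 0 i, 0) F) (chart_map a g, chart_map b h).
  rewrite /partial (near_eq_derive (g := fun y => Fv (chart_map a g, y))); last first.
    apply: (filterS _ (filterI (near_chart_codom bh) (near_chart_inv bh vE))).
    by move=> y [[q aq <-]] /= ->; rewrite chart_invK.
  by rewrite derive_slice2 (derive_lincomb _ (fun i =>
    smooth_at_derivable (smooth_at_derive (delta_mx 0 i, 0) sF))).
rewrite (eq_bigr _ (fun i _ => congr1 (fun z : R => va i * z) (dw i))).
rewrite [RHS](eq_bigr _ (fun j _ => congr1 (fun z : R => wb j * z) (dv j))).
exact: (bilinear_exchange va wb (fun i j =>
  'D_(0, delta_mx 0 j) ('D_(delta_mx 0 i, 0) F) (chart_map a g, chart_map b h))).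
Qed.

Lemma bracket_left_invariant A B : left_invariant A -> left_invariant B ->
  left_invariant (bracket A B).
Proof.
move=> [vA lA] [vB lB]; split; first exact: vector_field_bracket vA vB.
move=> g h f fgh; have fh := smooth_germ_lmul fgh.
rewrite (bracketE _ _ fgh) (bracketE _ _ fh).
have L (C D : vfield R G) : left_invariant C -> left_invariant D ->
    C (g * h)%g (fun q => D q f) = C h (fun q => D q (fun x => f (g * x)%g)).
  move=> [vC lC] [vD lD]; rewrite (lC g h _ (vfield_smooth vD fgh)).
  apply: (tangent_eq (vfield_tangent h vC) (smooth_germ_lmul (vfield_smooth vD fgh))).
  by apply: (filterS _ (lmul_near (smooth_germ_near fgh))) => k fk; exact: lD.
by rewrite L// L.
Qed.

(** By the product rule, X at g h is the sum of a part that acts through left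
translation by g, which behaves as a left-invariant field does, and a part that
acts through right translation by h.  In the bracket the latter contributes the
commutator of X at g and A at h, which is zero by [mixed_tangent]. *)
Lemma bracket_linear_left_invariant X A : linear_field X -> left_invariant A ->
  left_invariant (bracket X A).
Proof.
move=> lX [vA lA]; have [vX _] := lX; split; first exact: vector_field_bracket vX vA.
move=> g h f fgh; have fh := smooth_germ_lmul fgh.
rewrite (bracketE _ _ fgh) (bracketE _ _ fh).
have sA := vfield_smooth vA fgh; have sX := vfield_smooth vX fgh.
have tX := vfield_tangent g vX; have tA := vfield_tangent h vA.
have tXh := vfield_tangent h vX.
have [s1 s2 mix] := mixed_tangent tX tA fgh.
rewrite (linear_field_mul lX sA) (lA g h _ sX).
have -> : X h (fun x => A (g * x)%g f) = X h (fun q => A q (fun x => f (g * x)%g)).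
  apply: (tangent_eq tXh (smooth_germ_lmul sA)).
  by apply: (filterS _ (lmul_near (smooth_germ_near fgh))) => k fk; exact: lA.
have -> : X g (fun x => A (x * h)%g f) = X g (fun q => A h (fun k => f (q * k)%g)).
  apply: (tangent_eq tX (smooth_germ_rmul sA)).
  by apply: (filterS _ (rmul_near (smooth_germ_near fgh))) => q fq; exact: lA.
have sXh := vfield_smooth vX fh.
have -> : A h (fun x => X (g * x)%g f) =
    A h ((fun k => X k (fun x => f (g * x)%g)) + (fun k => X g (fun q => f (q * k)%g))).
  apply: (tangent_eq tA (smooth_germ_lmul sX)).
  apply: (filterS _ (lmul_near (smooth_germ_near fgh))) => k fk.
  exact: linear_field_mul.
by rewrite (tangentD tA sXh s2) mix; ring.
Qed.

End LieGroup.

(** * The character attached to a subalgebra of codimension one *)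
Section Span.
Context {R : realType} {U : lmodType R}.
Implicit Types (S W : set U).

(** The closure conditions stated on sets, where [submod_closed] speaks of
boolean predicates. *)
Definition lin_closed W := W 0 /\ forall (c : R) x y, W x -> W y -> W (c *: x + y).

Lemma lin_closedP W : submod_closed [in W] <-> lin_closed W.
Proof.
split=> -[W0 Wl].
  split; first by move: W0; rewrite inE.
  by move=> c x y Wx Wy; have := Wl c x y; rewrite !inE; apply.
split; first by rewrite inE.
by move=> c x y; rewrite !inE; exact: Wl.
Qed.

Lemma linear_span_min S W : lin_closed W -> S `<=` W -> linear_span S `<=` W.
Proof. by move=> /lin_closedP cW SW; exact: smallest_sub. Qed.

Lemma linear_span_closed S : lin_closed (linear_span S).
Proof.
split; first by move=> W [/lin_closedP[W0 _] _].
by move=> c x y Sx Sy W [cW SW]; have /lin_closedP[_] := cW; apply; [exact: Sx|exact: Sy].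
Qed.

Lemma sub_linear_span S : S `<=` linear_span S.
Proof. exact: sub_smallest. Qed.

End Span.

Section CodimensionOne.
Context {R : realType} {U : lmodType R}.
Variables (L : set U) (br : U -> U -> U) (D : U -> U) (om : U -> R).
Implicit Types (a b x y : U).
Hypothesis linL : lin_closed L.
Hypothesis br_in : forall x y, L x -> L y -> L (br x y).
Hypothesis br_anti : forall x y, br x y = - br y x.
Hypothesis br_linr : forall (c : R) a x y, L a -> L x -> L y ->
  br a (c *: x + y) = c *: br a x + br a y.
Hypothesis br_jacobi : forall x y z, L x -> L y -> L z ->
  br x (br y z) = br (br x y) z + br y (br x z).
Hypothesis D_in : forall x, L x -> L (D x).
Hypothesis D_lin : forall (c : R) x y, L x -> L y -> D (c *: x + y) = c *: D x + D y.
Hypothesis D_der : forall x y, L x -> L y -> D (br x y) = br (D x) y + br x (D y).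
Hypothesis om_lin : forall (c : R) x y, L x -> L y -> om (c *: x + y) = c * om x + om y.
Hypothesis ker_subalg : forall x y, L x -> L y -> om x = 0 -> om y = 0 -> om (br x y) = 0.

Let om0 : om 0 = 0.
Proof.
have := om_lin 1 linL.1 linL.1; rewrite scale1r addr0 mul1r => /eqP.
by rewrite -subr_eq0 opprD addrA subrr add0r oppr_eq0 => /eqP.
Qed.

Let omD x y : L x -> L y -> om (x + y) = om x + om y.
Proof. by move=> Lx Ly; have := om_lin 1 Lx Ly; rewrite scale1r mul1r. Qed.

Let omZ (c : R) x : L x -> om (c *: x) = c * om x.
Proof. by move=> Lx; have := om_lin c Lx linL.1; rewrite om0 !addr0. Qed.

Let omN x : L x -> om (- x) = - om x.
Proof. by move=> Lx; rewrite -scaleN1r omZ// mulN1r. Qed.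

Let br_linl (c : R) a x y : L a -> L x -> L y ->
  br (c *: x + y) a = c *: br x a + br y a.
Proof.
by move=> La Lx Ly; rewrite br_anti br_linr// opprD -scalerN -!br_anti.
Qed.

Let br_self x : L x -> om (br x x) = 0.
Proof.
move=> Lx; have Lb := br_in Lx Lx.
have := omN Lb; rewrite -br_anti => E; apply/eqP.
have E2 : om (br x x) *+ 2 == 0 by rewrite mulr2n {1}E addNr.
by move: E2; rewrite mulrn_eq0.
Qed.

Section Ideal.
Variables (I : set U) (y : U).
Hypothesis linI : lin_closed I.
Hypothesis subI : I `<=` L.
Hypothesis idealI : forall a x, L a -> I x -> I (br a x).
Hypothesis D_I : forall x, I x -> I (D x).
Hypothesis abelI : forall x z, I x -> I z -> om (br x z) = 0.
Hypothesis Iy : I y.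
Hypothesis omy : om y = 1.

Let Ly : L y. Proof. exact: subI. Qed.

(** The eigenvalue of ad a on the quotient of I by its intersection with the
kernel of om, which is the line of y. *)
Definition weight a : R := om (br a y).

Let compl x : x = om x *: y + (x - om x *: y).
Proof. by rewrite addrC subrK. Qed.

Let compl_in x : L x -> L (x - om x *: y).
Proof. by move=> Lx; rewrite addrC -scaleNr; exact: linL.2. Qed.

Let compl_ker x : L x -> om (x - om x *: y) = 0.
Proof. by move=> Lx; rewrite addrC -scaleNr om_lin// omy mulr1 addNr. Qed.

(** The part of a in the kernel of om preserves this kernel, and the part of a
along y brings I into it because I is abelian modulo the kernel. *)
Lemma weight_I a x : L a -> I x -> om (br a x) = weight a * om x.
Proof.
move=> La Ix; have Lx := subI Ix.
have Ix' : I (x - om x *: y).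
  by rewrite addrC -scaleNr; exact: linI.2.
have Lx' := subI Ix'.
rewrite [x in om (br a x)]compl br_linr// om_lin//; [|exact: br_in..].
suff -> : om (br a (x - om x *: y)) = 0 by rewrite addr0 mulrC.
have La' := compl_in La.
rewrite [a in om (br a _)]compl br_linl// om_lin//; [|exact: br_in..].
by rewrite (abelI Iy Ix') mulr0 add0r; apply: ker_subalg => //; exact: compl_ker.
Qed.

Lemma weight_lin (c : R) a b : L a -> L b -> weight (c *: a + b) = c * weight a + weight b.
Proof. by move=> La Lb; rewrite /weight br_linl// om_lin//; exact: br_in. Qed.

(** An eigenvalue of a representation on a line is a character. *)
Lemma weight_br a b : L a -> L b -> weight (br a b) = 0.
Proof.
move=> La Lb; have H : br (br a b) y = br a (br b y) - br b (br a y).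
  by rewrite (br_jacobi La Lb Ly) addrK.
rewrite /weight H -scaleN1r addrC om_lin; last 2 first.
- by do 2 apply: br_in => //.
- by do 2 apply: br_in => //.
rewrite !weight_I//; [|exact: idealI..].
by rewrite -!/(weight _); ring.
Qed.

(** The component x' of x in the kernel of om can only contribute through its
bracket with y, that is, through weight x' = weight x = 0. *)
Lemma weight_ker a x : L a -> L x -> weight x = 0 -> om (br a x) = weight a * om x.
Proof.
move=> La Lx wx; have La' := compl_in La; have Lx' := compl_in Lx.
rewrite [x in om (br a x)]compl br_linr// om_lin//; [|exact: br_in..].
suff -> : om (br a (x - om x *: y)) = 0 by rewrite addr0 mulrC.
rewrite [a in om (br a _)]compl br_linl// om_lin//; [|exact: br_in..].
rewrite (ker_subalg La' Lx')// ?addr0; [|exact: compl_ker..].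
rewrite br_anti omN; last exact: br_in.
rewrite -/(weight _) addrC -scaleNr weight_lin// wx.
by rewrite /weight br_self// mulr0 addr0 oppr0 mulr0.
Qed.

(** The iterated transposes of D applied to om.  Their linear relations on I are
what forces the character to vanish on the image of D. *)
Definition theta k x : R := om (iter k D x).

Definition theta_span k (phi : U -> R) :=
  exists c : nat -> R, forall x, I x -> phi x = \sum_(j < k) c j * theta j x.

Lemma theta_spanD k phi psi : theta_span k phi -> theta_span k psi ->
  theta_span k (fun x => phi x + psi x).
Proof.
move=> [c cE] [d dE]; exists (fun j => c j + d j) => x Ix.
by rewrite cE// dE// -big_split; apply: eq_bigr => j _; rewrite mulrDl.
Qed.

Lemma theta_spanZ k (e : R) phi : theta_span k phi -> theta_span k (fun x => e * phi x).
Proof.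
move=> [c cE]; exists (fun j => e * c j) => x Ix.
by rewrite cE// mulr_sumr; apply: eq_bigr => j _; rewrite mulrA.
Qed.

Lemma theta_span0 k : theta_span k (fun=> 0).
Proof. by exists (fun=> 0) => x Ix; rewrite big1// => j _; rewrite mul0r. Qed.

Lemma theta_span_theta k j : (j < k)%N -> theta_span k (theta j).
Proof.
move=> jk; exists (fun i => (i == j)%:R) => x Ix.
rewrite (bigD1 (Ordinal jk))//= eqxx mul1r big1 ?addr0// => i /negbTE ij.
by rewrite -(inj_eq val_inj) in ij; rewrite ij mul0r.
Qed.

Lemma theta_span_sum k m (phi : nat -> U -> R) :
  (forall j, (j < m)%N -> theta_span k (phi j)) ->
  theta_span k (fun x => \sum_(j < m) phi j x).
Proof.
elim: m => [|m IH] H.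
  by under eq_fun do rewrite big_ord0; exact: theta_span0.
under eq_fun do rewrite big_ord_recr /=.
by apply: theta_spanD; [apply: IH => j jm; apply: H; exact: ltnW|exact: H].
Qed.

Lemma theta_span_eq k phi psi : (forall x, I x -> phi x = psi x) ->
  theta_span k phi -> theta_span k psi.
Proof. by move=> E [c cE]; exists c => x Ix; rewrite -E// cE. Qed.

Lemma theta_span_mono k k' phi : (k <= k')%N -> theta_span k phi -> theta_span k' phi.
Proof.
move=> kk' [c cE].
apply: (@theta_span_eq k' (fun x => \sum_(j < k) c j * theta j x)).
  by move=> x Ix; rewrite cE.
apply: (@theta_span_sum k' k (fun j x => c j * theta j x)) => j jk.
by apply/theta_spanZ/theta_span_theta; exact: leq_trans kk'.
Qed.

Lemma thetaS k x : theta k (D x) = theta k.+1 x.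
Proof. by rewrite /theta -iterSr. Qed.

Lemma theta_span_D k phi : theta_span k phi -> theta_span k.+1 (fun x => phi (D x)).
Proof.
move=> [c cE].
apply: (@theta_span_eq _ (fun x => \sum_(j < k) c j * theta j.+1 x)).
  by move=> x Ix; rewrite cE; [apply: eq_bigr => j _; rewrite thetaS|exact: D_I].
apply: (@theta_span_sum _ k (fun j x => c j * theta j.+1 x)) => j jk.
by apply/theta_spanZ/theta_span_theta.
Qed.

Let iterD_in k x : L x -> L (iter k D x).
Proof. by move=> Lx; elim: k => //= k IH; exact: D_in. Qed.

Let iterD_lin k (c : R) x z : L x -> L z ->
  iter k D (c *: x + z) = c *: iter k D x + iter k D z.
Proof.
move=> Lx Lz; elim: k => //= k ->; rewrite D_lin//; exact: iterD_in.
Qed.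

(** By the Leibniz formula D^k [a, x] is the sum over i of the terms
binomial(k, i) * [D^i a, D^(k-i) x]; those with i = 0 and i = 1 are displayed, the
others fall into the span.  The induction treats all a at once, since D a occurs
in the step. *)
Lemma theta_br k a : L a -> theta_span k.-1 (fun x => theta k (br a x) -
  (weight a * theta k x + k%:R * weight (D a) * theta k.-1 x)).
Proof.
elim: k a => [|k IH] a La.
  exists (fun=> 0) => x Ix; rewrite big_ord0 /theta/= weight_I//.
  by rewrite mul0r mul0r addr0 subrr.
have H1 := IH a La; have LDa := D_in La; have H2 := IH _ LDa.
have S1 : theta_span k (fun x => theta k (br (D a) x) - weight (D a) * theta k x).
  case: k H2 {IH H1} => [|k] /= H2.
    apply: theta_span_eq H2 => x Ix; ring.
  apply: (@theta_span_eq _ (fun x => (theta k.+1 (br (D a) x) -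
      (weight (D a) * theta k.+1 x + k.+1%:R * weight (D (D a)) * theta k x))
      + (k.+1%:R * weight (D (D a))) * theta k x)).
    by move=> x Ix; ring.
  apply: theta_spanD; first exact: (theta_span_mono (leqnSn k)).
  by apply/theta_spanZ/theta_span_theta.
have S2 : theta_span k (fun x => theta k (br a (D x)) -
    (weight a * theta k (D x) + k%:R * weight (D a) * theta k x)).
  case: k {IH H2 S1} H1 => [|k] /= H1.
    apply: (theta_span_eq _ (theta_span_mono _ (theta_span0 0))) => // x Ix.
    by rewrite /theta/= weight_I//; [ring|exact: D_I].
  by apply: (theta_span_eq _ (theta_span_D H1)) => x Ix; rewrite /= !thetaS.
apply: (theta_span_eq _ (theta_spanD S1 S2)) => x Ix.
have Lx := subI Ix.
have -> : theta k.+1 (br a x) = theta k (br (D a) x) + theta k (br a (D x)).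
  rewrite -thetaS D_der// /theta -[br (D a) x]scale1r.
  rewrite iterD_lin; [|exact: br_in|by apply: br_in => //; exact: D_in].
  rewrite om_lin; [by rewrite mul1r scale1r| |];
    by apply: iterD_in; apply: br_in => //; exact: D_in.
rewrite thetaS /= -[k.+1%:R]natr1; ring.
Qed.

Lemma theta_comb k (J : Type) (r : seq J) (c : J -> R) (b : J -> U) :
  (forall i, L (b i)) -> L (\sum_(i <- r) c i *: b i) /\
  theta k (\sum_(i <- r) c i *: b i) = \sum_(i <- r) c i * theta k (b i).
Proof.
move=> Lb; elim: r => [|i r [IH1 IH2]].
  rewrite !big_nil; split; first exact: linL.1.
  rewrite /theta; have := iterD_lin k (-1) linL.1 linL.1.
  rewrite scaleN1r addNr => ->.
  by rewrite scaleN1r addNr om0.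
rewrite !big_cons; split; first exact: linL.2.
rewrite /theta (iterD_lin k (c i) (Lb i) IH1).
by rewrite (om_lin _ (iterD_in k (Lb i)) (iterD_in k IH1)) -IH2.
Qed.

Lemma theta_relation m (c : nat -> R) k : (k < m)%N -> c k != 0 ->
  (forall x, I x -> \sum_(j < m) c j * theta j x = 0) ->
  exists d, theta_span d (theta d).
Proof.
elim: m => // m IH km ck H.
have [cm|cm] := eqVneq (c m) 0.
  have km' : (k < m)%N.
    by rewrite ltn_neqAle -ltnS km andbT; apply: contraNneq ck => ->; exact/eqP.
  by apply: (IH km' ck) => x /H; rewrite big_ord_recr /= cm mul0r addr0.
exists m, (fun j => - (c m)^-1 * c j) => x Ix.
have := H x Ix; rewrite big_ord_recr /= => /eqP; rewrite addr_eq0 => /eqP E.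
under eq_bigr do rewrite -mulrA; rewrite -mulr_sumr E.
by rewrite mulrNN mulKf.
Qed.

(** In dimension m any m + 1 linear forms are dependent, and the last nonzero
coefficient of a relation can be inverted. *)
Lemma theta_dependent m (b : 'I_m -> U) : (forall i, L (b i)) ->
  (forall x, L x -> exists c : 'I_m -> R, x = \sum_i c i *: b i) ->
  exists d, theta_span d (theta d).
Proof.
move=> Lb bL; pose T : 'M[R]_(m.+1, m) := \matrix_(k, i) theta k (b i).
have : kermx T != 0.
  by rewrite kermx_eq0 /row_free; apply: contraTneq (rank_leq_col T) => ->; rewrite ltnn.
move=> /rowV0Pn[v /sub_kermxP vT v0].
have [k vk] : exists k, v 0 k != 0.
  apply/existsP; apply: contraNT v0; rewrite negb_exists => /forallP H.
  by apply/eqP/rowP => k; rewrite mxE; apply/eqP; move: (H k); rewrite negbK.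
apply: (@theta_relation m.+1 (fun j => v 0 (inord j)) k (ltn_ord k)).
  by rewrite inord_val.
move=> x Ix; have [c ->] := bL x (subI Ix).
transitivity (\sum_(j < m.+1) \sum_i c i * (v 0 j * T j i)).
  apply: eq_bigr => j _; rewrite inord_val (theta_comb j _ c Lb).2 mulr_sumr.
  by apply: eq_bigr => i _; rewrite mxE mulrCA.
rewrite exchange_big big1// => i _; rewrite -mulr_sumr.
by move/rowP/(_ i): vT; rewrite !mxE => ->; rewrite mulr0.
Qed.

(** Let theta_(e+1) be the first of the forms that on I is a combination of the
preceding ones (theta_0 is not zero, as om y = 1).  Evaluating this relation at
[a, x], [theta_br] puts (e + 1) * weight (D a) * theta_e in the span of
theta_0, ..., theta_(e-1), and minimality forces weight (D a) = 0. *)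
Lemma weight_D d a : L a -> theta_span d (theta d) -> weight (D a) = 0.
Proof.
move=> La Hd.
have ex : exists d, `[< theta_span d (theta d) >] by exists d; exact/asboolP.
case: (ex_minnP ex) => -[|e] /asboolP He emin {Hd}.
  have [c cE] := He; have := cE y Iy.
  by rewrite big_ord0 /theta/= omy => /eqP; rewrite oner_eq0.
apply/eqP; apply: contraT => wDa.
suff : theta_span e (theta e).
  by move=> /asboolP/emin; rewrite ltnn.
have [c cE] := He.
pose r k x := theta k (br a x) - (weight a * theta k x + k%:R * weight (D a) * theta k.-1 x).
have rE k : theta_span k.-1 (r k) := theta_br k La.
have q k : (k <= e)%N -> theta_span e (fun x => theta k (br a x) - weight a * theta k x).
  case: k => [|k] ke.
    apply: (theta_span_eq _ (theta_span0 e)) => x Ix.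
    by rewrite /theta/= weight_I// subrr.
  apply: (@theta_span_eq _ (fun x => r k.+1 x + (k.+1%:R * weight (D a)) * theta k x)).
    by move=> x Ix; rewrite /r /=; ring.
  apply: theta_spanD; first exact: theta_span_mono (ltnW ke) (rE k.+1).
  by apply/theta_spanZ/theta_span_theta.
have S : theta_span e (fun x => (\sum_(j < e.+1) c j *
    (theta j (br a x) - weight a * theta j x)) - r e.+1 x).
  apply: (@theta_span_eq _ (fun x => (\sum_(j < e.+1) c j *
    (theta j (br a x) - weight a * theta j x)) + (-1) * r e.+1 x)).
    by move=> x Ix; rewrite mulN1r.
  apply: theta_spanD; last exact: theta_spanZ (rE e.+1).
  apply: (@theta_span_sum _ _ (fun j x => c j * (theta j (br a x) - weight a * theta j x))).
  by move=> j je; apply: theta_spanZ; exact: q.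
(* Characteristic zero: the factor e + 1 can be cancelled. *)
have nz : e.+1%:R * weight (D a) != 0 by rewrite mulf_neq0// pnatr_eq0.
apply: (theta_span_eq _ (theta_spanZ (e.+1%:R * weight (D a))^-1 S)) => x Ix.
have -> : \sum_(j < e.+1) c j * (theta j (br a x) - weight a * theta j x) =
    theta e.+1 (br a x) - weight a * theta e.+1 x.
  rewrite (cE _ (idealI La Ix)) (cE _ Ix) mulr_sumr -sumrB.
  by apply: eq_bigr => j _; rewrite mulrBr mulrCA.
rewrite /r /=; set A := theta e.+1 _; set B := weight a * _.
have -> : A - B - (A - (B + e.+1%:R * weight (D a) * theta e x)) =
  e.+1%:R * weight (D a) * theta e x by ring.
by rewrite mulKf.
Qed.

End Ideal.

(** Let I be the last term of the derived series that is not contained in the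
kernel of om.  It is an ideal stable under D, and it is abelian modulo the kernel
since the next term lies in the kernel.  The character is the eigenvalue of the
adjoint action on the line I / (I cap ker om). *)
Lemma codim1_character (S : nat -> set U) m (b : 'I_m -> U) z0 :
  S 0 = L ->
  (forall k, S k.+1 = linear_span [set br x y | x in S k & y in S k]) ->
  (exists k, S k = [set 0]) ->
  (forall i, L (b i)) ->
  (forall x, L x -> exists c : 'I_m -> R, x = \sum_i c i *: b i) ->
  L z0 -> om z0 != 0 ->
  exists la : U -> R, [/\
    forall (c : R) a b, L a -> L b -> la (c *: a + b) = c * la a + la b,
    forall a b, L a -> L b -> la (br a b) = 0,
    forall a, L a -> la (D a) = 0 &
    forall a x, L a -> L x -> la x = 0 -> om (br a x) = la a * om x].
Proof.
move=> S0 SS Ssol Lb bL Lz0 omz0.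
have Slin k : lin_closed (S k).
  by case: k => [|k]; rewrite ?S0// SS; exact: linear_span_closed.
have SL k : S k `<=` L.
  elim: k => [|k IH]; first by rewrite S0.
  by rewrite SS; apply: linear_span_min => // _ [x /IH Lx [z /IH Lz <-]]; exact: br_in.
have Sid k a x : L a -> S k x -> S k (br a x).
  elim: k a x => [|k IH] a x La; first by rewrite S0; exact: br_in.
  pose W := [set x | L x /\ S k.+1 (br a x)].
  suff: S k.+1 `<=` W by move=> H /H [].
  rewrite {1}SS; apply: linear_span_min.
    split.
      split; first exact: linL.1.
      have := br_linr (-1) La linL.1 linL.1; rewrite scaleN1r addNr => ->.
      by rewrite scaleN1r addNr; exact: (Slin _).1.
    move=> c u v [Lu Su] [Lv Sv]; split; first exact: linL.2.
    by rewrite br_linr//; exact: (Slin _).2.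
  move=> _ [u Su [v Sv <-]]; have Lu := SL _ _ Su; have Lv := SL _ _ Sv.
  split; first exact: br_in.
  rewrite br_jacobi// -[br (br a u) v]scale1r; apply: (Slin _).2.
    by rewrite SS; apply: sub_linear_span; exists (br a u); [exact: IH|exists v].
  by rewrite SS; apply: sub_linear_span; exists u => //; exists (br a v); [exact: IH|].
have SD k x : S k x -> S k (D x).
  elim: k x => [|k IH] x; first by rewrite S0; exact: D_in.
  pose W := [set x | L x /\ S k.+1 (D x)].
  suff: S k.+1 `<=` W by move=> H /H [].
  rewrite {1}SS; apply: linear_span_min.
    split.
      split; first exact: linL.1.
      have := D_lin (-1) linL.1 linL.1; rewrite scaleN1r addNr => ->.
      by rewrite scaleN1r addNr; exact: (Slin _).1.
    move=> c u v [Lu Su] [Lv Sv]; split; first exact: linL.2.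
    by rewrite D_lin//; exact: (Slin _).2.
  move=> _ [u Su [v Sv <-]]; have Lu := SL _ _ Su; have Lv := SL _ _ Sv.
  split; first exact: br_in.
  rewrite D_der// -[br (D u) v]scale1r; apply: (Slin _).2.
    by rewrite SS; apply: sub_linear_span; exists (D u); [exact: IH|exists v].
  by rewrite SS; apply: sub_linear_span; exists u => //; exists (D v); [exact: IH|].
have ex : exists k, `[< S k `<=` [set x | om x = 0] >].
  by have [k Sk] := Ssol; exists k; apply/asboolP => x; rewrite Sk /= => ->.
case: (ex_minnP ex) => -[|k] /asboolP Sk kmin.
  by move: Lz0; rewrite -S0 => /Sk /eqP; rewrite (negbTE omz0).
(* S k is the ideal of the argument; a vector of it outside the kernel gives y. *)
have [z [Sz omz]] : exists z, S k z /\ om z != 0.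
  apply: contrapT => H; suff : (k.+1 <= k)%N by rewrite ltnn.
  apply: kmin; apply/asboolP => z Sz; apply: contrapT => /eqP omz.
  by apply: H; exists z.
have Lz := SL _ _ Sz.
pose y := (om z)^-1 *: z.
have Sy : S k y by rewrite /y -[_ *: z]addr0; apply: (Slin k).2 => //; exact: (Slin k).1.
have omy : om y = 1 by rewrite /y omZ// mulVf.
have abelS x w : S k x -> S k w -> om (br x w) = 0.
  move=> Sx Sw; apply: Sk; rewrite SS; apply: sub_linear_span.
  by exists x => //; exists w.
have [d Hd] := theta_dependent (SL k) Lb bL.
exists (weight y); split.
- by move=> c a a' La La'; exact: (weight_lin (SL k) Sy).
- by move=> a a' La La'; exact: (weight_br (Slin k) (SL k) (Sid k) abelS Sy omy).
- move=> a La.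
  exact: (weight_D (Slin k) (SL k) (Sid k) (SD k) abelS Sy omy La Hd).
- by move=> a x La Lx; exact: (weight_ker (SL k) Sy omy La Lx).
Qed.

End CodimensionOne.

(** * Frames of tangent vectors *)
Section TangentFrame.
Context {R : realType} {n : nat} {M : manifoldType R n}.
Implicit Types (p q : M) (f : M -> R) (a : chart R n M).

Definition coords a (v : (M -> R) -> R) : 'rV[R]_n :=
  \row_j v (fun q => chart_map a q 0 j).

Definition frame_mx a (e : 'I_n -> (M -> R) -> R) : 'M[R]_n :=
  \matrix_(i, j) e i (fun q => chart_map a q 0 j).

Lemma comb_apply m (c : 'I_m -> R) (e : 'I_m -> (M -> R) -> R) f :
  (\sum_i c i *: e i) f = \sum_i c i * e i f.
Proof. by rewrite fct_sumE. Qed.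

Lemma tangent_zero p : tangent_space p (0 : (M -> R) -> R).
Proof. by have [H _] := @vector_field0 R n M; exact: H. Qed.

Lemma tangent_lincomb p (I : Type) (r : seq I) (c : I -> R) (e : I -> (M -> R) -> R) :
  (forall i, tangent_space p (e i)) -> tangent_space p (\sum_(i <- r) c i *: e i).
Proof.
move=> te; elim: r => [|i r IH]; first by rewrite big_nil; exact: tangent_zero.
by rewrite big_cons; exact: tangent_comb.
Qed.

Lemma coords_comb a m (c : 'I_m -> R) (e : 'I_m -> (M -> R) -> R) j :
  coords a (\sum_i c i *: e i) 0 j = \sum_i c i * e i (fun q => chart_map a q 0 j).
Proof. by rewrite mxE comb_apply. Qed.

Lemma tangent_coords_inj a p v w : atlas M a -> chart_dom a p ->
  tangent_space p v -> tangent_space p w -> coords a v = coords a w -> v = w.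
Proof.
move=> Aa ap tv tw E; apply/funext => f.
have [fp|fp] := pselect (smooth_germ p f); last first.
  by have [v0 _ _ _] := tv; have [w0 _ _ _] := tw; rewrite v0// w0.
rewrite (tangent_coord Aa ap tv fp) (tangent_coord Aa ap tw fp).
by apply: eq_bigr => i _; move/rowP/(_ i): E; rewrite !mxE => ->.
Qed.

Lemma frame_mx_unit a p (e : 'I_n -> (M -> R) -> R) : atlas M a -> chart_dom a p ->
  (forall i, tangent_space p (e i)) -> lin_independent [set: 'I_n] e ->
  frame_mx a e \in unitmx.
Proof.
move=> Aa ap te ind; rewrite -row_free_unit -kermx_eq0.
apply: contraT => /rowV0Pn[c /sub_kermxP cE c0].
suff H i : c 0 i = 0.
  by move: c0; rewrite (_ : c = 0) ?eqxx//; apply/rowP => i; rewrite mxE.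
apply: (ind (fun i => c 0 i)); last by rewrite inE.
have E : \sum_i c 0 i *: e i = 0.
  apply: (tangent_coords_inj Aa ap (tangent_lincomb _ _ te) (tangent_zero p)).
  apply/rowP => j; rewrite coords_comb mxE.
  by move/rowP/(_ j): cE; rewrite !mxE => cE; rewrite -[RHS]cE; apply: eq_bigr => k _; rewrite mxE.
by rewrite -[RHS]E; apply: eq_bigl => k; rewrite inE.
Qed.

Lemma tangent_frame a p (e : 'I_n -> (M -> R) -> R) v : atlas M a -> chart_dom a p ->
  (forall i, tangent_space p (e i)) -> lin_independent [set: 'I_n] e ->
  tangent_space p v ->
  v = \sum_i (coords a v *m invmx (frame_mx a e)) 0 i *: e i.
Proof.
move=> Aa ap te ind tv; have Eu := frame_mx_unit Aa ap te ind.
apply: (tangent_coords_inj Aa ap tv (tangent_lincomb _ _ te)).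
apply/rowP => j; rewrite coords_comb.
transitivity ((coords a v *m invmx (frame_mx a e) *m frame_mx a e) 0 j).
  by rewrite mulmxKV.
by rewrite mxE; apply: eq_bigr => i _; congr (_ * _); rewrite mxE.
Qed.

Lemma lin_independent_inj p (e : 'I_n -> (M -> R) -> R) (c d : 'I_n -> R) :
  lin_independent [set: 'I_n] e ->
  (forall f, smooth_germ p f -> \sum_i c i * e i f = \sum_i d i * e i f) ->
  (forall i, tangent_space p (e i)) -> c =1 d.
Proof.
move=> ind H te i; apply/eqP; rewrite -subr_eq0; apply/eqP.
apply: (ind (fun i => c i - d i)); last by rewrite inE.
apply/funext => f.
have -> : (\sum_(i in [set: 'I_n]%SET) (c i - d i) *: e i) f = \sum_i (c i - d i) * e i f.
  rewrite -comb_apply (eq_bigl xpredT)// => k; by rewrite inE.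
have [fp|fp] := pselect (smooth_germ p f).
  under eq_bigr do rewrite mulrBl; rewrite sumrB (H f fp) subrr.
  by [].
rewrite big1// => k _; have [e0 _ _ _] := te k; by rewrite e0// mulr0.
Qed.

End TangentFrame.

(** * Parallelism of a Lie group *)
Section LeftInvariant.
Context {R : realType} {n : nat} {G : lieGroupType R n}.
Implicit Types (p q g : G) (f : G -> R) (A C X : vfield R G).

Lemma left_invariant_comb (c : R) A C :
  left_invariant A -> left_invariant C -> left_invariant (c *: A + C).
Proof.
move=> [vA lA] [vC lC]; split; first exact: vector_field_comb.
by move=> g h f fgh; rewrite -[LHS]/(c * A (g * h)%g f + C (g * h)%g f) lA// lC.
Qed.

Lemma left_invariant0 : left_invariant (0 : vfield R G).
Proof. by split; [exact: vector_field0|]. Qed.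

Lemma left_invariant_closed : lin_closed (@left_invariant R n G).
Proof. by split; [exact: left_invariant0|move=> c A C; exact: left_invariant_comb]. Qed.

Lemma left_invariant_transport A p q f : left_invariant A -> smooth_germ p f ->
  A p f = A q (fun x => f (p * q^-1 * x)%g).
Proof.
move=> [vA lA] fp; have E : (p * q^-1 * q)%g = p by rewrite -mulgA mulVg mulg1.
by rewrite -{1}E lA// E.
Qed.

Lemma left_invariant_ext A C p : left_invariant A -> left_invariant C ->
  A p = C p -> A = C.
Proof.
move=> lA lC E; have [vA _] := lA; have [vC _] := lC.
apply: (vfield_ext vA vC) => q f fq.
by rewrite (left_invariant_transport p lA fq) (left_invariant_transport p lC fq) E.
Qed.

Lemma left_invariant_lincomb m (c : 'I_m -> R) (e : 'I_m -> vfield R G) :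
  (forall i, left_invariant (e i)) -> left_invariant (\sum_i c i *: e i).
Proof.
move=> le; elim/big_rec: _ => [|i A _ lA]; first exact: left_invariant0.
exact: left_invariant_comb.
Qed.

Lemma lincomb_at m (c : 'I_m -> R) (e : 'I_m -> vfield R G) p :
  (\sum_i c i *: e i) p = \sum_i c i *: e i p.
Proof. by rewrite fct_sumE. Qed.

Lemma left_invariant_independent m (e : 'I_m -> vfield R G) (J : {set 'I_m}) p q :
  (forall i, left_invariant (e i)) ->
  lin_independent J (fun i => e i p) -> lin_independent J (fun i => e i q).
Proof.
move=> le ind c cE; apply: ind; apply/funext => f.
rewrite fct_sumE.
have [fp|fp] := pselect (smooth_germ p f); last first.
  rewrite big1// => i _; have [ve _] := le i.
  by rewrite -[LHS]/(c i * e i p f) (vfield_out ve fp) mulr0.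
transitivity ((\sum_(i in J) c i *: e i q) (fun x => f (p * q^-1 * x)%g)).
  rewrite fct_sumE; apply: eq_bigr => i _.
  by rewrite -[LHS]/(c i * e i p f) (left_invariant_transport q (le i) fp).
by rewrite cE.
Qed.

End LeftInvariant.

Section Parallelism.
Context {R : realType} {n : nat} {G : lieGroupType R n}.
Implicit Types (p q g : G) (f : G -> R) (A C X : vfield R G).
Variable B : 'I_n -> vfield R G.
Hypothesis linvB : forall i, left_invariant (B i).
Hypothesis indB : forall p, lin_independent [set: 'I_n]%SET (fun i => B i p).

Let tB p i : tangent_space p (B i p).
Proof. by have [vB _] := linvB i; exact: vfield_tangent. Qed.

Lemma frame_coef : exists cf : vfield R G -> 'I_n -> R,
  forall A, left_invariant A -> A = \sum_i cf A i *: B i.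
Proof.
suff : forall A, exists c : 'I_n -> R, left_invariant A -> A = \sum_i c i *: B i.
  by move=> /choice[cf H]; exists cf.
move=> A; have [lA|nA] := pselect (left_invariant A); last by exists (fun=> 0).
have [a Aa a1] := atlas_cover (1%g : G); have [vA _] := lA.
have E := tangent_frame Aa a1 (tB 1%g) (@indB 1%g) (vfield_tangent 1%g vA).
exists (fun i => (coords a (A 1%g) *m invmx (frame_mx a (fun i => B i 1%g))) 0 i) => _.
by apply: (left_invariant_ext lA (left_invariant_lincomb _ linvB) (p := 1%g)); rewrite lincomb_at.
Qed.

Lemma frame_coef_uniq (c d : 'I_n -> R) p :
  \sum_i c i *: B i p = \sum_i d i *: B i p -> c =1 d.
Proof.
move=> E; apply: (lin_independent_inj (@indB p) _ (tB p)) => f _.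
by rewrite -(comb_apply c (fun i => B i p) f) -(comb_apply d (fun i => B i p) f) E.
Qed.

Lemma smooth_frame_mx (a : chart R n G) p i j : atlas G a -> chart_dom a p ->
  smooth_at (fun y => frame_mx a (fun i => B i (chart_inv a y)) i j : R^o) (chart_map a p).
Proof.
move=> Aa ap; have [vB _] := linvB i.
rewrite (_ : (fun y => _) = (fun q => B i q (fun q => chart_map a q 0 j)) \o chart_inv a).
  exact: (vfield_smooth vB (smooth_germ_coord j Aa ap) Aa ap).
by apply/funext => y; rewrite mxE.
Qed.

Lemma frame_mx_det (a : chart R n G) p : atlas G a -> chart_dom a p ->
  \det (frame_mx a (fun i => B i p)) != 0.
Proof.
move=> Aa ap; rewrite -unitfE -unitmxE.
exact: (frame_mx_unit Aa ap (tB p) (@indB p)).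
Qed.

Lemma smooth_invframe_mx (a : chart R n G) p i j : atlas G a -> chart_dom a p ->
  smooth_at (fun y => invmx (frame_mx a (fun i => B i (chart_inv a y))) i j : R^o)
    (chart_map a p).
Proof.
move=> Aa ap; apply: smooth_at_invmx => [k l|]; first exact: smooth_frame_mx.
by rewrite chart_invK//; exact: frame_mx_det.
Qed.

(** In a chart the coefficients are obtained by inverting the matrix of the
frame, so they inherit its smoothness. *)
Lemma field_coef X : vector_field X -> exists a : 'I_n -> G -> R,
  (forall i p, smooth_germ p (a i)) /\ forall p, X p = \sum_i a i p *: B i p.
Proof.
move=> vX.
have /choice[c cE] : forall p, exists c : 'I_n -> R, X p = \sum_i c i *: B i p.
  move=> p; have [b Ab bp] := atlas_cover p.
  have E := tangent_frame Ab bp (tB p) (@indB p) (vfield_tangent p vX).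
  by exists (fun i => (coords b (X p) *m invmx (frame_mx b (fun i => B i p))) 0 i).
exists (fun i p => c p i); split=> // i p.
have [b Ab bp] := atlas_cover p; apply: (smooth_germ_chart Ab bp).
pose F y : R^o := \sum_j X (chart_inv b y) (fun q => chart_map b q 0 j) *
  invmx (frame_mx b (fun i => B i (chart_inv b y))) j i.
apply: (@smooth_at_ext _ _ _ F); last first.
  apply: smooth_at_sum => j _; apply: smooth_atM; last exact: smooth_invframe_mx.
  exact: (vfield_smooth vX (smooth_germ_coord j Ab bp) Ab bp).
apply: (filterS _ (near_chart_codom bp)) => y [q bq <-].
rewrite /F /= chart_invK//.
have E := tangent_frame Ab bq (tB q) (@indB q) (vfield_tangent q vX).
have E2 : \sum_i c q i *: B i q =
    \sum_i (coords b (X q) *m invmx (frame_mx b (fun i => B i q))) 0 i *: B i q.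
  by rewrite -cE.
rewrite (frame_coef_uniq E2 i) mxE; apply: eq_bigr => j _.
by congr (_ * _); rewrite mxE.
Qed.

(** The zero set is closed by continuity.  In a chart around a zero, inverting the
matrix of the frame bounds the partial derivatives of u by a multiple of |u|, so
that u vanishes nearby by [zero_near]: the zero set is also open. *)
Lemma propagation (u : G -> R) (ka : 'I_n -> R) : connected [set: G] ->
  (forall p, smooth_germ p u) -> (forall i p, B i p u = ka i * u p) ->
  u 1%g = 0 -> forall p, u p = 0.
Proof.
move=> cG su Bu u1.
suff H : [set p | u p = 0] = setT by move=> p; have : [set p | u p = 0] p by rewrite H.
apply: cG; first by exists 1%g.
- exists [set p | u p = 0]; last by rewrite setTI.
  rewrite openE => p up0; rewrite /interior.
  have [a Aa ap] := atlas_cover p.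
  have sp := su p a Aa ap.
  pose IE y := invmx (frame_mx a (fun i => B i (chart_inv a y))).
  have IEb i j : \forall y \near chart_map a p, `|IE y i j| <= `|IE (chart_map a p) i j| + 1.
    have c := smooth_at_continuous (smooth_invframe_mx i j Aa ap).
    have := (@cvgrPdist_le _ _ _ _ (nbhs_filter (chart_map a p)) _ _).1 c 1 ltr01.
    apply: filterS => y; rewrite distrC => H.
    rewrite -[IE y i j](subrK (IE (chart_map a p) i j)).
    by rewrite (le_trans (ler_normD _ _))// addrC lerD2l.
  pose K j := \sum_i (`|IE (chart_map a p) j i| + 1) * `|ka i|.
  have K0 j : 0 <= K j by apply: sumr_ge0 => i _; rewrite mulr_ge0// addr_ge0.
  pose C := \sum_j K j.
  have KC j : K j <= C by rewrite /C (bigD1 j)//= lerDl sumr_ge0.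
  have C0 : 0 <= C by exact: sumr_ge0.
  have Hz : \forall y \near chart_map a p, (u \o chart_inv a) y = 0.
    apply: (@zero_near _ _ (u \o chart_inv a : _ -> R^o) _ C C0 sp).
      by rewrite /= chart_invK.
    have IEall : \forall y \near chart_map a p, forall j i,
        `|IE y j i| <= `|IE (chart_map a p) j i| + 1.
      exact: (filter_forall (nbhs_filter (chart_map a p))
        (fun j => filter_forall (nbhs_filter (chart_map a p)) (IEb j))).
    apply: (filterS _ (filterI (near_chart_codom ap) IEall)).
    move=> y [[q aq <-] IEy] j.
    pose E := frame_mx a (fun i => B i q).
    have Eu : E \in unitmx by exact: (frame_mx_unit Aa aq (tB q) (@indB q)).
    have IEq : IE (chart_map a q) = invmx E by rewrite /IE chart_invK.
    pose d : 'cV[R]_n := \col_k partial a k u q.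
    have Ed : E *m d = \col_i (ka i * u q).
      apply/colP => i; rewrite !mxE -Bu (tangent_coord Aa aq (tB q i) (su q)).
      by apply: eq_bigr => k _; rewrite !mxE.
    have -> : 'D_(delta_mx 0 j) (u \o chart_inv a : _ -> R^o) (chart_map a q) = d j 0.
      by rewrite mxE.
    rewrite -[d](mulKmx Eu) Ed mxE /= chart_invK//.
    apply: (le_trans (ler_norm_sum _ _ _)).
    apply: (@le_trans _ _ (K j * `|u q|)); last by rewrite ler_wpM2r.
    rewrite /K mulr_suml ler_sum// => i _.
    rewrite mxE !normrM mulrA ler_wpM2r// ler_wpM2r//.
    by rewrite -IEq; exact: IEy.
  apply: (filterS _ (filterI (near_chart_dom ap) (near_chart_map ap Hz))).
  by move=> q [aq] /=; rewrite chart_invK.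
- exists [set p | u p = 0]; last by rewrite setTI.
  rewrite -openC openE => p /= up; rewrite /interior.
  have nz : nbhs (u p) [set r : R | r != 0].
    by apply: open_nbhs_nbhs; split; [exact: open_neq|exact/eqP].
  have H : nbhs p [set q | u q != 0] := smooth_germ_continuous (su p) nz.
  by apply: (filterS _ H) => q /= /eqP.
Qed.

End Parallelism.

(** * Consequences of the rank condition *)
Section Rank.
Context {R : realType} {V : lmodType R}.

Lemma family_rank_full k (v : 'I_k -> V) :
  family_rank v = k <-> lin_independent [set: 'I_k]%SET v.
Proof.
split=> [rk|ind].
  apply: contrapT => nind.
  have k0 : (0 < k)%N.
    by case: k v {rk} nind => // v nind; exfalso; apply: nind => c _ [].
  have : (family_rank v <= k.-1)%N.
    apply/bigmax_leqP => J /asboolP indJ; rewrite -ltnS prednK//.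
    rewrite ltn_neqAle -[X in (_ <= X)%N]card_ord max_card andbT.
    apply/eqP => Jk; apply: nind; suff <- : J = [set: 'I_k]%SET by [].
    by apply/eqP; rewrite eqEcard finset.subsetT cardsT card_ord Jk leqnn.
  by rewrite rk -ltnS prednK// ltnn.
apply/eqP; rewrite eqn_leq; apply/andP; split.
  by apply/bigmax_leqP => J _; rewrite -[X in (_ <= X)%N]card_ord max_card.
have := @leq_bigmax_cond _ (fun J : {set 'I_k} => `[< lin_independent J v >])
  (fun J => #|J|) [set: 'I_k]%SET.
by rewrite cardsT card_ord; apply; exact/asboolP.
Qed.

Lemma family_rank_lt k (v : 'I_k -> V) :
  (family_rank v < k)%N <-> ~ lin_independent [set: 'I_k]%SET v.
Proof.
rewrite -family_rank_full; split=> [rk E|nE]; first by move: rk; rewrite E ltnn.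
rewrite ltn_neqAle; apply/andP; split; first exact/eqP.
by apply/bigmax_leqP => J _; rewrite -[X in (_ <= X)%N]card_ord max_card.
Qed.

End Rank.

Section Setup.
Context {R : realType} {n : nat} {G : lieGroupType R n.+1}.
Implicit Types (p q g : G) (f : G -> R) (A C W X : vfield R G) (Y : 'I_n -> vfield R G).

Lemma frame_ord0 X Y : frame X Y ord0 = X.
Proof. by rewrite /frame unlift_none. Qed.

Lemma frame_lift X Y i : frame X Y (lift ord0 i) = Y i.
Proof. by rewrite /frame liftK. Qed.

Lemma frame_sum X Y (V : zmodType) (F : 'I_n.+1 -> vfield R G -> V) :
  \sum_i F i (frame X Y i) = F ord0 X + \sum_i F (lift ord0 i) (Y i).
Proof.
rewrite big_ord_recl frame_ord0; congr (_ + _).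
by apply: eq_bigr => i _; rewrite frame_lift.
Qed.

(** Automorphisms fix 1, so the flow is stationary there. *)
Lemma linear_field_1 X : linear_field X -> X 1%g = 0.
Proof.
move=> [vX [phi [flow _ aut]]]; apply/funext => f.
have [f1|f1] := pselect (smooth_germ 1%g f); last exact: vfield_out vX f1.
have phi1 t : phi t 1%g = 1%g.
  have [morph _ _] := aut t; have := morph 1%g 1%g; rewrite mulg1 => E.
  by rewrite -[LHS](mulKg (phi t 1%g)) -E mulVg.
have [phi0 [_ dphi]] := flow 1%g.
have := dphi 0 f; rewrite phi1 => /(_ f1)[_ <-].
rewrite (_ : f \o phi^~ 1%g = cst (f 1%g)); first exact: derive_cst.
by apply/funext => t; rewrite /= phi1.
Qed.

(** The fields c X + A with A in L form a Lie algebra, because bracketing with X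
preserves L and the bracket of X with itself is zero. *)
Lemma lie_generated_decomp X Y (L : set (vfield R G)) : linear_field X ->
  L `<=` @left_invariant R n.+1 G -> lin_closed L ->
  (forall A C, L A -> L C -> L (bracket A C)) ->
  (forall A, L A -> L (bracket X A)) -> (forall i, L (Y i)) ->
  forall W, lie_generated (range (frame X Y)) W -> exists (c : R) A, L A /\ W = c *: X + A.
Proof.
move=> lX Linv Llin Lbr LX LY W.
have [vX _] := lX.
pose GG := [set W : vfield R G | exists (c : R) A, L A /\ W = c *: X + A].
suff H : lie_generated (range (frame X Y)) `<=` GG by move=> /H.
have LN A : L A -> L (- A).
  by move=> LA; rewrite -scaleN1r -[_ *: A]addr0; apply: Llin.2 => //; exact: Llin.1.
have LD A C : L A -> L C -> L (A + C).
  by move=> LA LC; rewrite -[A]scale1r; exact: Llin.2.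
have LZ c A : L A -> L (c *: A).
  by move=> LA; rewrite -[_ *: A]addr0; apply: Llin.2 => //; exact: Llin.1.
have vL A : L A -> vector_field A by move=> /Linv[].
apply: smallest_sub; last first.
  move=> _ [i _ <-]; rewrite /frame; case: (unlift ord0 i) => [j|].
    by exists 0, (Y j); rewrite scale0r add0r.
  by exists 1, 0; rewrite scale1r addr0; split=> //; exact: Llin.1.
split.
- move=> _ [c [A [LA ->]]]; exact (vector_field_comb c vX (vL A LA)).
- apply/lin_closedP; split.
    by exists 0, 0; rewrite scale0r addr0; split=> //; exact: Llin.1.
  move=> c _ _ [d [A [LA ->]]] [e [C [LC ->]]].
  exists (c * d + e), (c *: A + C); split; first exact: Llin.2.
  by rewrite scalerDr scalerA scalerDl addrACA.
- move=> _ _ [c [A [LA ->]]] [d [C [LC ->]]].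
  exists 0, (d *: bracket A X + c *: bracket X C + bracket A C); split.
    have LAX : L (bracket A X) by rewrite bracketC; apply: LN; exact: LX.
    exact (LD _ _ (LD _ _ (LZ d _ LAX) (LZ c _ (LX C LC))) (Lbr _ _ LA LC)).
  have vA := vL A LA; have vC := vL C LC.
  rewrite scale0r add0r (bracketZDl c (vector_field_comb d vX vC) vX vA).
  rewrite (bracketZDr d vX vX vC) (bracketZDr d vA vX vC).
  have -> : bracket X X = 0.
    have E := bracketC X X.
    apply/eqP; rewrite -[_ == _]/(bracket X X == 0).
    have : (2 : R) *: bracket X X = 0 by rewrite scaler_nat mulr2n {1}E addNr.
    by move/eqP; rewrite scaler_eq0 pnatr_eq0.
  by rewrite scaler0 add0r addrCA addrA.
Qed.

(** At a point g of full rank X_g is transverse to the Y_i.  Translated to 1 it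
becomes a tangent vector which, by the rank condition, is the value of some
c X + A with A left-invariant ([lie_generated_decomp]); as X vanishes at 1, A
takes this value there and is the required field. *)
Lemma ars_basis X Y : simple_ARS X Y ->
  exists2 Y0, left_invariant Y0 & forall p,
    lin_independent [set: 'I_n.+1]%SET (fun i => frame Y0 Y i p).
Proof.
move=> [lX lY [g /family_rank_full ind] gen].
have [vX _] := lX.
have vY i : vector_field (Y i) by have [] := lY i.
have tX := vfield_tangent g vX.
(* The value of X at g, translated to 1 by the inverse of g. *)
pose v1 f := if `[< smooth_germ (1%g : G) f >] then X g (fun q => f (g^-1 * q)%g) else 0.
have sg f : smooth_germ (1%g : G) f -> smooth_germ g (fun q => f (g^-1 * q)%g).
  by move=> f1; apply: smooth_germ_lmul; rewrite mulVg.
have v1E f : smooth_germ (1%g : G) f -> v1 f = X g (fun q => f (g^-1 * q)%g).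
  by move=> f1; rewrite /v1 asboolT.
have tv1 : tangent_space (1%g : G) v1.
  split.
  - by move=> f f1; rewrite /v1 asboolF.
  - move=> f h f1 h1 fh; rewrite (v1E f f1) (v1E h h1).
    apply: (tangent_eq tX (sg f f1)).
    have := @lmul_near _ _ G g^-1%g g [set q | f q = h q].
    by rewrite mulVg; apply.
  - move=> c f h f1 h1.
    rewrite (v1E _ (smooth_germD (smooth_germZ c f1) h1)) (v1E f f1) (v1E h h1).
    rewrite -(tangentZ c tX (sg f f1)).
    exact (tangentD tX (smooth_germZ c (sg f f1)) (sg h h1)).
  - move=> f h f1 h1.
    rewrite (v1E _ (smooth_germM f1 h1)) (v1E f f1) (v1E h h1).
    have := tangentM tX (sg f f1) (sg h h1); rewrite mulVg; exact.
have [W genW W1] : exists2 W, lie_generated (range (frame X Y)) W & W 1%g = v1.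
  by move: tv1; rewrite -gen => -[W ? ?]; exists W.
have [c [A [lA WE]]] := @lie_generated_decomp X Y _ lX (@subset_refl _ _)
  left_invariant_closed (fun A C lA lC => bracket_left_invariant lA lC)
  (fun A lA => bracket_linear_left_invariant lX lA) lY W genW.
have A1 : A 1%g = v1.
  by rewrite -W1 WE -[RHS]/(c *: X 1%g + A 1%g) (linear_field_1 lX) scaler0 add0r.
have lB i : left_invariant (frame A Y i).
  by rewrite /frame; case: (unlift ord0 i).
exists A => // p.
suff ind1 : lin_independent [set: 'I_n.+1]%SET (fun i => frame A Y i 1%g).
  move=> d; exact: (left_invariant_independent lB ind1 (q := p)).
move=> d dE i _; apply: (ind d); last by rewrite inE.
apply/funext => f.
have [fg|fg] := pselect (smooth_germ g f); last first.
  have vF k : vector_field (frame X Y k) by rewrite /frame; case: (unlift ord0 k) => [j|]; [exact: vY|exact: vX].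
  rewrite fct_sumE big1// => k _.
  by rewrite -[LHS]/(d k * frame X Y k g f) (vfield_out (vF k) fg) mulr0.
have f1 : smooth_germ (1%g : G) (fun x => f (g * x)%g).
  by apply: smooth_germ_lmul; rewrite mulg1.
transitivity ((\sum_(i in [set: 'I_n.+1]%SET) d i *: frame A Y i 1%g) (fun x => f (g * x)%g)); last by rewrite dE.
rewrite !fct_sumE; apply: eq_bigr => k _.
rewrite -[LHS]/(d k * frame X Y k g f) -[RHS]/(d k * frame A Y k 1%g _); congr (_ * _).
rewrite /frame; case: (unlift ord0 k) => [j|].
  by have [_ l] := lY j; rewrite -l ?mulg1.
rewrite A1 (v1E _ f1); congr (X g _).
by apply/funext => q; rewrite mulgA mulgV mul1g.
Qed.

End Setup.

(** * The function defining the singular locus *)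
Section CoefDerivative.
Context {R : realType} {n : nat} {G : lieGroupType R n}.
Implicit Types (p q g : G) (f : G -> R) (A C X : vfield R G).
Variable B : 'I_n -> vfield R G.
Hypothesis linvB : forall i, left_invariant (B i).
Hypothesis indB : forall p, lin_independent [set: 'I_n]%SET (fun i => B i p).
Variable cf : vfield R G -> 'I_n -> R.
Hypothesis cfE : forall A, left_invariant A -> A = \sum_i cf A i *: B i.

Lemma cf_at A p f : left_invariant A -> A p f = \sum_i cf A i * B i p f.
Proof. by move=> lA; rewrite {1}(cfE lA) lincomb_at comb_apply. Qed.

Lemma cf_uniq A (c : 'I_n -> R) : left_invariant A -> A = \sum_i c i *: B i -> cf A =1 c.
Proof.
move=> lA E; apply: (frame_coef_uniq linvB indB (p := 1%g)).
by rewrite -!lincomb_at -E -cfE.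
Qed.

Lemma cf_lin (c : R) A C i : left_invariant A -> left_invariant C ->
  cf (c *: A + C) i = c * cf A i + cf C i.
Proof.
move=> lA lC; apply: (cf_uniq (c := fun i => c * cf A i + cf C i)).
  exact: left_invariant_comb.
rewrite {1}(cfE lA) {1}(cfE lC) scaler_sumr -big_split; apply: eq_bigr => k _.
by rewrite scalerA scalerDl.
Qed.

Lemma cf_basis j i : cf (B j) i = (i == j)%:R.
Proof.
apply: (cf_uniq (c := fun i => (i == j)%:R) (linvB j)).
rewrite (bigD1 j)//= eqxx scale1r big1 ?addr0// => k /negbTE ->.
by rewrite scale0r.
Qed.

(** Expand [A, sum_j a_j B_j] = sum_i (A a_i) B_i + sum_j a_j [A, B_j] and compare
the coefficients of B_i; those of the brackets are constants, as these brackets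
are left-invariant. *)
Lemma coef_derivative X A (a : 'I_n -> G -> R) p i : vector_field X ->
  (forall i p, smooth_germ p (a i)) -> (forall p, X p = \sum_i a i p *: B i p) ->
  left_invariant A -> left_invariant (bracket A X) ->
  A p (a i) = cf (bracket A X) i - \sum_j a j p * cf (bracket A (B j)) i.
Proof.
move=> vX sa XE lA lAX.
have [vA _] := lA; have tA := vfield_tangent p vA.
have vB j : vector_field (B j) by have [] := linvB j.
have tB j := vfield_tangent p (vB j).
have XfE q f : X q f = \sum_j a j q * B j q f by rewrite XE comb_apply.
suff H : (fun k => cf (bracket A X) k) =1
    (fun k => A p (a k) + \sum_j a j p * cf (bracket A (B j)) k).
  by rewrite (H i) addrK.
apply: (lin_independent_inj (@indB p) _ tB) => f fp.
rewrite -(cf_at p f lAX) (bracketE _ _ fp).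
have sB j := vfield_smooth (vB j) fp.
have -> : (fun q => X q f) = (fun q => \sum_j (a j * (fun q => B j q f)) q).
  by apply/funext => q; rewrite XfE.
rewrite (tangent_sum _ tA (fun j => smooth_germM (sa j p) (sB j))) XfE.
rewrite (eq_bigr _ (fun j _ => tangentM tA (sa j p) (sB j))).
rewrite big_split /= addrAC -sumrB addrC.
under [RHS]eq_bigr do rewrite mulrDl.
rewrite [RHS]big_split /=; congr (_ + _); first by apply: eq_bigr => j _; rewrite mulrC.
under [RHS]eq_bigr do rewrite mulr_suml.
rewrite [RHS]exchange_big; apply: eq_bigr => j _.
rewrite -mulrBr -(bracketE A (B j) fp) (cf_at p f (bracket_left_invariant lA (linvB j))).
by rewrite mulr_sumr; apply: eq_bigr => k _; rewrite mulrA.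
Qed.

End CoefDerivative.

Section DefiningFunction.
Context {R : realType} {n : nat} {G : lieGroupType R n.+1}.
Variables (X : vfield R G) (Y : 'I_n -> vfield R G).
Implicit Types (p q g : G) (f : G -> R) (A C : vfield R G).

(** The function f is the coefficient of X on Y_0, and om reads the coefficient
of a left-invariant field on Y_0.  Writing F p for the left-invariant field that
agrees with X at p, one has A f = om (D A) - om [A, F p], and the character la of
[codim1_character] turns the last term into la A * f once la (F p) = 0 is
known. *)
Lemma singular_locus_function : connected [set: G] -> simple_ARS X Y ->
  lie_solvable (@left_invariant R n.+1 G) -> lie_subalgebra (linear_span (range Y)) ->
  exists (f : G -> R) (om la : vfield R G -> R),
  [/\ (forall p, smooth_germ p f) /\ f 1%g = 0,
    forall p, singular_locus X Y p <-> f p = 0,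
    forall A, left_invariant A -> linear_span (range Y) A <-> om A = 0,
    forall A p, left_invariant A -> A p f = om (assoc_derivation X A) - la A * f p &
    exists2 A, left_invariant A & om (assoc_derivation X A) != 0].
Proof.
move=> cG ars sol [_ _ subY].
have [lX lY _ gen] := ars; have [vX _] := lX.
have [Y0 lY0 indB] := ars_basis ars.
pose B := frame Y0 Y.
have lB i : left_invariant (B i) by rewrite /B /frame; case: (unlift ord0 i).
have [cf cfE] := frame_coef lB indB.
pose om A := cf A ord0.
have cfl := cf_lin lB indB cfE.
have spanL : linear_span (range Y) `<=` @left_invariant R n.+1 G.
  by apply: linear_span_min; [exact: left_invariant_closed|move=> _ [i _ <-]].
have spanP A : left_invariant A -> linear_span (range Y) A <-> om A = 0.
  move=> lA; split.
    pose W := [set A | left_invariant A /\ om A = 0].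
    suff H : linear_span (range Y) `<=` W by move=> /H[].
    apply: linear_span_min.
      split.
        split; first exact: left_invariant0.
        have := cfl (-1) _ _ ord0 left_invariant0 left_invariant0.
        rewrite scaler0 addr0 mulN1r addNr; exact.
      move=> c C C' [lC oC] [lC' oC']; split; first exact: left_invariant_comb.
      by rewrite /om cfl// -!/(om _) oC oC' mulr0 addr0.
    move=> _ [i _ <-]; split; first exact: lY.
    have := cf_basis lB indB cfE (lift ord0 i) ord0.
    by rewrite /B frame_lift /om => ->.
  move=> omA; rewrite (cfE A lA) big_ord_recl -/(om A) omA scale0r add0r.
  have [S0 Sl] := linear_span_closed (range Y).
  elim/big_rec: _ => [|i C _ SC]; first exact: S0.
  by apply: Sl SC; apply: sub_linear_span; exists i => //; rewrite /B frame_lift.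
have D_in A : left_invariant A -> left_invariant (assoc_derivation X A).
  move=> lA; have := left_invariant_comb (-1)
    (bracket_linear_left_invariant lX lA) left_invariant0.
  by rewrite addr0 scaleN1r.
have vL A : left_invariant A -> vector_field A by case.
have D_lin (c : R) A C : left_invariant A -> left_invariant C ->
    assoc_derivation X (c *: A + C) = c *: assoc_derivation X A + assoc_derivation X C.
  move=> lA lC; rewrite /assoc_derivation (bracketZDr c vX (vL _ lA) (vL _ lC)).
  by rewrite opprD scalerN.
have D_der A C : left_invariant A -> left_invariant C ->
    assoc_derivation X (bracket A C) =
    bracket (assoc_derivation X A) C + bracket A (assoc_derivation X C).
  move=> lA lC; rewrite /assoc_derivation (jacobi vX (vL _ lA) (vL _ lC)) opprD.
  have vXA := vector_field_bracket vX (vL _ lA).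
  have vXC := vector_field_bracket vX (vL _ lC).
  by rewrite (bracketNl (vL _ lC) vXA) (bracketNr (vL _ lA) vXC).
have ker_sub A C : left_invariant A -> left_invariant C -> om A = 0 -> om C = 0 ->
    om (bracket A C) = 0.
  move=> lA lC oA oC; apply/(spanP _ (bracket_left_invariant lA lC)).
  by apply: subY; apply/spanP.
have omY0 : om Y0 != 0.
  have := cf_basis lB indB cfE ord0 ord0.
  by rewrite /B frame_ord0 /om => ->; rewrite eqxx oner_eq0.
have [la [la_lin la_br la_D la_om]] := @codim1_character R (vfield R G)
  (@left_invariant R n.+1 G) (@bracket R n.+1 G) (assoc_derivation X) om
  left_invariant_closed (fun A C => @bracket_left_invariant R n.+1 G A C)
  (@bracketC R n.+1 G)
  (fun c Z A C lZ lA lC => bracketZDr c (vL Z lZ) (vL A lA) (vL C lC))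
  (fun Z A C lZ lA lC => jacobi (vL Z lZ) (vL A lA) (vL C lC))
  D_in D_lin D_der (fun c A C => @cfl c A C ord0) ker_sub
  (derived_algebra (@left_invariant R n.+1 G)) n.+1 B Y0
  erefl (fun=> erefl) sol lB (fun A lA => ex_intro _ (cf A) (cfE A lA)) lY0 omY0.
have [a [sa XE]] := field_coef lB indB vX.
have lin_sum (eta : vfield R G -> R) (c : 'I_n.+1 -> R) :
    (forall (d : R) A C, left_invariant A -> left_invariant C ->
      eta (d *: A + C) = d * eta A + eta C) ->
    eta (\sum_i c i *: B i) = \sum_i c i * eta (B i).
  move=> eta_lin.
  have eta0 : eta 0 = 0.
    have := eta_lin (-1) _ _ left_invariant0 left_invariant0.
    by rewrite scaler0 addr0 mulN1r addNr.
  suff [] : left_invariant (\sum_i c i *: B i) /\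
    eta (\sum_i c i *: B i) = \sum_i c i * eta (B i) by [].
  elim/big_rec2: _ => [|i y C _ [lC <-]]; first by split; [exact: left_invariant0|].
  by split; [exact: left_invariant_comb|exact: eta_lin].
have DE A : assoc_derivation X A = bracket A X by rewrite [RHS]bracketC.
have lAX A : left_invariant A -> left_invariant (bracket A X).
  by move=> lA; rewrite -DE; exact: D_in.
have aD A p i (lA : left_invariant A) :=
  coef_derivative lB indB cfE p i vX sa XE lA (lAX A lA).
have br_lin A : left_invariant A -> forall (d : R) C C',
    left_invariant C -> left_invariant C' ->
    bracket A (d *: C + C') = d *: bracket A C + bracket A C'.
  by move=> lA d C C' lC lC'; exact: bracketZDr (vL A lA) (vL C lC) (vL C' lC').
have eta_br (eta : vfield R G -> R) A (c : 'I_n.+1 -> R) : left_invariant A ->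
    (forall (d : R) A C, left_invariant A -> left_invariant C ->
      eta (d *: A + C) = d * eta A + eta C) ->
    eta (bracket A (\sum_i c i *: B i)) = \sum_i c i * eta (bracket A (B i)).
  move=> lA eta_lin; apply: (lin_sum (fun C => eta (bracket A C))) => d C C' lC lC'.
  rewrite (br_lin A lA d C C' lC lC').
  exact: (eta_lin _ _ _ (bracket_left_invariant lA lC) (bracket_left_invariant lA lC')).
pose F p : vfield R G := \sum_i a i p *: B i.
have lF p : left_invariant (F p) by exact: left_invariant_lincomb.
have aD_eta (eta : vfield R G -> R) A p : left_invariant A ->
    (forall (d : R) A C, left_invariant A -> left_invariant C ->
      eta (d *: A + C) = d * eta A + eta C) ->
    \sum_i eta (B i) * A p (a i) = eta (bracket A X) - eta (bracket A (F p)).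
  move=> lA eta_lin; rewrite (eta_br eta A _ lA eta_lin).
  have etaE C : left_invariant C -> eta C = \sum_i cf C i * eta (B i).
    by move=> lC; rewrite {1}(cfE C lC) lin_sum.
  rewrite (etaE _ (lAX A lA)).
  under [X in _ - X]eq_bigr => j _ do
    rewrite (etaE _ (bracket_left_invariant lA (lB j))) mulr_sumr.
  rewrite [X in _ - X]exchange_big -sumrB; apply: eq_bigr => i _.
  rewrite (aD A p i lA) mulrBr [eta _ * cf _ _]mulrC mulr_sumr; congr (_ - _).
  by apply: eq_bigr => j _; ring.
have a1 i : a i 1%g = 0.
  have E : \sum_i a i 1%g *: B i 1%g = \sum_i (fun=> 0 : R) i *: B i 1%g.
    by rewrite -XE (linear_field_1 lX) big1// => k _; rewrite scale0r.
  exact: (frame_coef_uniq lB indB E).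
(* The function p |-> la (F p); it vanishes at 1 because X does. *)
pose u p := \sum_i a i p * la (B i).
have uE p : u p = la (F p) by rewrite /F lin_sum.
(* u is constant along every B i: la vanishes on D (B i) and on brackets. *)
have u0 p : u p = 0.
  apply: (propagation lB indB (ka := fun=> 0) cG) => [q|i q|].
  - rewrite (_ : u = fun q => \sum_i (la (B i) *: a i) q).
      by apply: smooth_germ_sum => i _; exact: smooth_germZ.
    by apply/funext => q'; apply: eq_bigr => i _; rewrite mulrC.
  - rewrite mul0r (_ : u = fun q => \sum_i (la (B i) *: a i) q); last first.
      by apply/funext => q'; apply: eq_bigr => k _; rewrite mulrC.
    have tB := vfield_tangent q (vL _ (lB i)).
    rewrite (tangent_sum _ tB (fun k => smooth_germZ (la (B k)) (sa k q))).
    rewrite (eq_bigr _ (fun k _ => tangentZ (la (B k)) tB (sa k q))).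
    rewrite (aD_eta la (B i) q (lB i) la_lin) -DE (la_D _ (lB i)).
    by rewrite (la_br _ _ (lB i) (lF q)) subrr.
  - by rewrite /u big1// => i _; rewrite a1 mul0r.
have omF p : om (F p) = a ord0 p.
  exact: (cf_uniq lB indB cfE (lF p) erefl).
exists (a ord0), om, la; split.
- by split; [exact: sa|exact: a1].
- move=> p; rewrite /singular_locus /= family_rank_lt.
  have XpE : X p = a ord0 p *: Y0 p + \sum_i a (lift ord0 i) p *: Y i p.
    by rewrite XE /B (frame_sum Y0 Y (fun i A => a i p *: A p)).
  have setTE (v : 'I_n.+1 -> (G -> R) -> R) (c : 'I_n.+1 -> R) :
      \sum_(i in [set: 'I_n.+1]%SET) c i *: v i = \sum_i c i *: v i.
    by apply: eq_bigl => k; rewrite inE.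
  split=> [nind|ap0 ind].
    apply: contrapT => /eqP ap; apply: nind => c; rewrite setTE.
    rewrite (frame_sum X Y (fun i A => c i *: A p)) XpE scalerDr scalerA -addrA.
    rewrite scaler_sumr -big_split /= => E.
    pose d i := if unlift ord0 i is Some j then c ord0 * a i p + c i else c ord0 * a ord0 p.
    have dE : \sum_i d i *: B i p = \sum_i (fun=> 0 : R) i *: B i p.
      rewrite [RHS]big1; last by move=> k _; rewrite scale0r.
      rewrite /B (frame_sum Y0 Y (fun i A => d i *: A p)) -[RHS]E /d unlift_none.
      congr (_ + _); apply: eq_bigr => i _.
      by rewrite liftK scalerA scalerDl.
    have d0 := frame_coef_uniq lB indB dE.
    have c0 : c ord0 = 0.
      have /eqP := d0 ord0; rewrite /d unlift_none mulf_eq0 (negbTE ap) orbF.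
      by move/eqP.
    move=> i _; case: (unliftP ord0 i) => [j ->|->//].
    by have := d0 (lift ord0 j); rewrite /d liftK c0 mul0r add0r.
  pose c i := if unlift ord0 i is Some j then - a i p else 1.
  have := ind c; rewrite setTE (frame_sum X Y (fun i A => c i *: A p)) XpE ap0.
  rewrite {1 2}/c unlift_none scale0r add0r scale1r -big_split big1 => [|i _].
    move=> /(_ erefl ord0); rewrite inE => /(_ isT); rewrite /c unlift_none => /eqP.
    by rewrite oner_eq0.
  by rewrite /= liftK scaleNr addrN.
- exact: spanP.
- move=> A p lA; rewrite DE -omF.
  have := aD_eta om A p lA (fun d C C' => @cfl d C C' ord0).
  rewrite (la_om A (F p) lA (lF p)) -?uE//; last first.
  move=> <-; rewrite (bigD1 ord0)//= big1.
    by rewrite addr0 /om (cf_basis lB indB cfE) eqxx mul1r.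
  by move=> i i0; rewrite /om (cf_basis lB indB cfE) eq_sym (negbTE i0) mul0r.
- apply: contrapT => H.
  have omD A : left_invariant A -> om (assoc_derivation X A) = 0.
    by move=> lA; apply: contrapT => /eqP nz; apply: H; exists A.
  (* If om o D = 0, the span of Y is stable under brackets with X, so every generated
     field has at 1 a value in this span; but Y0 is transverse to it. *)
  have spanX A : linear_span (range Y) A -> linear_span (range Y) (bracket X A).
    move=> /spanL lA; apply/(spanP _ (bracket_linear_left_invariant lX lA)).
    have E : bracket X A = -1 *: assoc_derivation X A + 0.
      by rewrite addr0 scaleN1r opprK.
    rewrite E /om cfl; [|exact: D_in|exact: left_invariant0].
    rewrite -!/(om _) (omD A lA) mulr0 add0r.
    by apply/(spanP _ left_invariant0); exact: (linear_span_closed (range Y)).1.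
  have : tangent_space (1%g : G) (Y0 1%g) by exact: vfield_tangent (vL _ lY0).
  rewrite -gen => -[W genW W1].
  have [c [A [SA WE]]] := lie_generated_decomp lX spanL (linear_span_closed (range Y))
    subY spanX (fun i => sub_linear_span (ex_intro2 _ _ i I erefl)) genW.
  have lA := spanL _ SA.
  have A1 : A 1%g = Y0 1%g.
    rewrite -W1 WE -[RHS]/(c *: X 1%g + A 1%g).
    by rewrite (linear_field_1 lX) scaler0 add0r.
  move: omY0; rewrite -(left_invariant_ext lA lY0 A1) => /eqP; apply.
  exact/(spanP _ lA).
Qed.

End DefiningFunction.

(** * Slice charts of a submersion *)
Section SwapCoord.
Context {R : realType} {m : nat}.
Variables (i j : 'I_m).

Definition swap_coord (x : 'rV[R]_m) : 'rV[R]_m := xcol i j x.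

Lemma swap_coordE x k : swap_coord x 0 k = x 0 (tperm i j k).
Proof. by rewrite mxE. Qed.

Lemma swap_coordK : involutive swap_coord.
Proof. by move=> x; apply/rowP => k; rewrite !swap_coordE tpermK. Qed.

Lemma swap_coord_affine y (h : R) w :
  swap_coord (h *: w + y) = h *: swap_coord w + swap_coord y.
Proof. by apply/rowP => k; rewrite !mxE. Qed.

Lemma swap_coord_smooth x : smooth_at swap_coord x.
Proof.
apply/smooth_at_rV => k; under eq_fun do rewrite swap_coordE.
by apply: (smooth_on_smooth_at openT I) => l; exact: Ck_coord.
Qed.

Lemma swap_coord_delta : swap_coord (delta_mx 0 j) = delta_mx 0 i.
Proof. by apply/rowP => k; rewrite swap_coordE !mxE eqxx/= (canF_eq (tpermK i j)) tpermR. Qed.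

End SwapCoord.

Section SliceChart.
Context {R : realType} {n : nat} {M : manifoldType R n.+1}.

(** Some partial derivative of f is nonzero at p.  Exchanging this coordinate with
the last one and scaling f makes the last derivative equal to 1 at p, so that f
can replace the last coordinate.  Scaling also gets rid of the sign, which is why
the constant c is there. *)
Lemma submersion_chart (f : M -> R) (p : M) (v : (M -> R) -> R) :
  smooth_germ p f -> tangent_space p v -> v f != 0 ->
  exists (a : chart R n.+1 M) (c : R), [/\ admissible a, chart_dom a p, c != 0 &
    forall q, chart_dom a q -> chart_map a q 0 ord_max = c * f q].
Proof.
move=> fp tv vf; have [a Aa ap] := atlas_cover p.
have [j dj] : exists j, partial a j f p != 0.
  apply: contrapT => H; move: vf; rewrite (tangent_coord Aa ap tv fp) big1 ?eqxx// => j _.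
  have [->|nz] := eqVneq (partial a j f p) 0; first by rewrite mulr0.
  by exfalso; apply: H; exists j.
pose c := (partial a j f p)^-1.
pose P := @swap_coord R n.+1 j ord_max.
pose u0 : 'rV[R]_n.+1 -> R^o := f \o chart_inv a.
pose u y : R^o := c * u0 (P y).
pose y0 := P (chart_map a p).
have Py0 : P y0 = chart_map a p by exact: swap_coordK.
have cP y : {for y, continuous P} := smooth_at_continuous (swap_coord_smooth j ord_max y).
have su0 : smooth_at (u0 \o P) y0.
  apply: (smooth_at_affine cP (swap_coord_affine _ _)); rewrite Py0; exact: fp.
have su : smooth_at u y0 by exact: smooth_atZ.
have du : 'D_(delta_mx 0 ord_max) u y0 = 1.
  rewrite /u (deriveZ _ (smooth_at_derivable su0)).
  rewrite (@derive_affine _ _ _ _ u0 P y0 _ (delta_mx 0 j)); last first.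
    by move=> h; rewrite /P swap_coord_affine swap_coord_delta.
  by rewrite Py0 -[_ *: _]/(c * partial a j f p) mulVf.
have npos : nbhs y0 [set y | 0 < 'D_(delta_mx 0 ord_max) u y].
  have cD := smooth_at_continuous (smooth_at_derive (delta_mx 0 ord_max) su).
  have pos : nbhs ('D_(delta_mx 0 ord_max) u y0) [set t : R | 0 < t].
    by apply: open_nbhs_nbhs; split; [exact: open_gt|rewrite /= du ltr01].
  exact: cD _ pos.
have [U [oU Uy0 sU uU]] := smooth_at_nbhs su npos.
have [r /= r0 rU] := (nbhs_ballP _ _).1 (open_nbhs_nbhs (conj oU Uy0)).
have uB : smooth_on (ball y0 r) u by move=> k; exact: Ck_sub (uU k).
have uj y : ball y0 r y -> 0 < 'D_(delta_mx 0 ord_max) u y by move=> /rU/sU.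
pose B := ball y0 r.
have oB : open B by exact: ball_open.
pose Phi := repl_coord u ord_max.
pose Psi := repl_coord_inv u ord_max y0 r.
have PsiK y : B y -> Psi (Phi y) = y by exact: repl_coordK.
pose dom := [set q | chart_dom a q /\ B (P (chart_map a q))].
pose kmap q := Phi (P (chart_map a q)).
pose kinv y := chart_inv a (P (Psi y)).
have nearB q : dom q -> nbhs (chart_map a q) (P @^-1` B).
  by move=> [aq Bq]; apply: cP; exact: open_nbhs_nbhs.
have odom : open dom.
  rewrite openE => q dq; have [aq Bq] := dq.
  apply: (filterS _ (filterI (near_chart_dom aq) (near_chart_map aq (nearB q dq)))).
  by move=> q' [].
have PhiP q : dom q -> Psi (kmap q) = P (chart_map a q) by move=> [_]; exact: PsiK.
have kK : {in dom, cancel kmap kinv}.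
  move=> q; rewrite inE => dq; rewrite /kinv PhiP// /P swap_coordK chart_invK//.
  by case: dq.
have ocodom : open (kmap @` dom).
  rewrite openE => _ [q dq <-]; have [aq Bq] := dq.
  have nc : nbhs (P (chart_map a q)) (P @^-1` (chart_map a @` chart_dom a)).
    apply: cP; rewrite /P swap_coordK; exact: near_chart_codom.
  rewrite /interior; have H := repl_coord_open uB uj Bq nc.
  apply: (filterS _ H) => _ [z [[q' aq' q'E] Bz] <-].
  have zE : P (chart_map a q') = z by rewrite q'E /P swap_coordK.
  by exists q'; [split=> //; rewrite zE|rewrite /kmap zE].
have ckmap : {in dom, continuous kmap}.
  move=> q; rewrite inE => -[aq Bq].
  apply: (@continuous_comp _ _ _ (P \o chart_map a) Phi q).
    apply: (@continuous_comp _ _ _ (chart_map a) P q); last exact: cP.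
    by apply: chart_map_continuous; rewrite inE.
  exact: Ck_continuous (repl_coord_smooth ord_max uB 0%N) Bq.
have sPsi y : (Phi @` B) y -> smooth_at Psi y.
  move=> By; apply: (smooth_on_smooth_at _ By).
    exact: (repl_coord_image_open uB uj).
  exact: (repl_coord_inv_smooth uB uj).
have PhiB q : dom q -> (Phi @` B) (kmap q) by move=> [_ Bq]; exists (P (chart_map a q)).
have sPPsi q : dom q -> smooth_at (P \o Psi) (kmap q).
  by move=> dq; apply: smooth_at_comp_rV; [exact/sPsi/PhiB|exact: swap_coord_smooth].
have PPsi q : dom q -> (P \o Psi) (kmap q) = chart_map a q.
  by move=> dq; rewrite /= PhiP// /P swap_coordK.
have ckinv : {in kmap @` dom, continuous kinv}.
  move=> y; rewrite inE => -[q dq <-].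
  apply: (@continuous_comp _ _ _ (P \o Psi) (chart_inv a) (kmap q)).
    exact: smooth_at_continuous (sPPsi q dq).
  rewrite PPsi//; apply: chart_inv_continuous; rewrite inE; exists q => //.
  by case: dq.
pose k := Chart odom ocodom kK ckmap ckinv.
exists k, c; split.
- move=> b Ab q [aq Bq] bq; have [ab ba] := atlas_compatible a b Aa Ab q aq bq.
  have dq : dom q by [].
  split.
    apply: (@smooth_at_comp_rV _ _ _ _ (P \o Psi) (chart_map b \o chart_inv a)).
      exact: sPPsi.
    rewrite (PPsi q dq); exact: ab.
  apply: (@smooth_at_comp_rV _ _ _ _ (P \o (chart_map a \o chart_inv b)) Phi).
    apply: smooth_at_comp_rV; [exact: ba|exact: swap_coord_smooth].
  apply: (smooth_on_smooth_at oB); first by rewrite /= chart_invK.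
  exact: (repl_coord_smooth ord_max uB).
- by split=> //; exact: ballxx.
- by rewrite invr_neq0.
- move=> q [aq Bq]; rewrite /= /kmap /Phi repl_coordE eqxx /u /u0 /= /P swap_coordK.
  by rewrite chart_invK.
Qed.

End SliceChart.

(** * Level sets and the singular locus *)
Section LevelSets.
Context {R : realType} {n : nat} {M : manifoldType R n.+1}.
Variables (f : M -> R) (S : set M).
Hypothesis sf : forall p, smooth_germ p f.
Hypothesis SE : forall p, S p <-> f p = 0.

Lemma level_submanifold :
  (forall p, S p -> exists2 v, tangent_space p v & v f != 0) ->
  embedded_submanifold n S.
Proof.
move=> sub; split=> // p /sub[v tv vf].
have [a [c [Aa ap c0 aE]]] := submersion_chart (@sf p) tv vf.
exists a; split=> // q aq; split=> [/SE fq i ni|H].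
  have -> : i = ord_max by apply/val_inj/eqP; rewrite eqn_leq ni -ltnS ltn_ord.
  by rewrite aE// fq mulr0.
apply/SE/eqP; have /eqP := H ord_max (leqnn n).
by rewrite aE// mulf_eq0 (negbTE c0).
Qed.

(** In a slice chart the straight line issued from p in the direction of v stays
in S when the last component of v, which is v f up to a factor, is zero. *)
Lemma tangent_to_level p v : S p -> (exists2 w, tangent_space p w & w f != 0) ->
  tangent_to S p v <-> tangent_space p v /\ v f = 0.
Proof.
move=> Sp [w tw wf]; split=> [[tv [c [c0 cS _ _ cd]]]|[tv vf]]; split=> //.
  have [_ <-] := cd f (@sf p).
  rewrite (@near_eq_derive _ _ _ (f \o c : R^o -> R^o) (cst 0)).
    exact: derive_cst.
  by apply: (filterS _ cS) => t /SE.
have [a [k [Aa ap k0 aE]]] := submersion_chart (@sf p) tw wf.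
pose x i q : R := chart_map a q 0 i.
pose u : 'rV[R]_n.+1 := \row_i v (x i).
pose y0 := chart_map a p.
pose line (t : R) := t *: u + y0.
have line0 : line 0 = y0 by rewrite /line scale0r add0r.
have cl : {for 0, continuous line} by exact: line_continuous.
have ulast : u 0 ord_max = 0.
  rewrite mxE; have H : \forall q \near p, (k *: f) q = x ord_max q.
    by apply: (filterS _ (near_chart_dom ap)) => q aq; rewrite /x aE.
  rewrite -(tangent_eq tv (smooth_germZ k (@sf p)) H) (tangentZ _ tv (@sf p)).
  by rewrite vf mulr0.
have ylast : y0 0 ord_max = 0 by rewrite /y0 aE// (SE p).1// mulr0.
exists (chart_inv a \o line); split.
- by rewrite /= line0 chart_invK.
- have N : nbhs (line 0) (chart_map a @` chart_dom a).
    by rewrite line0; exact: near_chart_codom.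
  have N' : nbhs (0 : R) [set t | (chart_map a @` chart_dom a) (line t)] := cl _ N.
  apply: (filterS _ N') => t [q aq qE] /=; rewrite -qE chart_invK//; apply/SE.
  have := aE q aq; rewrite qE /line !mxE ylast.
  move: ulast; rewrite mxE => ->; rewrite mulr0 add0r => /esym/eqP.
  by rewrite mulf_eq0 (negbTE k0) => /eqP.
- apply: (@continuous_comp _ _ _ line (chart_inv a) 0); first exact: cl.
  by apply: chart_inv_continuous; rewrite inE; exists p.
- move=> b Ab bp; have [ab _] := Aa b Ab p ap bp.
  apply: (@smooth_at_affine _ R^o _ _ (chart_map b \o chart_inv a) line (fun h => h *: u)).
  + exact: line_continuous.
  + by move=> s h t; rewrite /line scalerDl scalerA addrA.
  + by rewrite line0; exact: ab.
move=> g gp; have sg := (smooth_germ_admissible g Aa ap).2 gp.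
have dg : derivable (g \o chart_inv a : _ -> R^o) (0 *: u + y0) u.
  by rewrite -/(line 0) line0; exact: smooth_at_derivable.
apply: DeriveDef; first exact: line_derivable dg.
rewrite (line_derive (g \o chart_inv a : _ -> R^o) y0 u 0) -/(line 0) line0.
rewrite (tangent_admissible Aa ap tv gp).
have /smooth_atP[U [oU Uy gU]] := sg.
rewrite (C1_differentiable oU (gU 1%N) Uy).2; apply: eq_bigr => i _.
by rewrite mxE.
Qed.

End LevelSets.

Unset Implicit Arguments.

Theorem theorem2 (R : realType) (n : nat) (G : lieGroupType R n.+1)
    (X : vfield R G) (Y : 'I_n -> vfield R G) :
  connected [set: G] ->
  simple_ARS X Y ->
  lie_solvable (@left_invariant R n.+1 G) ->
  lie_subalgebra (linear_span (range Y)) ->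
  [/\ group_closed [in singular_locus X Y],
    embedded_submanifold n (singular_locus X Y) &
    lie_algebra_of (singular_locus X Y) =
      [set A | left_invariant A /\ linear_span (range Y) (assoc_derivation X A)]].
Proof.
move=> cG ars sol sub; have [lX _ _ _] := ars.
have [f [om [la [[sf f1] SE spanE Af [E lE omE]]]]] := singular_locus_function cG ars sol sub.
have [Y0 lY0 indB] := ars_basis ars.
have lB i : left_invariant (frame Y0 Y i).
  by rewrite /frame; case: (unlift ord0 i) => [j|//]; have [_ lY _ _] := ars.
have lD A : left_invariant A -> left_invariant (assoc_derivation X A).
  move=> lA; rewrite /assoc_derivation -[- _]addr0 -scaleN1r.
  apply: left_invariant_comb left_invariant0.
  exact: bracket_linear_left_invariant.
(* The inhomogeneous term of the equation of f is unchanged by left translation,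
   so it disappears from the equation of the difference. *)
have fM g : f g = 0 -> forall h, f (g * h)%g = f h.
  move=> fg h; apply/eqP; rewrite -subr_eq0; apply/eqP.
  have sg q : smooth_germ q (fun x => f (g * x)%g) by apply: smooth_germ_lmul; exact: sf.
  pose u := (fun x => f (g * x)%g) - f.
  have su q : smooth_germ q u.
    by rewrite /u -scaleN1r; exact: smooth_germD (@sg q) (smooth_germZ (-1) (@sf q)).
  apply: (propagation lB indB (u := u) (ka := fun i => - la (frame Y0 Y i)) cG su).
  - move=> i q; have [vB lBi] := lB i.
    rewrite (tangentB (vfield_tangent q vB) (@sg q) (@sf q)) -(lBi g q f (@sf _)).
    by rewrite !Af// /u !fctE; ring.
  - by rewrite /u !fctE mulg1 fg f1 subr0.
(* Where f vanishes its derivative along E is om (D E), a nonzero constant. *)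
have tE p : singular_locus X Y p -> exists2 w, tangent_space p w & w f != 0.
  move=> /SE fp; have [vE _] := lE; exists (E p); first exact: vfield_tangent.
  by rewrite Af// fp mulr0 subr0.
split.
- split=> [|g h]; rewrite !inE; first exact/SE.
  move=> /SE fg /SE fh; apply/SE; rewrite fM//.
  by rewrite -(fM h fh) mulgV.
- exact: level_submanifold sf SE tE.
- have S1 : singular_locus X Y 1%g by exact/SE.
  apply/seteqP; split=> A [lA H]; split=> //.
    apply/(spanE _ (lD _ lA)).
    have [_] := (tangent_to_level sf SE (A 1%g) S1 (tE _ S1)).1 H.
    by rewrite Af// f1 mulr0 subr0.
  apply/(tangent_to_level sf SE (A 1%g) S1 (tE _ S1)).
  have [vA _] := lA; split; first exact: vfield_tangent.
  by rewrite Af// f1 mulr0 subr0; exact/(spanE _ (lD _ lA)).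
Qed.
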